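(* Consider the compound MAC model in which both receivers have the same side information $W_1=W_2=W$ and $S_1-W-S_2$ forms a Markov chain. Source-channel rate $b$ is achievable if there exist $Q$ with $|\mathcal{Q}|\le4$ and a distribution $p(q)p(x_1|q)p(x_2|q)$ such that for $k=1,2$: $$H(S_1|W)<b\,I(X_1;Y_k|X_2,Q),\quad H(S_2|W)<b\,I(X_2;Y_k|X_1,Q),\quad H(S_1|W)+H(S_2|W)<b\,I(X_1,X_2;Y_k|Q).$$ Conversely, if $b$ is achievable then these inequalities hold with $<$ replaced by $\le$ for some distribution of the same form.
   Context: Compound MAC model: $\{(S_{1,k},S_{2,k},W_{1,k},W_{2,k})\}_{k\ge1}$ i.i.d. $\sim p(s_1,s_2,w_1,w_2)$ on finite alphabets. Transmitter $i\in\{1,2\}$ observes $S_i^m$ and sends $X_i^n=f_i^{(m,n)}(S_i^m)$. The channel $p(y_1,y_2|x_1,x_2)$ is discrete memoryless with finite alphabets. Receiver $k\in\{1,2\}$ observes $(Y_k^n,W_k^m)$ and outputs $(\hat S_{k,1}^m,\hat S_{k,2}^m)=g_k^{(m,n)}(Y_k^n,W_k^m)$, an estimate of both sources. Error probability $P_e^{(m,n)}=\Pr\{\bigcup_{k=1,2}\{(S_1^m,S_2^m)\neq(\hat S_{k,1}^m,\hat S_{k,2}^m)\}\}$. Rate $b$ is achievable if for every $\epsilon>0$ there exist positive integers $m,n$ with $n/m=b$ and encoders/decoders with $P_e^{(m,n)}<\epsilon$.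
   Formalization: In the direct part, b is assumed to be a positive rational n/m, since achievability requires positive integers m, n with n/m = b exactly, so the claim fails for irrational b. *)

(* Defs.v *)
From Stdlib Require Import Reals.
From mathcomp Require Import all_boot.

Set Implicit Arguments.
Unset Strict Implicit.
Unset Printing Implicit Defensive.

Local Open Scope R_scope.

Definition rsum (T : finType) (A : pred T) (F : T -> R) : R :=
  \big[Rplus/R0]_(t | A t) F t.

Definition is_pmf (T : finType) (P : T -> R) : Prop :=
  (forall t, 0 <= P t) /\ rsum predT P = 1.

Definition prob (T : finType) (P : T -> R) (E : pred T) : R := rsum E P.

(* conditional entropy H(A|C) (natural log; convention 0 log 0 = 0, which
   holds automatically since terms are multiplied by P t) *)
Definition cond_entropy (T : finType) (P : T -> R) (A C : finType)
  (fa : T -> A) (fc : T -> C) : R :=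
  - rsum predT (fun t => P t *
      ln (prob P (fun u => (fa u == fa t) && (fc u == fc t)) /
          prob P (fun u => fc u == fc t))).

Definition cond_mutual_info (T : finType) (P : T -> R) (A B C : finType)
  (fa : T -> A) (fb : T -> B) (fc : T -> C) : R :=
  rsum predT (fun t => P t *
    ln (prob P (fun u => [&& fa u == fa t, fb u == fb t & fc u == fc t]) *
        prob P (fun u => fc u == fc t) /
        (prob P (fun u => (fa u == fa t) && (fc u == fc t)) *
         prob P (fun u => (fb u == fb t) && (fc u == fc t))))).

Definition markov (T : finType) (P : T -> R) (A B C : finType)
  (fa : T -> A) (fb : T -> B) (fc : T -> C) : Prop :=
  forall a b c,
    prob P (fun u => [&& fa u == a, fb u == b & fc u == c]) *
    prob P (fun u => fc u == c) =
    prob P (fun u => (fa u == a) && (fc u == c)) *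
    prob P (fun u => (fb u == b) && (fc u == c)).

Section Model.
Variables (S1 S2 W X1 X2 Y1 Y2 : finType).

(* Error probability of an (m,n) code for the compound MAC with common side
   information W_1 = W_2 = W.  Source pmf p(s1,s2,w) (i.i.d.), channel
   ch x1 x2 (y1,y2) = p(y1,y2|x1,x2) (memoryless). *)
Definition err_prob (m n : nat) (p : S1 * S2 * W -> R)
  (ch : X1 -> X2 -> Y1 * Y2 -> R)
  (f1 : m.-tuple S1 -> n.-tuple X1) (f2 : m.-tuple S2 -> n.-tuple X2)
  (g1 : n.-tuple Y1 -> m.-tuple W -> m.-tuple S1 * m.-tuple S2)
  (g2 : n.-tuple Y2 -> m.-tuple W -> m.-tuple S1 * m.-tuple S2) : R :=
  rsum predT (fun s : m.-tuple S1 * m.-tuple S2 * m.-tuple W =>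
    (\big[Rmult/R1]_(i < m) p (tnth s.1.1 i, tnth s.1.2 i, tnth s.2 i)) *
    rsum predT (fun y : n.-tuple Y1 * n.-tuple Y2 =>
      (\big[Rmult/R1]_(j < n)
          ch (tnth (f1 s.1.1) j) (tnth (f2 s.1.2) j) (tnth y.1 j, tnth y.2 j)) *
      (if (g1 y.1 s.2 != s.1) || (g2 y.2 s.2 != s.1) then 1 else 0))).

Definition achievable (p : S1 * S2 * W -> R) (ch : X1 -> X2 -> Y1 * Y2 -> R)
  (b : R) : Prop :=
  forall eps, 0 < eps ->
    exists m n : nat, (0 < m)%N /\ (0 < n)%N /\ INR n / INR m = b /\
      exists f1 f2 g1 g2, @err_prob m n p ch f1 f2 g1 g2 < eps.

Definition code_joint (Q : finType) (pq : Q -> R) (px1 : Q -> X1 -> R)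
  (px2 : Q -> X2 -> R) (ch : X1 -> X2 -> Y1 * Y2 -> R)
  (t : Q * X1 * X2 * (Y1 * Y2)) : R :=
  pq t.1.1.1 * px1 t.1.1.1 t.1.1.2 * px2 t.1.1.1 t.1.2 * ch t.1.1.2 t.1.2 t.2.

Definition region_cond (rel : R -> R -> Prop) (p : S1 * S2 * W -> R)
  (ch : X1 -> X2 -> Y1 * Y2 -> R) (b : R)
  (Q : finType) (pq : Q -> R) (px1 : Q -> X1 -> R) (px2 : Q -> X2 -> R) : Prop :=
  let P := code_joint pq px1 px2 ch in
  let q  := fun t : Q * X1 * X2 * (Y1 * Y2) => t.1.1.1 in
  let x1 := fun t : Q * X1 * X2 * (Y1 * Y2) => t.1.1.2 in
  let x2 := fun t : Q * X1 * X2 * (Y1 * Y2) => t.1.2 in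
  let y1 := fun t : Q * X1 * X2 * (Y1 * Y2) => t.2.1 in
  let y2 := fun t : Q * X1 * X2 * (Y1 * Y2) => t.2.2 in
  let H1 := cond_entropy p (fun t => t.1.1) (fun t => t.2) in
  let H2 := cond_entropy p (fun t => t.1.2) (fun t => t.2) in
  rel H1 (b * cond_mutual_info P x1 y1 (fun t => (x2 t, q t))) /\
  rel H2 (b * cond_mutual_info P x2 y1 (fun t => (x1 t, q t))) /\
  rel (H1 + H2) (b * cond_mutual_info P (fun t => (x1 t, x2 t)) y1 q) /\
  rel H1 (b * cond_mutual_info P x1 y2 (fun t => (x2 t, q t))) /\
  rel H2 (b * cond_mutual_info P x2 y2 (fun t => (x1 t, q t))) /\
  rel (H1 + H2) (b * cond_mutual_info P (fun t => (x1 t, x2 t)) y2 q).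

Definition region_exists (rel : R -> R -> Prop) (p : S1 * S2 * W -> R)
  (ch : X1 -> X2 -> Y1 * Y2 -> R) (b : R) : Prop :=
  exists (Q : finType) (pq : Q -> R) (px1 : Q -> X1 -> R) (px2 : Q -> X2 -> R),
    (#|Q| <= 4)%N /\ is_pmf pq /\ (forall q, is_pmf (px1 q)) /\
    (forall q, is_pmf (px2 q)) /\ region_cond rel p ch b pq px1 px2.

End Model.

(* Main.v *)
Require Import Defs.
From Stdlib Require Import Reals.
From mathcomp Require Import all_boot all_order all_algebra.
From mathcomp Require Import Rstruct Rstruct_topology.
From mathcomp Require Import boolp classical_sets reals topology normedtype sequences exp.
From mathcomp Require Import derive realfun.
From mathcomp Require Import ring lra.
Set Implicit Arguments.
Unset Strict Implicit.
Unset Printing Implicit Defensive.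
Import Order.TTheory GRing.Theory Num.Theory.
Import numFieldNormedType.Exports.
Local Open Scope ring_scope.
Local Notation "'\1[' b ]" := ((nat_of_bool b%R)%:R)
  (at level 0, b at level 200, format "'\1[' b ]").

(* Achievability: every source sequence gets an independent random codeword, drawn given a
   common time-sharing sequence, and no separate source code is used. A receiver accepts
   [(s1, s2)] if three products [prod p(s|w) * prod V(y|x1,x2)/p(y|..)], one for each set of
   possibly wrong sources, exceed [exp (t d)]. The true pair fails a test with exponentially small
   probability (Chernoff); since the mean of each product, summed over the wrong sequences, is at
   most [1], Markov's inequality bounds the false alarms by [exp (- t d)].

   Converse: given the side information the two codewords are independent, so [Q = (W^m, J)] with
   [J] uniform is a legitimate time-sharing variable. Each inequality, up to a Fano term, is the
   nonnegativity of a single divergence.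

   Cardinality: for each [q] the three informations of a receiver bound a pentagon, a polymatroid,
   and the pentagon of the averaged informations is the Minkowski average of these pentagons. So a
   point of it splits into points of the pentagons, leaving two linear conditions per receiver,
   four in all; conic Caratheodory, where the total weight is only asked to be at most [1], then
   keeps four values of [q]. With [Q] fixed, compactness and continuity remove the error terms. *)

(** * Finite probability *)

Section FiniteProbability.
Variable R : realType.

(** Achievability asks for the ratio [n / m = b] exactly, so a code uses [m0 * t] letters and
    [n0 * t] channel uses for a fixed pair [(m0, n0)], and every error bound has the form [K ^+ t]
    with [K < 1] chosen before [t]. Since source and channel factors sit in the same product, the
    mean of its logarithm is [t] times [- m0 H + n0 I]: its positivity is the rate condition itself,
    and no intermediate rate has to be chosen.

    In the converse the alphabet of [(W^m, J)] grows with the code, while the Fano term disappears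
    only along a sequence of codes. A limit of their input laws makes sense on a fixed alphabet
    only, so the reduction to four values comes before the limit, not after it. The six inequalities
    taken as they stand would give six points; the splitting of the sum information removes one
    condition per receiver. The total weight may drop below [1] because informations are
    nonnegative, so the missing weight can be put on any point.

    Division by [0] and [ln] of a nonpositive number return default values; logarithms are therefore
    split or combined only on the support of the law that weighs them. *)

Definition pmf (T : finType) (P : T -> R) := (forall t, 0 <= P t) /\ \sum_t P t = 1.

Lemma sum_pair (A B : finType) (F : A * B -> R) : \sum_p F p = \sum_a \sum_b F (a, b).
Proof. by rewrite pair_bigA; apply: eq_bigr => -[]. Qed.

Lemma pmf_witness (T : finType) (P : T -> R) : pmf P -> exists t, P t != 0.
Proof.
move=> [_ h]; apply: contrapT => /forallNP e; move: h; rewrite big1.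
  by move=> /esym/eqP; rewrite oner_eq0.
by move=> t _; apply/eqP; rewrite -[_ == _]negbK; apply/negP; exact: e.
Qed.

(* [U] enumerates the families of elements of [T] indexed by [I]; [k] reads the coordinates. *)
Definition families (I T U : finType) (k : U -> I -> T) :=
  forall F : I -> T -> R, \sum_u \prod_i F i (k u i) = \prod_i \sum_x F i x.

Lemma families_ffun (I T : finType) : families (fun (f : {ffun I -> T}) i => f i).
Proof. by move=> F; rewrite bigA_distr_bigA. Qed.

Lemma families_tuple (T : finType) n : families (@tnth n T).
Proof.
move=> F; rewrite -families_ffun.
rewrite (reindex (fun f : {ffun 'I_n -> T} => [tuple f i | i < n])) /=.
  by apply: eq_bigr => f _; apply: eq_bigr => i _; rewrite tnth_mktuple.
exists (fun t : n.-tuple T => [ffun i => tnth t i]) => /= f _.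
  by apply/ffunP => i; rewrite ffunE tnth_mktuple.
by apply: eq_from_tnth => i; rewrite tnth_mktuple ffunE.
Qed.

Lemma families_pair (I T1 T2 U1 U2 : finType) (k1 : U1 -> I -> T1) (k2 : U2 -> I -> T2) :
  families k1 -> families k2 -> families (fun (u : U1 * U2) i => (k1 u.1 i, k2 u.2 i)).
Proof.
move=> h1 h2 F; rewrite sum_pair /=.
under eq_bigr do rewrite (h2 (fun i b => F i (k1 _ i, b))).
rewrite (h1 (fun i a => \sum_b F i (a, b))); apply: eq_bigr => i _.
by rewrite sum_pair.
Qed.

Section Families.
Variables (I T U : finType) (k : U -> I -> T).
Hypothesis kP : families k.

Lemma families_sum1 (F : I -> T -> R) :
  (forall i, \sum_x F i x = 1) -> \sum_u \prod_i F i (k u i) = 1.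
Proof. by move=> h; rewrite kP big1. Qed.

Lemma families_le1 (F : I -> T -> R) : (forall i x, 0 <= F i x) ->
  (forall i, \sum_x F i x <= 1) -> \sum_u \prod_i F i (k u i) <= 1.
Proof.
move=> h0 h; rewrite kP; apply: prodr_ile1 => i _.
by rewrite h andbT; apply: sumr_ge0 => x _.
Qed.

(** The function [a] of one coordinate is absorbed into factor [i], so the summand is again a
    product and the remaining factors sum to [1]. The next lemma does the same with two distinct
    coordinates. *)
Lemma families_marginal (F : I -> T -> R) i (a : T -> R) :
  (forall j, \sum_x F j x = 1) ->
  \sum_u (\prod_j F j (k u j)) * a (k u i) = \sum_x F i x * a x.
Proof.
move=> h.
have -> : \sum_u (\prod_j F j (k u j)) * a (k u i) =
    \sum_u \prod_j (F j (k u j) * (if j == i then a (k u j) else 1)).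
  apply: eq_bigr => u _; rewrite big_split /=; congr (_ * _).
  by rewrite -big_mkcond big_pred1_eq.
rewrite (kP (fun j x => F j x * (if j == i then a x else 1))) (bigD1 i) //= eqxx.
rewrite [X in _ * X]big1 ?mulr1 // => j /negPf ->.
by under eq_bigr do rewrite mulr1.
Qed.

Lemma families_indep (F : T -> R) i j (a b : T -> R) : i != j ->
  \sum_x F x = 1 ->
  \sum_u (\prod_l F (k u l)) * (a (k u i) * b (k u j)) =
  (\sum_x F x * a x) * (\sum_x F x * b x).
Proof.
move=> ij h.
have -> : \sum_u (\prod_l F (k u l)) * (a (k u i) * b (k u j)) =
    \sum_u \prod_l (F (k u l) * ((if l == i then a (k u l) else 1) *
                                 (if l == j then b (k u l) else 1))).
  apply: eq_bigr => u _; rewrite !big_split /=; congr (_ * (_ * _));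
  by rewrite -big_mkcond big_pred1_eq.
rewrite (kP (fun l x => F x * ((if l == i then a x else 1) * (if l == j then b x else 1)))).
have ji : j != i by rewrite eq_sym.
rewrite (bigD1 i) //= (bigD1 j) //= !eqxx (negPf ij) (negPf ji).
rewrite [X in _ * (_ * X)]big1 ?mulr1; last first.
  by move=> l /andP[/negPf -> /negPf ->]; under eq_bigr do rewrite !mulr1.
by congr (_ * _); apply: eq_bigr => x _; rewrite ?mulr1 ?mul1r.
Qed.

End Families.

Lemma prodr_gt0_all (I : finType) (F : I -> R) : (forall i, 0 <= F i) ->
  0 < \prod_i F i -> forall i, 0 < F i.
Proof.
move=> h0 h i; rewrite lt0r h0 andbT; apply/negP => /eqP e.
by move: h; rewrite (bigD1 i) //= e mul0r ltxx.
Qed.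

Lemma ln_prod (I : finType) (F : I -> R) : (forall i, 0 < F i) ->
  ln (\prod_i F i) = \sum_i ln (F i).
Proof.
move=> h; apply: (@expR_inj R); rewrite lnK ?posrE ?prodr_gt0 // expR_sum.
by apply: eq_bigr => i _; rewrite lnK // posrE.
Qed.

Lemma ln_leB1 (x : R) : 0 < x -> ln x <= x - 1.
Proof.
move=> x0; have {1}-> : x = 1 + (x - 1) by ring.
by apply: le_ln1Dx; lra.
Qed.

(** Termwise [ln x >= 1 - 1 / x] at [x = P t / D t]. [D] may have smaller mass than [P], which is
    the form needed for reference laws that are only known to be subprobabilities. *)
Lemma gibbs (T : finType) (P D : T -> R) : (forall t, 0 <= P t) ->
  (forall t, 0 <= D t) -> (forall t, 0 < P t -> 0 < D t) ->
  \sum_t D t <= \sum_t P t -> 0 <= \sum_t P t * ln (P t / D t).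
Proof.
move=> P0 D0 PD le; apply: (@le_trans _ _ (\sum_t (P t - D t))).
  by rewrite sumrB subr_ge0.
apply: ler_sum => t _; have [->|/eqP Pt] := eqVneq (P t) 0.
  by rewrite mul0r sub0r oppr_le0.
have Pp : 0 < P t by rewrite lt0r P0 andbT; apply/eqP.
have Dp := PD _ Pp.
rewrite -[P t / D t]invrK lnV ?posrE ?invr_gt0 ?divr_gt0 // invf_div mulrN.
rewrite -opprB lerN2.
apply: (@le_trans _ _ (P t * (D t / P t - 1))).
  by rewrite ler_pM2l // ln_leB1 // divr_gt0.
by rewrite mulrBr mulr1 mulrCA divff ?mulr1 // gt_eqF.
Qed.

(** Inverting [1 + v <= expR v] reduces the claim to [(1 - v + c v^2) (1 + v) >= 1], that is
    [c - 1 + c v >= 0]; on [v >= - 1 / 2] the least such [c] is [2]. *)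
Lemma expRN_le (v : R) : `|v| <= 1 / 2 -> expR (- v) <= 1 - v + 2 * v ^+ 2.
Proof.
rewrite ler_norml => /andP[h1 h2]; rewrite expRN.
have e1 := expR_ge1Dx v.
have v1 : 0 < 1 + v by lra.
apply: (@le_trans _ _ (1 + v)^-1); first by rewrite lef_pV2 ?posrE ?expR_gt0.
rewrite -[leLHS]mul1r ler_pdivrMr //.
have : 0 <= v ^+ 2 * (1 + 2 * v) by apply: mulr_ge0; [exact: sqr_ge0|lra].
have -> : (1 - v + 2 * v ^+ 2) * (1 + v) = 1 + v ^+ 2 * (1 + 2 * v) by ring.
lra.
Qed.

(** Expansion of the moment generating function at [0]: the slope is minus the mean and the
    remainder is quadratic, uniformly for small [s]. [B] bounds [|f|], and [s <= 1 / (2 B)] keeps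
    [s * f t] in the range of [expRN_le]. *)
Lemma mgf_le (T : finType) (P f : T -> R) : pmf P ->
  exists C s0 : R, [/\ 0 <= C, 0 < s0 & forall s, 0 < s -> s <= s0 ->
    \sum_t P t * expR (- (s * f t)) <= expR (- (s * \sum_t P t * f t) + s ^+ 2 * C)].
Proof.
move=> [P0 P1]; pose B := 1 + \sum_t `|f t|.
have sB : 0 <= \sum_t `|f t| by apply: sumr_ge0.
have B0 : 0 < B by rewrite /B; lra.
have fB t : `|f t| <= B.
  rewrite /B (bigD1 t) //= addrCA lerDl addr_ge0 //.
  by apply: sumr_ge0.
exists (2 * B ^+ 2), (1 / 2 / B); split; [|by rewrite !divr_gt0|].
  by rewrite mulr_ge0 ?sqr_ge0.
move=> s s0 sle.
have sB2 : s * B <= 1 / 2 by rewrite -ler_pdivlMr.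
apply: le_trans (expR_ge1Dx _).
apply: (@le_trans _ _ (\sum_t (P t - s * (P t * f t) + P t * (s ^+ 2 * (2 * B ^+ 2))))).
  apply: ler_sum => t _.
  have sf : `|s * f t| <= s * B by rewrite normrM gtr0_norm // ler_pM2l.
  have sq : (s * f t) ^+ 2 <= s ^+ 2 * B ^+ 2.
    by rewrite -real_normK ?num_real // -exprMn lerXn2r ?nnegrE // mulr_ge0 // ltW.
  have := expRN_le (le_trans sf sB2) => /(ler_wpM2l (P0 t)) /le_trans; apply.
  have -> : P t - s * (P t * f t) + P t * (s ^+ 2 * (2 * B ^+ 2)) =
     P t * (1 - s * f t + 2 * (s ^+ 2 * B ^+ 2)) by ring.
  by apply: ler_wpM2l => //; lra.
rewrite big_split /= sumrB -mulr_sumr -mulr_suml P1 mul1r.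
lra.
Qed.

Lemma chernoff_exponent (T1 T2 : finType) (P1 f1 : T1 -> R) (P2 f2 : T2 -> R)
    (m n : nat) (d : R) : pmf P1 -> pmf P2 ->
  d < m%:R * (\sum_t P1 t * f1 t) + n%:R * (\sum_t P2 t * f2 t) ->
  exists2 s, 0 < s & expR (s * d) * (\sum_t P1 t * expR (- (s * f1 t))) ^+ m *
                    (\sum_t P2 t * expR (- (s * f2 t))) ^+ n < 1.
Proof.
move=> p1 p2; set m1 := \sum_t P1 t * f1 t; set m2 := \sum_t P2 t * f2 t => hd.
have [C1 [s1 [C10 s10 h1]]] := mgf_le f1 p1.
have [C2 [s2 [C20 s20 h2]]] := mgf_le f2 p2.
set g := m%:R * m1 + n%:R * m2 - d.
have g0 : 0 < g by rewrite /g; lra.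
(* The [+ 1] only makes [C] positive. With [s * C <= g / 2] the exponent [s (s C - g - s)] is
   negative: the linear gain [s g] beats the quadratic loss. *)
set C := m%:R * C1 + n%:R * C2 + 1.
have C0 : 0 < C by rewrite /C ltr_wpDl // addr_ge0 // mulr_ge0.
pose s := Num.min (Num.min s1 s2) (g / (2 * C)).
have gC : 0 < g / (2 * C) by rewrite divr_gt0 // mulr_gt0.
have s0 : 0 < s by rewrite /s !lt_min s10 s20 gC.
exists s => //.
have ss1 : s <= s1 by rewrite /s !ge_min lexx.
have ss2 : s <= s2 by rewrite /s !ge_min lexx orbT.
have sg : s * C <= g / 2.
  have : s <= g / (2 * C) by rewrite /s !ge_min lexx orbT.
  move=> /(ler_wpM2r (ltW C0)) /le_trans; apply.
  by rewrite invfM -!mulrA mulVf ?mulr1 // gt_eqF.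
have pos (T : finType) (P f : T -> R) : pmf P -> 0 <= \sum_t P t * expR (- (s * f t)).
  by move=> [P0 _]; apply: sumr_ge0 => t _; rewrite mulr_ge0 // expR_ge0.
apply: le_lt_trans (_ : expR (s * d) * expR (- (s * m1) + s ^+ 2 * C1) ^+ m *
   expR (- (s * m2) + s ^+ 2 * C2) ^+ n < 1).
  apply: ler_pM; rewrite ?mulr_ge0 ?expR_ge0 ?exprn_ge0 //; do ?exact: pos.
    rewrite ler_pM2l ?expR_gt0 // lerXn2r ?nnegrE ?expR_ge0 //; first exact: pos.
    exact: h1.
  rewrite lerXn2r ?nnegrE ?expR_ge0 //; first exact: pos.
  exact: h2.
rewrite -!expRM_natl -!expRD expR_lt1.
have -> : s * d + m%:R * (- (s * m1) + s ^+ 2 * C1) + n%:R * (- (s * m2) + s ^+ 2 * C2)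
   = s * (s * C - g - s) by rewrite /C /g; ring.
by rewrite pmulr_rlt0 //; lra.
Qed.

End FiniteProbability.

(** * Information densities and threshold decoding *)

Section Information.
Variables (R : realType) (A B Z : finType).
Implicit Types (u : A -> R) (v : B -> R) (V : A -> B -> Z -> R).

(** For independent inputs with laws [u] and [v], the choices [D = out1 u V], [out2 v V],
    [out12 u v V] give I(X1;Z|X2), I(X2;Z|X1) and I(X1,X2;Z). The three output laws share one type
    so that a single functional covers them. *)
Definition info u v V (D : A -> B -> Z -> R) : R :=
  \sum_a \sum_b \sum_z u a * v b * V a b z * ln (V a b z / D a b z).
Definition out1 u V (_ : A) b z : R := \sum_a u a * V a b z.
Definition out2 v V a (_ : B) z : R := \sum_b v b * V a b z.
Definition out12 u v V (_ : A) (_ : B) z : R := \sum_a \sum_b u a * v b * V a b z.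

Lemma out1_le u V a b z : (forall a, 0 <= u a) -> (forall a b z, 0 <= V a b z) ->
  u a * V a b z <= out1 u V a b z.
Proof.
move=> u0 V0; rewrite /out1 (bigD1 a) //= lerDl.
by apply: sumr_ge0 => *; rewrite mulr_ge0.
Qed.

Lemma out2_le v V a b z : (forall b, 0 <= v b) -> (forall a b z, 0 <= V a b z) ->
  v b * V a b z <= out2 v V a b z.
Proof.
move=> v0 V0; rewrite /out2 (bigD1 b) //= lerDl.
by apply: sumr_ge0 => *; rewrite mulr_ge0.
Qed.

Lemma out12_le u v V a b z : (forall a, 0 <= u a) -> (forall b, 0 <= v b) ->
  (forall a b z, 0 <= V a b z) -> u a * v b * V a b z <= out12 u v V a b z.
Proof.
move=> u0 v0 V0; rewrite /out12 (bigD1 a) //= (bigD1 b) //= -addrA lerDl.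
apply: addr_ge0; first by apply: sumr_ge0 => *; rewrite !mulr_ge0.
by apply: sumr_ge0 => *; apply: sumr_ge0 => *; rewrite !mulr_ge0.
Qed.

End Information.

Section Miss.
Variable R : realType.

(** The indicator of a product below [expR (t d)] is at most that ratio to the power [- s]; the
    resulting sum factorizes over letters and uses into [t] copies of the Chernoff factor, which
    [chernoff_exponent] makes smaller than [1]. *)
Lemma miss_le (T1 T2 : finType) (P1 c : T1 -> R) (P2 r : T2 -> R) (m0 n0 : nat) (d : R) :
  pmf P1 -> pmf P2 -> (forall x, 0 < P1 x -> 0 < c x) -> (forall x, 0 < P2 x -> 0 < r x) ->
  d < m0%:R * (\sum_x P1 x * ln (c x)) + n0%:R * (\sum_x P2 x * ln (r x)) ->
  exists K : R, [/\ 0 <= K, K < 1 & forall t (U1 U2 : finType)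
    (k1 : U1 -> 'I_(m0 * t) -> T1) (k2 : U2 -> 'I_(n0 * t) -> T2),
    families R k1 -> families R k2 ->
    \sum_u1 \sum_u2 (\prod_i P1 (k1 u1 i)) * (\prod_j P2 (k2 u2 j)) *
      \1[(\prod_i c (k1 u1 i)) * (\prod_j r (k2 u2 j)) < expR (t%:R * d)] <= K ^+ t].
Proof.
move=> p1 p2 c0 r0 /(chernoff_exponent p1 p2)[s s0].
set E1 := \sum_x P1 x * expR _; set E2 := \sum_x P2 x * expR _ => K1.
have E10 : 0 <= E1 by apply: sumr_ge0 => x _; rewrite mulr_ge0 ?expR_ge0 ?(proj1 p1).
have E20 : 0 <= E2 by apply: sumr_ge0 => x _; rewrite mulr_ge0 ?expR_ge0 ?(proj1 p2).
exists (expR (s * d) * E1 ^+ m0 * E2 ^+ n0); split => //.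
  by rewrite !mulr_ge0 ?expR_ge0 ?exprn_ge0.
move=> t U1 U2 k1 k2 f1 f2.
have -> : (expR (s * d) * E1 ^+ m0 * E2 ^+ n0) ^+ t =
  \sum_u1 \sum_u2 expR (s * d) ^+ t * (\prod_i (P1 (k1 u1 i) * expR (- (s * ln (c (k1 u1 i)))))) *
    (\prod_j (P2 (k2 u2 j) * expR (- (s * ln (r (k2 u2 j)))))).
  under eq_bigr do rewrite -mulr_sumr.
  rewrite -mulr_suml -mulr_sumr.
  rewrite (f1 (fun _ x => P1 x * expR (- (s * ln (c x))))).
  rewrite (f2 (fun _ x => P2 x * expR (- (s * ln (r x))))).
  by rewrite !prodr_const !card_ord !exprMn -!exprM.
apply: ler_sum => u1 _; apply: ler_sum => u2 _.
rewrite !big_split /=.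
set A := \prod_i P1 _; set B := \prod_j P2 _.
have A0 : 0 <= A by apply: prodr_ge0 => i _; rewrite (proj1 p1).
have B0 : 0 <= B by apply: prodr_ge0 => i _; rewrite (proj1 p2).
set X := \prod_i expR _; set Y := \prod_i expR _.
have X0 : 0 <= X by apply: prodr_ge0 => i _; rewrite expR_ge0.
have Y0 : 0 <= Y by apply: prodr_ge0 => i _; rewrite expR_ge0.
have -> : expR (s * d) ^+ t * (A * X) * (B * Y) = A * B * (expR (s * d) ^+ t * X * Y) by ring.
have nn : 0 <= expR (s * d) ^+ t * X * Y by rewrite !mulr_ge0 ?exprn_ge0 ?expR_ge0.
(* Outside the support both sides vanish; on it every factor is positive and logarithms of products
   become sums. *)
have [AB|/eqP AB] := eqVneq (A * B) 0; first by rewrite AB !mul0r.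
have ABp : 0 < A * B by rewrite lt0r mulr_ge0 // andbT; apply/eqP.
rewrite ler_pM2l //.
case: ltP => [lt|_]; last by [].
have Ap : 0 < A by rewrite lt0r A0 andbT; apply: contraPneq AB => ->; rewrite mul0r.
have Bp : 0 < B by rewrite lt0r B0 andbT; apply: contraPneq AB => ->; rewrite mulr0.
have cp i : 0 < c (k1 u1 i).
  by apply: c0; apply: (@prodr_gt0_all _ _ (fun i => P1 (k1 u1 i)) _ Ap) => ?; rewrite (proj1 p1).
have rp i : 0 < r (k2 u2 i).
  by apply: r0; apply: (@prodr_gt0_all _ _ (fun i => P2 (k2 u2 i)) _ Bp) => ?; rewrite (proj1 p2).
have : ln ((\prod_i c (k1 u1 i)) * (\prod_j r (k2 u2 j))) < t%:R * d.
  rewrite -(expRK (t%:R * d)) ltr_ln ?posrE ?expR_gt0 // mulr_gt0 // prodr_gt0 //.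
rewrite lnM ?posrE ?prodr_gt0 // !ln_prod // => {}lt.
rewrite /X /Y -!expR_sum -expRM_natl -!expRD !sumrN -!mulr_sumr.
rewrite [leLHS]mulr1n -[leLHS](@expR0 R) ler_expR.
have -> : t%:R * (s * d) + - (s * \sum_i ln (c (k1 u1 i))) + - (s * \sum_i ln (r (k2 u2 i)))
  = s * (t%:R * d - (\sum_i ln (c (k1 u1 i)) + \sum_i ln (r (k2 u2 i)))) by ring.
by rewrite mulr_ge0 ?ltW // subr_gt0.
Qed.

End Miss.

Section Decoding.
Variable R : realType.

(** If the true pair passes all tests, an error means that some wrong pair passes them too. The test
    to use is the one attached to its set of wrong coordinates: that term alone makes the
    corresponding sum at least [th]. This is Markov's inequality before any averaging. *)
Lemma pick_error_le (M1 M2 : finType) (L1 L2 L12 : M1 -> M2 -> R) (th : R)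
    (s0 : M1 * M2) s1 s2 : 0 < th ->
  (forall a b, 0 <= L1 a b) -> (forall a b, 0 <= L2 a b) -> (forall a b, 0 <= L12 a b) ->
  \1[odflt s0 [pick s | [&& th <= L1 s.1 s.2, th <= L2 s.1 s.2 & th <= L12 s.1 s.2]]
      != (s1, s2)] <=
  \1[L1 s1 s2 < th] + \1[L2 s1 s2 < th] + \1[L12 s1 s2 < th] +
  th^-1 * (\sum_(a | a != s1) L1 a s2 + \sum_(b | b != s2) L2 s1 b +
           \sum_(a | a != s1) \sum_(b | b != s2) L12 a b) :> R.
Proof.
move=> th0 h1 h2 h12.
have n1 : 0 <= \sum_(a | a != s1) L1 a s2 by apply: sumr_ge0.
have n2 : 0 <= \sum_(b | b != s2) L2 s1 b by apply: sumr_ge0.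
have n12' a : 0 <= \sum_(b | b != s2) L12 a b by apply: sumr_ge0.
have n12 : 0 <= \sum_(a | a != s1) \sum_(b | b != s2) L12 a b by apply: sumr_ge0.
have big x : 0 <= x -> th <= x -> 1 <= th^-1 * x.
  by move=> x0 hx; rewrite mulrC ler_pdivlMr // mul1r.
have ti : 0 < th^-1 by rewrite invr_gt0.
have pos x : 0 <= x -> 0 <= th^-1 * x by move=> x0; rewrite mulr_ge0 // ltW.
move: (pos _ n1) (pos _ n2) (pos _ n12) => p1 p2 p12.
rewrite !mulrDr.
case: eqVneq => [_|ne]; first by rewrite !addr_ge0.
rewrite /=.
have i2 := ler0n R (L2 s1 s2 < th)%R; have i12 := ler0n R (L12 s1 s2 < th)%R.
case: ltP => l1; first by rewrite mulr1n; lra.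
case: ltP => l2; first by rewrite mulr1n mulr0n; move: (ler0n R (L12 s1 s2 < th)%R); lra.
case: ltP => l12; first by rewrite mulr1n !mulr0n; lra.
rewrite !mulr0n !add0r; move: ne.
case: pickP => [[a b] /= /and3P[g1 g2 g12]|/(_ (s1, s2))]; last first.
  by rewrite /= l1 l2 l12.
rewrite xpair_eqE negb_and.
have [ea|na] := eqVneq a s1; have [eb|nb] := eqVneq b s2 => //= _; rewrite mulr1n.
- have : 1 <= th^-1 * \sum_(b | b != s2) L2 s1 b; last by lra.
  by apply: big => //; rewrite (bigD1 b) //= -ea ler_wpDr ?sumr_ge0.
- have : 1 <= th^-1 * \sum_(a | a != s1) L1 a s2; last by lra.
  by apply: big => //; rewrite (bigD1 a) //= -eb ler_wpDr ?sumr_ge0.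
- have : 1 <= th^-1 * \sum_(a | a != s1) \sum_(b | b != s2) L12 a b; last by lra.
  apply: big => //; rewrite (bigD1 a) //= (bigD1 b) //= -addrA.
  by rewrite ler_wpDr ?addr_ge0 ?sumr_ge0.
Qed.

End Decoding.

(** * Random coding *)

Section Codebook.
Variable R : realType.

Lemma pmf_prod (I T U : finType) (k : U -> I -> T) (F : I -> T -> R) :
  families R k -> (forall i, pmf (F i)) -> pmf (fun u => \prod_i F i (k u i)).
Proof.
move=> kP h; split; first by move=> u; apply: prodr_ge0 => i _; case: (h i).
by apply: families_sum1 => // i; case: (h i).
Qed.

Lemma pmf_codebook (M X : finType) (mu : X -> R) : pmf mu ->
  pmf (fun C : {ffun M -> X} => \prod_s mu (C s)).
Proof. by move=> h; apply: (pmf_prod (F := fun=> mu) (@families_ffun R M X)). Qed.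

Lemma codebook_marginal (M X : finType) (mu : X -> R) (a : X -> R) (i : M) : pmf mu ->
  \sum_(C : {ffun M -> X}) (\prod_s mu (C s)) * a (C i) = \sum_x mu x * a x.
Proof. by move=> [_ h]; rewrite (families_marginal (@families_ffun R M X) (F := fun=> mu)). Qed.

(* The codeword of a wrong message is independent of the channel output. *)
Lemma codebook_false_alarm (M X Z : finType) (mu : X -> R) (V b : X -> Z -> R) (i j : M) :
  i != j -> pmf mu -> (forall x, pmf (V x)) ->
  (forall z, \sum_x mu x * b x z <= 1) ->
  \sum_(C : {ffun M -> X}) (\prod_s mu (C s)) * (\sum_z V (C i) z * b (C j) z) <= 1.
Proof.
move=> ij [mu0 mu1] V1 hb.
under eq_bigr do rewrite mulr_sumr.
rewrite exchange_big /=.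
under eq_bigr do rewrite (families_indep (@families_ffun R M X) (V^~ _) (b^~ _) ij mu1).
apply: (@le_trans _ _ (\sum_z \sum_x mu x * V x z)).
  apply: ler_sum => z _; rewrite -[leRHS]mulr1; apply: ler_wpM2l => //.
  by apply: sumr_ge0 => x _; rewrite mulr_ge0 //; case: (V1 x).
rewrite exchange_big /= -[leRHS]mu1; apply: ler_sum => x _.
by rewrite -mulr_sumr (proj2 (V1 x)) mulr1.
Qed.

(** Averaging over the second codebook, where [i2] and [j2] get independent codewords, replaces [V]
    and [b] by their means [V'] and [b']. What remains is the one-codebook statement for the
    averaged channel. *)
Lemma codebook_false_alarm2 (M1 M2 X1 X2 Z : finType) (mu1 : X1 -> R) (mu2 : X2 -> R)
    (V b : X1 -> X2 -> Z -> R) (i1 j1 : M1) (i2 j2 : M2) :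
  i1 != j1 -> i2 != j2 -> pmf mu1 -> pmf mu2 -> (forall x1 x2, pmf (V x1 x2)) ->
  (forall z, \sum_x1 \sum_x2 mu1 x1 * mu2 x2 * b x1 x2 z <= 1) ->
  \sum_(C1 : {ffun M1 -> X1}) (\prod_s mu1 (C1 s)) *
    \sum_(C2 : {ffun M2 -> X2}) (\prod_s mu2 (C2 s)) *
      (\sum_z V (C1 i1) (C2 i2) z * b (C1 j1) (C2 j2) z) <= 1.
Proof.
move=> ij1 ij2 p1 [p20 p21] V1 hb.
pose V' x1 z := \sum_x2 mu2 x2 * V x1 x2 z.
pose b' x1 z := \sum_x2 mu2 x2 * b x1 x2 z.
have := @codebook_false_alarm M1 X1 Z mu1 V' b' i1 j1 ij1 p1.
have -> : \sum_(C1 : {ffun M1 -> X1}) (\prod_s mu1 (C1 s)) *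
    \sum_(C2 : {ffun M2 -> X2}) (\prod_s mu2 (C2 s)) *
      (\sum_z V (C1 i1) (C2 i2) z * b (C1 j1) (C2 j2) z) =
  \sum_(C : {ffun M1 -> X1}) (\prod_s mu1 (C s)) * (\sum_z V' (C i1) z * b' (C j1) z).
  apply: eq_bigr => C1 _; congr (_ * _).
  under eq_bigr do rewrite mulr_sumr.
  rewrite exchange_big /=; apply: eq_bigr => z _.
  by rewrite (families_indep (@families_ffun R M2 X2) (fun x => V _ x z) (fun x => b _ x z)
    ij2 p21).
apply.
- move=> x; split=> [z|].
    by apply: sumr_ge0 => y _; rewrite mulr_ge0 //; case: (V1 x y).
  rewrite exchange_big /= -[RHS]p21; apply: eq_bigr => y _.
  by rewrite -mulr_sumr (proj2 (V1 x y)) mulr1.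
- move=> z; apply: le_trans (hb z); apply: ler_sum => x _.
  by rewrite mulr_sumr; under eq_bigr do rewrite mulrA.
Qed.

Lemma exists_le_mean (T : finType) (P F : T -> R) : pmf P ->
  exists t, F t <= \sum_t P t * F t.
Proof.
move=> [P0 P1]; apply: contrapT => /forallNP h.
have {}h t : \sum_t P t * F t < F t by rewrite ltNge; apply/negP/h.
have : \sum_t P t * (F t - \sum_t P t * F t) = 0.
  under eq_bigr do rewrite mulrBr.
  by rewrite sumrB -mulr_suml P1 mul1r subrr.
move=> /eqP; rewrite psumr_eq0; last by move=> t _; rewrite mulr_ge0 // subr_ge0 ltW.
move=> /allP e; have : \sum_t P t = 0.
  apply: big1 => t _; have := e t (mem_index_enum t).
  by rewrite mulf_eq0 [X in _ || X]gt_eqF ?subr_gt0 // orbF => /eqP.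
by rewrite P1 => /eqP; rewrite oner_eq0.
Qed.

End Codebook.

Section RandomCoding.
Variables (R : realType) (S1 S2 W Q X1 X2 : finType).
Variables (pS : S1 * S2 * W -> R) (c1 : W -> S1 -> R) (c2 : W -> S2 -> R).
Variables (pq : Q -> R) (p1 : Q -> X1 -> R) (p2 : Q -> X2 -> R).
Hypotheses (pSP : pmf pS) (c1P : forall w, pmf (c1 w)) (c2P : forall w, pmf (c2 w)).
Hypotheses (pqP : pmf pq) (p1P : forall q, pmf (p1 q)) (p2P : forall q, pmf (p2 q)).
Hypotheses (c1_gt0 : forall s, 0 < pS s -> 0 < c1 s.2 s.1.1)
           (c2_gt0 : forall s, 0 < pS s -> 0 < c2 s.2 s.1.2).

Section Ensemble.
Variables (m n : nat).
Local Notation M1 := (m.-tuple S1).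
Local Notation M2 := (m.-tuple S2).

Definition cond1 (q : n.-tuple Q) (x : n.-tuple X1) : R := \prod_j p1 (tnth q j) (tnth x j).
Definition cond2 (q : n.-tuple Q) (x : n.-tuple X2) : R := \prod_j p2 (tnth q j) (tnth x j).
Definition seqQ (q : n.-tuple Q) : R := \prod_j pq (tnth q j).

(** The time-sharing sequence is part of the random codebook: both encoders and the decoders know
    it, and choosing one good codebook fixes it as well. *)
Definition codebook : finType :=
  (n.-tuple Q * ({ffun M1 -> n.-tuple X1} * {ffun M2 -> n.-tuple X2}))%type.

Definition codebook_pmf (C : codebook) : R :=
  seqQ C.1 * ((\prod_s cond1 C.1 (C.2.1 s)) * (\prod_s cond2 C.1 (C.2.2 s))).

Lemma cond1P q : pmf (cond1 q).
Proof. exact: (pmf_prod (@families_tuple R X1 n) (fun j => p1P (tnth q j))). Qed.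

Lemma cond2P q : pmf (cond2 q).
Proof. exact: (pmf_prod (@families_tuple R X2 n) (fun j => p2P (tnth q j))). Qed.

Lemma seqQP : pmf seqQ.
Proof. exact: (pmf_prod (@families_tuple R Q n) (fun=> pqP)). Qed.

Lemma sum_codebook (F : codebook -> R) :
  \sum_C codebook_pmf C * F C =
  \sum_q seqQ q * \sum_(C1 : {ffun M1 -> n.-tuple X1}) (\prod_s cond1 q (C1 s)) *
    \sum_(C2 : {ffun M2 -> n.-tuple X2}) (\prod_s cond2 q (C2 s)) * F (q, (C1, C2)).
Proof.
rewrite sum_pair /=.
apply: eq_bigr => q _.
rewrite sum_pair /=.
rewrite mulr_sumr; apply: eq_bigr => C1 _; rewrite !mulr_sumr; apply: eq_bigr => C2 _.
by rewrite /codebook_pmf /= !mulrA.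
Qed.

Lemma codebook_pmfP : pmf codebook_pmf.
Proof.
split=> [C|].
  rewrite /codebook_pmf mulr_ge0 ?mulr_ge0 //; first by case: seqQP.
    by case: (pmf_codebook M1 (cond1P C.1)).
  by case: (pmf_codebook M2 (cond2P C.1)).
under eq_bigr do rewrite -[codebook_pmf _]mulr1.
rewrite (sum_codebook (fun=> 1)) -[RHS](proj2 seqQP); apply: eq_bigr => q _.
rewrite -[RHS]mulr1; congr (_ * _); rewrite -[RHS](proj2 (pmf_codebook M1 (cond1P q))).
apply: eq_bigr => C1 _ /=; rewrite -[RHS]mulr1; congr (_ * _).
rewrite -[RHS](proj2 (pmf_codebook M2 (cond2P q))).
by apply: eq_bigr => C2 _; rewrite mulr1.
Qed.

Lemma codebook_mean (a : n.-tuple Q -> n.-tuple X1 -> n.-tuple X2 -> R) s1 s2 :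
  \sum_C codebook_pmf C * a C.1 (C.2.1 s1) (C.2.2 s2) =
  \sum_q seqQ q * \sum_x1 cond1 q x1 * \sum_x2 cond2 q x2 * a q x1 x2.
Proof.
rewrite sum_codebook; apply: eq_bigr => q _; congr (_ * _) => /=.
under eq_bigr => C1 _ do rewrite (codebook_marginal (a q (C1 s1)) s2 (cond2P q)).
exact: (codebook_marginal (fun x => \sum_x2 _ * a q x x2) s1 (cond1P q)).
Qed.

End Ensemble.

(** * Threshold decoding at one receiver, averaged over the codebooks *)

Section Receiver.
Variables (Z : finType) (V : X1 -> X2 -> Z -> R).
Hypothesis VP : forall x1 x2, pmf (V x1 x2).

Definition code_pmf (t : Q * X1 * X2 * Z) : R :=
  pq t.1.1.1 * p1 t.1.1.1 t.1.1.2 * p2 t.1.1.1 t.1.2 * V t.1.1.2 t.1.2 t.2.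

Lemma sum_code_pmf (F : Q * X1 * X2 * Z -> R) :
  \sum_t code_pmf t * F t =
  \sum_q pq q * \sum_x1 \sum_x2 \sum_z p1 q x1 * p2 q x2 * V x1 x2 z * F (q, x1, x2, z).
Proof.
rewrite sum_pair /=.
rewrite sum_pair /=.
rewrite sum_pair /=.
apply: eq_bigr => q _; rewrite mulr_sumr; apply: eq_bigr => x1 _.
rewrite mulr_sumr; apply: eq_bigr => x2 _; rewrite mulr_sumr; apply: eq_bigr => z _.
by rewrite /code_pmf /= !mulrA.
Qed.

Lemma code_pmfP : pmf code_pmf.
Proof.
split=> [t|].
  rewrite /code_pmf !mulr_ge0 //; first by case: pqP.
  - by case: (p1P t.1.1.1).
  - by case: (p2P t.1.1.1).
  - by case: (VP t.1.1.2 t.1.2).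
under eq_bigr do rewrite -[code_pmf _]mulr1.
rewrite (sum_code_pmf (fun=> 1)) -[RHS](proj2 pqP); apply: eq_bigr => q _.
rewrite -[RHS]mulr1; congr (_ * _); rewrite -[RHS](proj2 (p1P q)).
apply: eq_bigr => x1 _; rewrite -[RHS]mulr1 -[in RHS](proj2 (p2P q)) mulr_sumr.
apply: eq_bigr => x2 _; under eq_bigr do rewrite mulr1.
by rewrite -mulr_sumr (proj2 (VP x1 x2)) mulr1.
Qed.

Section Blocks.
Variables (m n : nat).
Local Notation M1 := (m.-tuple S1).
Local Notation M2 := (m.-tuple S2).
Local Notation Wm := (m.-tuple W).
Local Notation Zn := (n.-tuple Z).

Definition letters (s : M1 * M2 * Wm) i := (tnth s.1.1 i, tnth s.1.2 i, tnth s.2 i).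
Definition uses (u : n.-tuple Q * n.-tuple X1 * n.-tuple X2 * Zn) j :=
  (tnth u.1.1.1 j, tnth u.1.1.2 j, tnth u.1.2 j, tnth u.2 j).

Lemma families_letters : families R letters.
Proof.
exact: (families_pair (families_pair (@families_tuple R S1 m) (@families_tuple R S2 m))
  (@families_tuple R W m)).
Qed.

Lemma families_uses : families R uses.
Proof.
exact: (families_pair (families_pair (families_pair (@families_tuple R Q n)
  (@families_tuple R X1 n)) (@families_tuple R X2 n)) (@families_tuple R Z n)).
Qed.

Definition seqS (s : M1 * M2 * Wm) : R := \prod_i pS (letters s i).
Definition seqV (x1 : n.-tuple X1) (x2 : n.-tuple X2) (z : Zn) : R :=
  \prod_j V (tnth x1 j) (tnth x2 j) (tnth z j).

Lemma seqSP : pmf seqS.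
Proof. exact: (pmf_prod families_letters (fun=> pSP)). Qed.

Lemma seqVP x1 x2 : pmf (seqV x1 x2).
Proof. exact: (pmf_prod (@families_tuple R Z n) (fun j => VP (tnth x1 j) (tnth x2 j))). Qed.

Definition likelihood (c : S1 * S2 * W -> R) (r : Q * X1 * X2 * Z -> R)
    (C : codebook m n) (z : Zn) (w : Wm) (s1 : M1) (s2 : M2) : R :=
  (\prod_i c (letters (s1, s2, w) i)) * (\prod_j r (uses (C.1, C.2.1 s1, C.2.2 s2, z) j)).

Definition ratio1 (t : Q * X1 * X2 * Z) : R :=
  V t.1.1.2 t.1.2 t.2 / out1 (p1 t.1.1.1) V t.1.1.2 t.1.2 t.2.
Definition ratio2 (t : Q * X1 * X2 * Z) : R :=
  V t.1.1.2 t.1.2 t.2 / out2 (p2 t.1.1.1) V t.1.1.2 t.1.2 t.2.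
Definition ratio12 (t : Q * X1 * X2 * Z) : R :=
  V t.1.1.2 t.1.2 t.2 / out12 (p1 t.1.1.1) (p2 t.1.1.1) V t.1.1.2 t.1.2 t.2.
Definition weight1 (s : S1 * S2 * W) : R := c1 s.2 s.1.1.
Definition weight2 (s : S1 * S2 * W) : R := c2 s.2 s.1.2.
Definition weight12 (s : S1 * S2 * W) : R := c1 s.2 s.1.1 * c2 s.2 s.1.2.

(** Any passing pair may be returned, without a uniqueness test, since the false alarm bound already
    counts all wrong passing pairs; [s0] is the answer when none passes. *)
Definition decoder (th : R) (s0 : M1 * M2) (C : codebook m n) (z : Zn) (w : Wm) : M1 * M2 :=
  odflt s0 [pick s | [&& th <= likelihood weight1 ratio1 C z w s.1 s.2,
                         th <= likelihood weight2 ratio2 C z w s.1 s.2 &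
                         th <= likelihood weight12 ratio12 C z w s.1 s.2]].

Definition receiver_error (f1 : M1 -> n.-tuple X1) (f2 : M2 -> n.-tuple X2)
    (g : Zn -> Wm -> M1 * M2) : R :=
  \sum_s seqS s * \sum_z seqV (f1 s.1.1) (f2 s.1.2) z * \1[g z s.2 != s.1].

Definition miss c r (th : R) (C : codebook m n) : R :=
  \sum_s seqS s * \sum_z seqV (C.2.1 s.1.1) (C.2.2 s.1.2) z *
     \1[likelihood c r C z s.2 s.1.1 s.1.2 < th].

(** The mean of the likelihood of the candidate [(a, b)], not the probability that it passes; the
    factor [th^-1] in the bounds below converts one into the other. *)
Definition alarm c r (C : codebook m n) (s : M1 * M2 * Wm) (a : M1) (b : M2) : R :=
  \sum_z seqV (C.2.1 s.1.1) (C.2.2 s.1.2) z * likelihood c r C z s.2 a b.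

Lemma out1_ge0 q a b z : 0 <= out1 (p1 q) V a b z.
Proof. by apply: sumr_ge0 => x _; rewrite mulr_ge0 //; [case: (p1P q)|case: (VP x b)]. Qed.
Lemma out2_ge0 q a b z : 0 <= out2 (p2 q) V a b z.
Proof. by apply: sumr_ge0 => x _; rewrite mulr_ge0 //; [case: (p2P q)|case: (VP a x)]. Qed.
Lemma out12_ge0 q a b z : 0 <= out12 (p1 q) (p2 q) V a b z.
Proof.
apply: sumr_ge0 => x _; apply: sumr_ge0 => y _.
by rewrite !mulr_ge0 //; [case: (p1P q)|case: (p2P q)|case: (VP x y)].
Qed.

Lemma weight1_ge0 s : 0 <= weight1 s. Proof. exact: (proj1 (c1P s.2)). Qed.
Lemma weight2_ge0 s : 0 <= weight2 s. Proof. exact: (proj1 (c2P s.2)). Qed.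
Lemma weight12_ge0 s : 0 <= weight12 s.
Proof. exact: mulr_ge0 (weight1_ge0 s) (weight2_ge0 s). Qed.
Lemma ratio1_ge0 t : 0 <= ratio1 t.
Proof. by apply: divr_ge0; [case: (VP t.1.1.2 t.1.2)|exact: out1_ge0]. Qed.
Lemma ratio2_ge0 t : 0 <= ratio2 t.
Proof. by apply: divr_ge0; [case: (VP t.1.1.2 t.1.2)|exact: out2_ge0]. Qed.
Lemma ratio12_ge0 t : 0 <= ratio12 t.
Proof. by apply: divr_ge0; [case: (VP t.1.1.2 t.1.2)|exact: out12_ge0]. Qed.

Lemma likelihood_ge0 c r C z w a b : (forall s, 0 <= c s) -> (forall t, 0 <= r t) ->
  0 <= likelihood c r C z w a b.
Proof. by move=> c0 r0; rewrite mulr_ge0 ?prodr_ge0. Qed.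

Lemma code_error_le th s0 (C : codebook m n) : 0 < th ->
  receiver_error C.2.1 C.2.2 (decoder th s0 C) <=
  miss weight1 ratio1 th C + miss weight2 ratio2 th C + miss weight12 ratio12 th C +
  th^-1 * \sum_s seqS s *
    (\sum_(a | a != s.1.1) alarm weight1 ratio1 C s a s.1.2 +
     \sum_(b | b != s.1.2) alarm weight2 ratio2 C s s.1.1 b +
     \sum_(a | a != s.1.1) \sum_(b | b != s.1.2) alarm weight12 ratio12 C s a b).
Proof.
move=> th0; rewrite /receiver_error /miss mulr_sumr -!big_split /=.
apply: ler_sum => -[[s1 s2] w] _ /=.
rewrite [X in _ + X]mulrCA -!mulrDr; apply: ler_wpM2l; first by case: seqSP.
set v := seqV (C.2.1 s1) (C.2.2 s2).
have ex (T : finType) (P : pred T) (F : T -> Zn -> R) :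
    \sum_(a | P a) \sum_z v z * F a z = \sum_z v z * \sum_(a | P a) F a z.
  by rewrite exchange_big; apply: eq_bigr => z _; rewrite mulr_sumr.
have -> : \sum_(a | a != s1) \sum_(b | b != s2) alarm weight12 ratio12 C (s1, s2, w) a b =
    \sum_z v z * \sum_(a | a != s1) \sum_(b | b != s2) likelihood weight12 ratio12 C z w a b.
  by rewrite -ex; apply: eq_bigr => a _; rewrite -ex.
rewrite /alarm /= !ex -!big_split /= mulr_sumr -big_split /=.
apply: ler_sum => z _.
rewrite -!mulrDr [X in _ <= _ + X]mulrCA -mulrDr.
apply: ler_wpM2l; first by case: (seqVP (C.2.1 s1) (C.2.2 s2)).
apply: pick_error_le => // a b; apply: likelihood_ge0.
- exact: weight1_ge0. - exact: ratio1_ge0.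
- exact: weight2_ge0. - exact: ratio2_ge0.
- exact: weight12_ge0. - exact: ratio12_ge0.
Qed.

Lemma code_pmf_uses q x1 x2 z : \prod_j code_pmf (uses (q, x1, x2, z) j) =
  seqQ q * cond1 q x1 * cond2 q x2 * seqV x1 x2 z.
Proof. by rewrite /code_pmf !big_split. Qed.

(** Only the codewords of the true pair enter, so after averaging the codebook disappears: the
    letters and the channel uses are i.i.d., which is the setting of [miss_le]. *)
Lemma miss_mean c r th : \sum_C codebook_pmf C * miss c r th C =
  \sum_s \sum_u (\prod_i pS (letters s i)) * (\prod_j code_pmf (uses u j)) *
    \1[(\prod_i c (letters s i)) * (\prod_j r (uses u j)) < th].
Proof.
rewrite /miss; under eq_bigr do rewrite mulr_sumr.
rewrite exchange_big; apply: eq_bigr => -[[s1 s2] w] _ /=.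
pose a q x1 x2 := \sum_z seqV x1 x2 z *
  \1[(\prod_i c (letters (s1, s2, w) i)) * (\prod_j r (uses (q, x1, x2, z) j)) < th].
transitivity (seqS (s1, s2, w) * \sum_C codebook_pmf C * a C.1 (C.2.1 s1) (C.2.2 s2)).
  by rewrite mulr_sumr; apply: eq_bigr => C _; rewrite mulrCA.
rewrite codebook_mean !sum_pair /= mulr_sumr; apply: eq_bigr => q _.
rewrite 2!mulr_sumr; apply: eq_bigr => x1 _.
rewrite 3!mulr_sumr; apply: eq_bigr => x2 _.
rewrite /a 4!mulr_sumr; apply: eq_bigr => z _.
by rewrite code_pmf_uses /seqS; ring.
Qed.

Lemma codebook_pmf_sum (a : n.-tuple Q -> R) :
  (forall q, a q <= 1) -> \sum_q seqQ q * a q <= 1.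
Proof.
move=> h; rewrite -[leRHS](proj2 (seqQP n)) ler_sum // => q _.
by rewrite -[leRHS]mulr1 ler_wpM2l //; case: (seqQP n).
Qed.

(** The second codeword is the same for the true pair and the candidate, so [C2] is frozen and only
    the first codebook is averaged. For a fixed output [ratio1] has mean at most [1] under [p1],
    with inequality because it is [0] where [out1] vanishes. What is left is the conditional
    probability of [a] given the side information. *)
Lemma alarm1_mean s a : a != s.1.1 ->
  \sum_C codebook_pmf C * alarm weight1 ratio1 C s a s.1.2 <=
  \prod_i c1 (tnth s.2 i) (tnth a i).
Proof.
case: s => -[s1 s2] w /= ne.
pose A := \prod_i c1 (tnth w i) (tnth a i).
have A0 : 0 <= A by apply: prodr_ge0 => i _; case: (c1P (tnth w i)).
pose b q x1 x2 z := \prod_j ratio1 (uses (q, x1, x2, z) j).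
pose F (C : codebook m n) := \sum_z seqV (C.2.1 s1) (C.2.2 s2) z * b C.1 (C.2.1 a) (C.2.2 s2) z.
have -> : \sum_C codebook_pmf C * alarm weight1 ratio1 C (s1, s2, w) a s2 =
    A * \sum_C codebook_pmf C * F C.
  rewrite mulr_sumr; apply: eq_bigr => C _; rewrite mulrCA; congr (_ * _).
  by rewrite mulr_sumr; apply: eq_bigr => z _; rewrite mulrCA.
rewrite -[leRHS]mulr1; apply: ler_wpM2l => //.
rewrite sum_codebook; apply: codebook_pmf_sum => q.
under eq_bigr do rewrite mulr_sumr.
rewrite exchange_big /= -[leRHS](proj2 (pmf_codebook M2 (cond2P q))); apply: ler_sum => C2 _.
under eq_bigr do rewrite mulrCA.
rewrite -mulr_sumr -[leRHS]mulr1; apply: ler_wpM2l.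
  by case: (pmf_codebook M2 (cond2P q)).
apply: (@codebook_false_alarm _ _ _ _ _ (fun x z => seqV x (C2 s2) z)
  (fun x z => b q x (C2 s2) z)) => //.
- by rewrite eq_sym.
- exact: cond1P.
- by move=> x; exact: seqVP.
move=> z; rewrite /cond1 /b.
under eq_bigr do rewrite -big_split /=.
apply: (families_le1 (@families_tuple R X1 n) (F := fun j x =>
  p1 (tnth q j) x * ratio1 (tnth q j, x, tnth (C2 s2) j, tnth z j))).
  by move=> j x; rewrite mulr_ge0 ?ratio1_ge0 //; case: (p1P (tnth q j)).
move=> j; rewrite /ratio1 /out1 /=.
under eq_bigr do rewrite mulrA.
rewrite -mulr_suml; set o := \sum_x _.
by have [->|ne0] := eqVneq o 0; rewrite ?mul0r // divff.
Qed.

Lemma alarm2_mean s b : b != s.1.2 ->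
  \sum_C codebook_pmf C * alarm weight2 ratio2 C s s.1.1 b <=
  \prod_i c2 (tnth s.2 i) (tnth b i).
Proof.
case: s => -[s1 s2] w /= ne.
pose A := \prod_i c2 (tnth w i) (tnth b i).
have A0 : 0 <= A by apply: prodr_ge0 => i _; case: (c2P (tnth w i)).
pose h q x1 x2 z := \prod_j ratio2 (uses (q, x1, x2, z) j).
pose F (C : codebook m n) := \sum_z seqV (C.2.1 s1) (C.2.2 s2) z * h C.1 (C.2.1 s1) (C.2.2 b) z.
have -> : \sum_C codebook_pmf C * alarm weight2 ratio2 C (s1, s2, w) s1 b =
    A * \sum_C codebook_pmf C * F C.
  rewrite mulr_sumr; apply: eq_bigr => C _; rewrite mulrCA; congr (_ * _).
  by rewrite mulr_sumr; apply: eq_bigr => z _; rewrite mulrCA.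
rewrite -[leRHS]mulr1; apply: ler_wpM2l => //.
rewrite sum_codebook; apply: codebook_pmf_sum => q.
rewrite -[leRHS](proj2 (pmf_codebook M1 (cond1P q))); apply: ler_sum => C1 _.
rewrite -[leRHS]mulr1; apply: ler_wpM2l.
  by case: (pmf_codebook M1 (cond1P q)).
apply: (@codebook_false_alarm _ _ _ _ _ (fun x z => seqV (C1 s1) x z)
  (fun x z => h q (C1 s1) x z)) => //.
- by rewrite eq_sym.
- exact: cond2P.
- by move=> x; exact: seqVP.
move=> z; rewrite /cond2 /h.
under eq_bigr do rewrite -big_split /=.
apply: (families_le1 (@families_tuple R X2 n) (F := fun j x =>
  p2 (tnth q j) x * ratio2 (tnth q j, tnth (C1 s1) j, x, tnth z j))).
  by move=> j x; rewrite mulr_ge0 ?ratio2_ge0 //; case: (p2P (tnth q j)).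
move=> j; rewrite /ratio2 /out2 /=.
under eq_bigr do rewrite mulrA.
rewrite -mulr_suml; set o := \sum_x _.
by have [->|ne0] := eqVneq o 0; rewrite ?mul0r // divff.
Qed.

(** Both codewords of the candidate are independent of the output, hence the normalization by the
    output law averaged over both inputs. *)
Lemma alarm12_mean s a b : a != s.1.1 -> b != s.1.2 ->
  \sum_C codebook_pmf C * alarm weight12 ratio12 C s a b <=
  (\prod_i c1 (tnth s.2 i) (tnth a i)) * (\prod_i c2 (tnth s.2 i) (tnth b i)).
Proof.
case: s => -[s1 s2] w /= ne1 ne2.
pose A := \prod_i (c1 (tnth w i) (tnth a i) * c2 (tnth w i) (tnth b i)).
have A0 : 0 <= A.
  by apply: prodr_ge0 => i _; apply: mulr_ge0; [case: (c1P (tnth w i))|case: (c2P (tnth w i))].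
rewrite -big_split -/A.
pose h q x1 x2 z := \prod_j ratio12 (uses (q, x1, x2, z) j).
pose F (C : codebook m n) := \sum_z seqV (C.2.1 s1) (C.2.2 s2) z * h C.1 (C.2.1 a) (C.2.2 b) z.
have -> : \sum_C codebook_pmf C * alarm weight12 ratio12 C (s1, s2, w) a b =
    A * \sum_C codebook_pmf C * F C.
  rewrite mulr_sumr; apply: eq_bigr => C _; rewrite mulrCA; congr (_ * _).
  by rewrite mulr_sumr; apply: eq_bigr => z _; rewrite mulrCA.
rewrite -[leRHS]mulr1; apply: ler_wpM2l => //.
rewrite sum_codebook; apply: codebook_pmf_sum => q.
apply: (@codebook_false_alarm2 _ _ _ _ _ _ _ _ (fun x y z => seqV x y z)
  (fun x y z => h q x y z)) => //; do 1?[by rewrite eq_sym].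
- exact: cond1P.
- exact: cond2P.
- by move=> x y; exact: seqVP.
move=> z; rewrite pair_bigA /cond1 /cond2 /h /=.
under eq_bigr do rewrite -!big_split /=.
apply: (families_le1 (families_pair (@families_tuple R X1 n) (@families_tuple R X2 n))
  (F := fun j x => p1 (tnth q j) x.1 * p2 (tnth q j) x.2 *
     ratio12 (tnth q j, x.1, x.2, tnth z j))).
  move=> j x; rewrite mulr_ge0 ?ratio12_ge0 //.
  by rewrite mulr_ge0 //; [case: (p1P (tnth q j))|case: (p2P (tnth q j))].
move=> j; rewrite /ratio12 /out12 /= sum_pair /=.
under eq_bigr => x _.
  under eq_bigr do rewrite mulrA.
  rewrite -mulr_suml; over.
rewrite -mulr_suml; set o := \sum_x _.
by have [->|ne0] := eqVneq o 0; rewrite ?mul0r // divff.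
Qed.

(** The constant [3] counts the sets of wrong sources. Each false alarm sum is bounded by a
    conditional pmf summed over the wrong sequences; putting the true sequence back completes this
    sum to [1]. *)
Lemma mean_code_error_le th s0 : 0 < th ->
  \sum_C codebook_pmf C * receiver_error C.2.1 C.2.2 (decoder th s0 C) <=
  \sum_C codebook_pmf C * miss weight1 ratio1 th C +
  \sum_C codebook_pmf C * miss weight2 ratio2 th C +
  \sum_C codebook_pmf C * miss weight12 ratio12 th C + th^-1 * 3.
Proof.
move=> th0; have ti : 0 <= th^-1 by rewrite invr_ge0 ltW.
pose E s C := \sum_(a | a != s.1.1) alarm weight1 ratio1 C s a s.1.2 +
     \sum_(b | b != s.1.2) alarm weight2 ratio2 C s s.1.1 b +
     \sum_(a | a != s.1.1) \sum_(b | b != s.1.2) alarm weight12 ratio12 C s a b.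
apply: (@le_trans _ _ (\sum_C codebook_pmf C *
  (miss weight1 ratio1 th C + miss weight2 ratio2 th C + miss weight12 ratio12 th C +
  th^-1 * \sum_s seqS s * E s C))).
  apply: ler_sum => C _; apply: ler_wpM2l; first by case: (codebook_pmfP m n).
  exact: code_error_le.
under eq_bigr do rewrite !mulrDr.
rewrite !big_split /= lerD2l.
under eq_bigr do rewrite mulrCA.
rewrite -mulr_sumr; apply: ler_wpM2l => //.
under eq_bigr do rewrite mulr_sumr.
rewrite exchange_big /=.
apply: (@le_trans _ _ (\sum_s seqS s * 3)); last first.
  by rewrite -mulr_suml (proj2 seqSP) mul1r.
apply: ler_sum => s _.
under eq_bigr do rewrite mulrCA.
rewrite -mulr_sumr; apply: ler_wpM2l; first by case: seqSP.
have fam1 : \sum_(a : M1) \prod_i c1 (tnth s.2 i) (tnth a i) = 1.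
  by apply: (families_sum1 (@families_tuple R S1 m) (F := fun i x => c1 (tnth s.2 i) x)) => i;
    case: (c1P (tnth s.2 i)).
have fam2 : \sum_(b : M2) \prod_i c2 (tnth s.2 i) (tnth b i) = 1.
  by apply: (families_sum1 (@families_tuple R S2 m) (F := fun i x => c2 (tnth s.2 i) x)) => i;
    case: (c2P (tnth s.2 i)).
have pos1 a : 0 <= \prod_i c1 (tnth s.2 i) (tnth a i).
  by apply: prodr_ge0 => i _; case: (c1P (tnth s.2 i)).
have pos2 b : 0 <= \prod_i c2 (tnth s.2 i) (tnth b i).
  by apply: prodr_ge0 => i _; case: (c2P (tnth s.2 i)).
rewrite /E; under eq_bigr do rewrite !mulrDr.
rewrite !big_split /=.
have -> : (3 : R) = 1 + 1 + 1 by ring.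
apply: lerD; [apply: lerD|].
- under eq_bigr do rewrite mulr_sumr.
  rewrite exchange_big /= -[leRHS]fam1 [leRHS](bigID (fun a => a != s.1.1)) /=.
  by apply: ler_wpDr; [apply: sumr_ge0 => *|apply: ler_sum => a ne; exact: alarm1_mean].
- under eq_bigr do rewrite mulr_sumr.
  rewrite exchange_big /= -[leRHS]fam2 [leRHS](bigID (fun b => b != s.1.2)) /=.
  by apply: ler_wpDr; [apply: sumr_ge0 => *|apply: ler_sum => a ne; exact: alarm2_mean].
- under eq_bigr do rewrite mulr_sumr.
  rewrite exchange_big /= -[leRHS]fam1 [leRHS](bigID (fun a => a != s.1.1)) /=.
  apply: ler_wpDr; [by apply: sumr_ge0 => *|apply: ler_sum => a ne].
  under eq_bigr do rewrite mulr_sumr.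
  rewrite exchange_big /= -[leRHS]mulr1 -[X in _ <= _ * X]fam2 mulr_sumr.
  rewrite [leRHS](bigID (fun b => b != s.1.2)) /=.
  apply: ler_wpDr; first by apply: sumr_ge0 => *; apply: mulr_ge0.
  by apply: ler_sum => b ne'; exact: alarm12_mean.
Qed.

End Blocks.

Lemma code_pmf_gt0 t : 0 < code_pmf t ->
  [/\ 0 < p1 t.1.1.1 t.1.1.2, 0 < p2 t.1.1.1 t.1.2 & 0 < V t.1.1.2 t.1.2 t.2].
Proof.
rewrite /code_pmf => h; split; rewrite lt0r.
- rewrite (proj1 (p1P _)) andbT; apply: contraTneq h => ->; rewrite mulr0 !mul0r ltxx //.
- rewrite (proj1 (p2P _)) andbT; apply: contraTneq h => ->; rewrite mulr0 !mul0r ltxx //.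
- rewrite (proj1 (VP _ _)) andbT; apply: contraTneq h => ->; rewrite mulr0 ltxx //.
Qed.

Lemma ratios_gt0 t : 0 < code_pmf t ->
  [/\ 0 < ratio1 t, 0 < ratio2 t & 0 < ratio12 t].
Proof.
move=> /code_pmf_gt0[h1 h2 hV].
have V0 a b z : 0 <= V a b z by case: (VP a b).
have u0 a : 0 <= p1 t.1.1.1 a by case: (p1P t.1.1.1).
have v0 a : 0 <= p2 t.1.1.1 a by case: (p2P t.1.1.1).
split; apply: divr_gt0 => //.
- by apply: lt_le_trans (out1_le _ _ _ u0 V0); rewrite mulr_gt0.
- by apply: lt_le_trans (out2_le _ _ _ v0 V0); rewrite mulr_gt0.
- by apply: lt_le_trans (out12_le _ _ _ u0 v0 V0); rewrite !mulr_gt0.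
Qed.

(** [d] lies strictly between [0] and the three mean exponents: the threshold [expR (t d)] is below
    the typical size of the products at the true pair, and still exponentially large. *)
Theorem random_coding (m0 n0 : nat) (d : R) : 0 < d ->
  d < m0%:R * (\sum_s pS s * ln (weight1 s)) + n0%:R * (\sum_t code_pmf t * ln (ratio1 t)) ->
  d < m0%:R * (\sum_s pS s * ln (weight2 s)) + n0%:R * (\sum_t code_pmf t * ln (ratio2 t)) ->
  d < m0%:R * (\sum_s pS s * ln (weight12 s)) + n0%:R * (\sum_t code_pmf t * ln (ratio12 t)) ->
  exists K : R, [/\ 0 <= K, K < 1 & forall t s0,
    \sum_C @codebook_pmf (m0 * t)%N (n0 * t)%N C *
      receiver_error C.2.1 C.2.2 (decoder (expR (t%:R * d)) s0 C) <= 6 * K ^+ t].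
Proof.
move=> d0 g1 g2 g12.
have w1 s : 0 < pS s -> 0 < weight1 s by exact: c1_gt0.
have w2 s : 0 < pS s -> 0 < weight2 s by exact: c2_gt0.
have w12 s : 0 < pS s -> 0 < weight12 s by move=> h; apply: mulr_gt0; [exact: w1|exact: w2].
have r1 t : 0 < code_pmf t -> 0 < ratio1 t by case/ratios_gt0.
have r2 t : 0 < code_pmf t -> 0 < ratio2 t by case/ratios_gt0.
have r12 t : 0 < code_pmf t -> 0 < ratio12 t by case/ratios_gt0.
have [K1 [K10 K11 h1]] := miss_le pSP code_pmfP w1 r1 g1.
have [K2 [K20 K21 h2]] := miss_le pSP code_pmfP w2 r2 g2.
have [K3 [K30 K31 h3]] := miss_le pSP code_pmfP w12 r12 g12.
have e0 : 0 <= expR (- d) by exact: expR_ge0.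
have e1 : expR (- d) < 1 by rewrite expR_lt1 oppr_lt0.
(* Three misses of at most [K ^+ t] each and three false alarms of at most [expR (- d) ^+ t] each
   give the factor [6]. *)
pose K := Num.max (Num.max K1 K2) (Num.max K3 (expR (- d))).
have le1 : K1 <= K by rewrite /K !le_max lexx.
have le2 : K2 <= K by rewrite /K !le_max lexx !orbT.
have le3 : K3 <= K by rewrite /K !le_max lexx !orbT.
have le4 : expR (- d) <= K by rewrite /K !le_max lexx !orbT.
exists K; split; first exact: le_trans K10 le1.
  by rewrite /K !gt_max K11 K21 K31 e1.
move=> t s0; apply: le_trans; first exact: mean_code_error_le (expR_gt0 _).
rewrite !miss_mean.
have {}h1 := h1 t _ _ _ _ (@families_letters _) (@families_uses _).
have {}h2 := h2 t _ _ _ _ (@families_letters _) (@families_uses _).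
have {}h3 := h3 t _ _ _ _ (@families_letters _) (@families_uses _).
have pw x : 0 <= x -> x <= K -> x ^+ t <= K ^+ t.
  by move=> x0 xK; rewrite lerXn2r // nnegrE // (le_trans x0 xK).
have := pw _ K10 le1; have := pw _ K20 le2; have := pw _ K30 le3; have := pw _ e0 le4.
rewrite -expRN -expRM_natl -mulrN.
move: h1 h2 h3; lra.
Qed.

End Receiver.
End RandomCoding.

(** * Converse *)

Section Converse.
Variables (R : realType) (S1 S2 W X1 X2 : finType).
Variables (pW : W -> R) (c1 : W -> S1 -> R) (c2 : W -> S2 -> R).
Hypotheses (pWP : pmf pW) (c1P : forall w, pmf (c1 w)) (c2P : forall w, pmf (c2 w)).

Definition source_pmf (s : S1 * S2 * W) : R := pW s.2 * c1 s.2 s.1.1 * c2 s.2 s.1.2.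

Lemma sum_source (F : S1 * S2 * W -> R) :
  \sum_s source_pmf s * F s =
  \sum_w pW w * \sum_s1 c1 w s1 * \sum_s2 c2 w s2 * F (s1, s2, w).
Proof.
rewrite sum_pair exchange_big; apply: eq_bigr => w _; rewrite sum_pair mulr_sumr.
apply: eq_bigr => s1 _; rewrite !mulr_sumr; apply: eq_bigr => s2 _.
by rewrite /source_pmf /=; ring.
Qed.

Lemma source_pmfP : pmf source_pmf.
Proof.
split=> [s|].
  rewrite /source_pmf !mulr_ge0 //; first by case: pWP.
    by case: (c1P s.2).
  by case: (c2P s.2).
under eq_bigr do rewrite -[source_pmf _]mulr1.
rewrite (sum_source (fun=> 1)) -[RHS](proj2 pWP); apply: eq_bigr => w _.
rewrite -[RHS]mulr1; congr (_ * _); rewrite -[RHS](proj2 (c1P w)); apply: eq_bigr => s1 _.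
by under eq_bigr do rewrite mulr1; rewrite (proj2 (c2P w)) mulr1.
Qed.

Section Code.
Variables (Z : finType) (V : X1 -> X2 -> Z -> R).
Hypothesis VP : forall x1 x2, pmf (V x1 x2).
Variables (m n : nat).
Local Notation M1 := (m.-tuple S1).
Local Notation M2 := (m.-tuple S2).
Local Notation Wm := (m.-tuple W).
Local Notation Zn := (n.-tuple Z).
Variables (f1 : M1 -> n.-tuple X1) (f2 : M2 -> n.-tuple X2).

Definition seqW (w : Wm) : R := \prod_i pW (tnth w i).
Definition seq1 (w : Wm) (s : M1) : R := \prod_i c1 (tnth w i) (tnth s i).
Definition seq2 (w : Wm) (s : M2) : R := \prod_i c2 (tnth w i) (tnth s i).

Lemma seqWP : pmf seqW.
Proof. exact: (pmf_prod (@families_tuple R W m) (fun=> pWP)). Qed.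
Lemma seq1P w : pmf (seq1 w).
Proof. exact: (pmf_prod (@families_tuple R S1 m) (fun i => c1P (tnth w i))). Qed.
Lemma seq2P w : pmf (seq2 w).
Proof. exact: (pmf_prod (@families_tuple R S2 m) (fun i => c2P (tnth w i))). Qed.

Lemma seqSE s1 s2 w : seqS source_pmf (s1, s2, w) = seqW w * seq1 w s1 * seq2 w s2.
Proof. by rewrite /seqS /source_pmf !big_split. Qed.

Lemma sum_seqS (F : M1 * M2 * Wm -> R) :
  \sum_s seqS source_pmf s * F s =
  \sum_w seqW w * \sum_s1 seq1 w s1 * \sum_s2 seq2 w s2 * F (s1, s2, w).
Proof.
rewrite sum_pair exchange_big; apply: eq_bigr => w _; rewrite sum_pair mulr_sumr.
apply: eq_bigr => s1 _; rewrite !mulr_sumr; apply: eq_bigr => s2 _.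
by rewrite seqSE; ring.
Qed.

(** The law of letter [j] of the first codeword given the side information [w]; indexed by the pair
    [(w, j)], it is the input law attached to the time-sharing variable. *)
Definition input1 (w : Wm) (j : 'I_n) (x : X1) : R := \sum_(s | tnth (f1 s) j == x) seq1 w s.
Definition input2 (w : Wm) (j : 'I_n) (x : X2) : R := \sum_(s | tnth (f2 s) j == x) seq2 w s.

Lemma sum_image (A B : finType) (P : A -> R) (h : A -> B) (F : B -> R) :
  \sum_a P a * F (h a) = \sum_b (\sum_(a | h a == b) P a) * F b.
Proof.
rewrite (partition_big h predT) //=; apply: eq_bigr => b _.
by rewrite mulr_suml; apply: eq_bigr => a /eqP <-.
Qed.

Lemma image_pmf (A B : finType) (P : A -> R) (h : A -> B) : pmf P ->
  pmf (fun b => \sum_(a | h a == b) P a).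
Proof.
move=> [P0 P1]; split=> [b|]; first by apply: sumr_ge0.
by rewrite -[RHS]P1 [RHS](partition_big h predT).
Qed.

Lemma input1P w j : pmf (input1 w j).
Proof. exact: (image_pmf (fun s => tnth (f1 s) j) (seq1P w)). Qed.
Lemma input2P w j : pmf (input2 w j).
Proof. exact: (image_pmf (fun s => tnth (f2 s) j) (seq2P w)). Qed.

Lemma seq1_le_input w s j : seq1 w s <= input1 w j (tnth (f1 s) j).
Proof.
rewrite /input1 (bigD1 s) //= lerDl; apply: sumr_ge0 => *; by case: (seq1P w).
Qed.
Lemma seq2_le_input w s j : seq2 w s <= input2 w j (tnth (f2 s) j).
Proof.
rewrite /input2 (bigD1 s) //= lerDl; apply: sumr_ge0 => *; by case: (seq2P w).
Qed.

(** Given [w] the two source sequences are independent, so the pair of [j]-th inputs has a product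
    law; since the channel is memoryless, [V] alone then produces the [j]-th output. *)
Lemma letter_mean w j (F : X1 -> X2 -> Z -> R) :
  \sum_s1 seq1 w s1 * \sum_s2 seq2 w s2 * \sum_z seqV V (f1 s1) (f2 s2) z *
    F (tnth (f1 s1) j) (tnth (f2 s2) j) (tnth z j) =
  \sum_x1 \sum_x2 \sum_z input1 w j x1 * input2 w j x2 * V x1 x2 z * F x1 x2 z.
Proof.
pose G x1 x2 := \sum_z V x1 x2 z * F x1 x2 z.
transitivity (\sum_s1 seq1 w s1 * \sum_s2 seq2 w s2 * G (tnth (f1 s1) j) (tnth (f2 s2) j)).
  apply: eq_bigr => s1 _; congr (_ * _); apply: eq_bigr => s2 _; congr (_ * _).
  apply: (families_marginal (@families_tuple R Z n)
    (F := fun j z => V (tnth (f1 s1) j) (tnth (f2 s2) j) z) j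
    (F (tnth (f1 s1) j) (tnth (f2 s2) j))) => i.
  by case: (VP (tnth (f1 s1) i) (tnth (f2 s2) i)).
under eq_bigr => s1 _ do rewrite (sum_image (seq2 w) (fun s => tnth (f2 s) j) (G (tnth (f1 s1) j))).
rewrite (sum_image (seq1 w) (fun s => tnth (f1 s) j) (fun x1 => \sum_x2 input2 w j x2 * G x1 x2)).
apply: eq_bigr => x1 _; rewrite mulr_sumr; apply: eq_bigr => x2 _.
by rewrite /G 2!mulr_sumr; apply: eq_bigr => z _; rewrite !mulrA.
Qed.

Variable g : Zn -> Wm -> M1 * M2.

Local Notation error := (receiver_error source_pmf V f1 f2 g).

(* [D] plays the role of the output law of a virtual channel and [r] that of the
   posterior of the decoded sources; the bound is the nonnegativity of the
   divergence of the true law from the one built out of [D] and [r]. *)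
Lemma converse_core (cA cB : W -> S1 -> S2 -> R) (D : Wm -> 'I_n -> X1 -> X2 -> Z -> R)
    (r : Zn -> Wm -> M1 -> M2 -> R) (eta M : R) :
  0 < eta -> eta < 1 -> 1 <= M ->
  (forall w s1 s2, c1 w s1 * c2 w s2 = cA w s1 s2 * cB w s1 s2) ->
  (forall w s1 s2, 0 <= cA w s1 s2) -> (forall w s1 s2, 0 <= cB w s1 s2) ->
  (forall w j x1 x2 z, input1 w j x1 * input2 w j x2 * V x1 x2 z <= D w j x1 x2 z) ->
  (forall z w s1 s2, eta / M <= r z w s1 s2) ->
  (forall z w s1 s2, g z w = (s1, s2) -> 1 - eta <= r z w s1 s2) ->
  \sum_w seqW w * (\sum_s1 \sum_s2 (\prod_i cB (tnth w i) (tnth s1 i) (tnth s2 i)) *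
     \sum_z (\prod_j D w j (tnth (f1 s1) j) (tnth (f2 s2) j) (tnth z j)) * r z w s1 s2) <= 1 ->
  - (m%:R * \sum_s source_pmf s * ln (cA s.2 s.1.1 s.1.2)) <=
  \sum_w seqW w * (\sum_j info (input1 w j) (input2 w j) V (D w j)) +
  (- ln (1 - eta) + error * ln (M / eta)).
Proof.
move=> eta0 eta1 M1' ceq cA0 cB0 hD hr hg mass.
have M0 : 0 < M by lra.
have [V0 u0 v0] : [/\ forall x1 x2 z, 0 <= V x1 x2 z, forall w j x, 0 <= input1 w j x &
    forall w j x, 0 <= input2 w j x].
  by split => [x1 x2|w j|w j]; [case: (VP x1 x2)|case: (input1P w j)|case: (input2P w j)].
have D0 w j x1 x2 z : 0 <= D w j x1 x2 z.
  by apply: le_trans (hD w j x1 x2 z); rewrite !mulr_ge0.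
have r0 z w s1 s2 : 0 < r z w s1 s2 by apply: lt_le_trans (hr z w s1 s2); rewrite divr_gt0.
have eM0 : 0 <= - ln (1 - eta) by rewrite oppr_ge0 ln_le0 //; lra.
pose P (t : M1 * M2 * Wm * Zn) :=
  seqS source_pmf t.1 * seqV V (f1 t.1.1.1) (f2 t.1.1.2) t.2.
(* The reference measure. In [P t / T t] the factor [cB] and the law of [w] cancel, leaving [cA],
   the ratios [V / D] and [1 / r]: entropy, information and Fano term. *)
pose T (t : M1 * M2 * Wm * Zn) :=
  seqW t.1.2 * (\prod_i cB (tnth t.1.2 i) (tnth t.1.1.1 i) (tnth t.1.1.2 i)) *
  ((\prod_j D t.1.2 j (tnth (f1 t.1.1.1) j) (tnth (f2 t.1.1.2) j) (tnth t.2 j)) *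
   r t.2 t.1.2 t.1.1.1 t.1.1.2).
have sSP := seqSP source_pmfP m.
have P0 t : 0 <= P t.
  by apply: mulr_ge0; [case: sSP|case: (seqVP VP (f1 t.1.1.1) (f2 t.1.1.2))].
have P1 : \sum_t P t = 1.
  rewrite sum_pair -[RHS](proj2 sSP); apply: eq_bigr => s _.
  by rewrite /P /= -mulr_sumr (proj2 (seqVP VP _ _)) mulr1.
have W0 w : 0 <= seqW w by case: seqWP.
have T0 t : 0 <= T t.
  apply: mulr_ge0; apply: mulr_ge0; last exact: ltW.
  - exact: W0.
  - exact: prodr_ge0.
  - exact: prodr_ge0.
have T1 : \sum_t T t <= \sum_t P t.
  rewrite P1; apply: le_trans mass; rewrite le_eqVlt; apply/orP; left; apply/eqP.
  rewrite sum_pair sum_pair exchange_big; apply: eq_bigr => w _.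
  rewrite sum_pair mulr_sumr; apply: eq_bigr => s1 _.
  rewrite mulr_sumr; apply: eq_bigr => s2 _.
  by rewrite mulrA mulr_sumr.
have pos t : 0 < P t -> [/\ 0 < seqW t.1.2,
     forall i, 0 < cA (tnth t.1.2 i) (tnth t.1.1.1 i) (tnth t.1.1.2 i),
     forall i, 0 < cB (tnth t.1.2 i) (tnth t.1.1.1 i) (tnth t.1.1.2 i),
     forall j, 0 < V (tnth (f1 t.1.1.1) j) (tnth (f2 t.1.1.2) j) (tnth t.2 j) &
     forall j, 0 < D t.1.2 j (tnth (f1 t.1.1.1) j) (tnth (f2 t.1.1.2) j) (tnth t.2 j)].
  case: t => -[[s1 s2] w] z; rewrite /P /= seqSE => h.
  have w0 : 0 < seqW w.
    by rewrite lt0r W0 andbT; apply: contraTneq h => ->; rewrite !mul0r ltxx.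
  have a0 : 0 < seq1 w s1.
    by rewrite lt0r (proj1 (seq1P w)) andbT; apply: contraTneq h => ->; rewrite mulr0 !mul0r ltxx.
  have b0 : 0 < seq2 w s2.
    by rewrite lt0r (proj1 (seq2P w)) andbT; apply: contraTneq h => ->; rewrite mulr0 mul0r ltxx.
  have V0' : 0 < seqV V (f1 s1) (f2 s2) z.
    by rewrite lt0r (proj1 (seqVP VP _ _)) andbT; apply: contraTneq h => ->; rewrite mulr0 ltxx.
  have cAB i : 0 < cA (tnth w i) (tnth s1 i) (tnth s2 i) * cB (tnth w i) (tnth s1 i) (tnth s2 i).
    rewrite -ceq; apply: mulr_gt0.
      by apply: (@prodr_gt0_all R _ (fun i => c1 (tnth w i) (tnth s1 i)) _ a0) => k;
        case: (c1P (tnth w k)).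
    by apply: (@prodr_gt0_all R _ (fun i => c2 (tnth w i) (tnth s2 i)) _ b0) => k;
      case: (c2P (tnth w k)).
  have Vj j : 0 < V (tnth (f1 s1) j) (tnth (f2 s2) j) (tnth z j).
    exact: (@prodr_gt0_all R _ (fun j => V (tnth (f1 s1) j) (tnth (f2 s2) j) (tnth z j)) _ V0').
  split=> // [i|i|j].
  - by rewrite lt0r cA0 andbT; apply: contraTneq (cAB i) => ->; rewrite mul0r ltxx.
  - by rewrite lt0r cB0 andbT; apply: contraTneq (cAB i) => ->; rewrite mulr0 ltxx.
  - apply: lt_le_trans (hD _ _ _ _ _); rewrite !mulr_gt0 //.
      exact: lt_le_trans a0 (seq1_le_input w s1 j).
    exact: lt_le_trans b0 (seq2_le_input w s2 j).
have PT t : 0 < P t -> 0 < T t.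
  move=> /pos[h1 h2 h3 h4 h5]; apply: mulr_gt0; apply: mulr_gt0 => //.
  - exact: prodr_gt0.
  - exact: prodr_gt0.
have := gibbs P0 T0 PT T1.
pose sA (s : M1 * M2 * Wm) := \sum_i ln (cA (tnth s.2 i) (tnth s.1.1 i) (tnth s.1.2 i)).
pose sV (t : M1 * M2 * Wm * Zn) := \sum_j
  ln (V (tnth (f1 t.1.1.1) j) (tnth (f2 t.1.1.2) j) (tnth t.2 j) /
      D t.1.2 j (tnth (f1 t.1.1.1) j) (tnth (f2 t.1.1.2) j) (tnth t.2 j)).
(* [- ln r] is at most [- ln (1 - eta)] where decoding succeeds and at most [ln (M / eta)]
   everywhere; charging the second bound to the error event replaces Fano's inequality. *)
pose ie (t : M1 * M2 * Wm * Zn) : R := \1[g t.2 t.1.2 != t.1.1].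
move=> /le_trans /(_ (_ : _ <= \sum_t (P t * sA t.1 + P t * sV t + P t * - ln (1 - eta) +
   P t * ie t * ln (M / eta)))) H.
have {H} : 0 <= \sum_t (P t * sA t.1 + P t * sV t + P t * - ln (1 - eta) +
   P t * ie t * ln (M / eta)).
  apply: H; apply: ler_sum => t _.
  have [->|ne0] := eqVneq (P t) 0; first by rewrite !mul0r !addr0.
  have Pt : 0 < P t by rewrite lt0r ne0 P0.
  have [h1 h2 h3 h4 h5] := pos t Pt.
  rewrite -mulrA -!mulrDr ler_pM2l //.
  have -> : P t / T t = (\prod_i cA (tnth t.1.2 i) (tnth t.1.1.1 i) (tnth t.1.1.2 i)) *
     (\prod_j (V (tnth (f1 t.1.1.1) j) (tnth (f2 t.1.1.2) j) (tnth t.2 j) /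
      D t.1.2 j (tnth (f1 t.1.1.1) j) (tnth (f2 t.1.1.2) j) (tnth t.2 j))) /
     r t.2 t.1.2 t.1.1.1 t.1.1.2.
    rewrite big_split /= prodfV.
    case: t {Pt ne0} h1 h2 h3 h4 h5 => -[[s1 s2] w] z /= h1 h2 h3 h4 h5.
    rewrite /P /T /= seqSE -[seqW w * _ * _]mulrA.
    have -> : seq1 w s1 * seq2 w s2 = (\prod_i cA (tnth w i) (tnth s1 i) (tnth s2 i)) *
        (\prod_i cB (tnth w i) (tnth s1 i) (tnth s2 i)).
      by rewrite -!big_split; apply: eq_bigr => i _; exact: ceq.
    have B0 : 0 < \prod_i cB (tnth w i) (tnth s1 i) (tnth s2 i) by rewrite prodr_gt0.
    have Dj : 0 < \prod_j D w j (tnth (f1 s1) j) (tnth (f2 s2) j) (tnth z j) by rewrite prodr_gt0.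
    rewrite /seqV; field.
    by rewrite !gt_eqF.
  rewrite ln_div ?posrE ?mulr_gt0 ?prodr_gt0 //; last by move=> j _; rewrite divr_gt0.
  rewrite lnM ?posrE ?prodr_gt0 //; last by move=> j _; rewrite divr_gt0.
  rewrite !ln_prod //; last by move=> j; rewrite divr_gt0.
  rewrite -/(sA t.1) -/(sV t) -[leRHS]addrA lerD2l.
  rewrite /ie; case: eqP => [e|_].
    rewrite mul0r addr0 lerN2 ler_ln ?posrE //; last by lra.
    by apply: hg; rewrite e; case: (t.1.1).
  rewrite mul1r; apply: ler_wpDl => //.
  rewrite -[M / eta]invrK lnV ?posrE ?invr_gt0 ?divr_gt0 // invf_div lerN2.
  by rewrite ler_ln ?posrE ?divr_gt0.
rewrite !big_split /= -!mulr_suml P1 mul1r.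
have -> : \sum_t P t * sA t.1 = m%:R * \sum_s source_pmf s * ln (cA s.2 s.1.1 s.1.2).
  rewrite sum_pair; transitivity (\sum_s seqS source_pmf s * sA s).
    apply: eq_bigr => s _; rewrite /P /= -mulr_suml -mulr_sumr.
    by rewrite (proj2 (seqVP VP _ _)) mulr1.
  rewrite /sA; under eq_bigr do rewrite mulr_sumr.
  rewrite exchange_big /=.
  under eq_bigr => i _ do rewrite (families_marginal (@families_letters R S1 S2 W m)
    (F := fun=> source_pmf) i (fun s => ln (cA s.2 s.1.1 s.1.2)) (fun=> proj2 source_pmfP)).
  by rewrite sumr_const card_ord mulr_natl.
have -> : \sum_t P t * sV t = \sum_w seqW w * (\sum_j info (input1 w j) (input2 w j) V (D w j)).
  rewrite sum_pair.
  transitivity (\sum_s seqS source_pmf s *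
     \sum_z seqV V (f1 s.1.1) (f2 s.1.2) z * sV (s, z)).
    by apply: eq_bigr => s _; rewrite mulr_sumr; apply: eq_bigr => z _; rewrite /P mulrA.
  rewrite sum_seqS; apply: eq_bigr => w _; congr (_ * _).
  rewrite /info; under [RHS]eq_bigr => j _ do
    rewrite -(letter_mean w j (fun x1 x2 z => ln (V x1 x2 z / D w j x1 x2 z))).
  rewrite exchange_big; apply: eq_bigr => s1 _; rewrite -mulr_sumr; congr (_ * _).
  rewrite exchange_big; apply: eq_bigr => s2 _; rewrite -mulr_sumr; congr (_ * _).
  rewrite exchange_big; apply: eq_bigr => z _; rewrite -mulr_sumr; congr (_ * _).
have -> : \sum_t P t * ie t = error.
  rewrite sum_pair; apply: eq_bigr => s _; rewrite mulr_sumr; apply: eq_bigr => z _.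
  by rewrite /P mulrA.
lra.
Qed.

(** The guessed posterior is the point mass at the decoded value mixed with a uniform law of weight
    [eta]; the uniform part keeps its logarithm finite when the decoder is wrong. *)
Lemma mixture_sum1 (T : finType) (t0 : T) (eta : R) :
  \sum_t ((1 - eta) * \1[t == t0] + eta / #|T|%:R) = 1.
Proof.
have T0 : (0 < #|T|)%N by apply/card_gt0P; exists t0.
rewrite big_split /= -mulr_sumr (bigD1 t0) //= eqxx big1 ?addr0; last by move=> t /negPf ->.
rewrite sumr_const -[X in _ + X]mulr_natr -mulrA mulVf ?pnatr_eq0 -?lt0n //.
by rewrite !mulr1 subrK.
Qed.

Local Notation M1c := (#|{: M1}|%:R : R).
Local Notation M2c := (#|{: M2}|%:R : R).
Local Notation slack eta := (- ln (1 - eta) + error * ln (M1c * M2c / eta)).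

Lemma input_joint_le w j x1 x2 z : [/\
  input1 w j x1 * input2 w j x2 * V x1 x2 z <= out1 (input1 w j) V x1 x2 z,
  input1 w j x1 * input2 w j x2 * V x1 x2 z <= out2 (input2 w j) V x1 x2 z &
  input1 w j x1 * input2 w j x2 * V x1 x2 z <= out12 (input1 w j) (input2 w j) V x1 x2 z].
Proof.
have V0 a b c : 0 <= V a b c by case: (VP a b).
have le1 (T : finType) (P : T -> R) t : pmf P -> P t <= 1.
  by move=> [P0 <-]; rewrite (bigD1 t) //= lerDl sumr_ge0.
have [u0 _] := input1P w j; have [v0 _] := input2P w j.
split; last exact: out12_le.
  apply: le_trans (out1_le _ _ _ u0 V0); apply: ler_wpM2r => //.
  by rewrite ler_piMr // le1 //; exact: input2P.
apply: le_trans (out2_le _ _ _ v0 V0); apply: ler_wpM2r => //.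
by rewrite ler_piMl // le1 //; exact: input1P.
Qed.

Lemma source_card_gt0 : (0 < #|S1|)%N /\ (0 < #|S2|)%N.
Proof.
have [[[s1 s2] w] _] := pmf_witness source_pmfP.
by split; apply/card_gt0P; [exists s1|exists s2].
Qed.

Lemma card_ge1 : 1 <= M1c /\ 1 <= M2c.
Proof.
have [h1 h2] := source_card_gt0.
by rewrite !card_tuple !ler1n !expn_gt0 h1 h2.
Qed.

(** The reference measure keeps the law of [s2], averages the first input out of the channel and
    guesses [s1] from the decoder. With [s2] fixed, [out1] does not depend on [s1], so summing the
    guess over [s1] gives [1] and the output law then has mass at most [1]. *)
Lemma converse1 eta : 0 < eta -> eta < 1 ->
  - (m%:R * \sum_s source_pmf s * ln (c1 s.2 s.1.1)) <=
  \sum_w seqW w * (\sum_j info (input1 w j) (input2 w j) V (out1 (input1 w j) V)) + slack eta.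
Proof.
move=> eta0 eta1; have [m1 m2] := card_ge1.
have M0 : 0 < M1c by lra.
apply: (@converse_core (fun w s1 _ => c1 w s1) (fun w _ s2 => c2 w s2)
  (fun w j => out1 (input1 w j) V)
  (fun z w s1 _ => (1 - eta) * \1[s1 == (g z w).1] + eta / M1c)) => //.
- by rewrite -[leLHS]mulr1; apply: ler_pM.
- by move=> w s1 _; case: (c1P w).
- by move=> w _ s2; case: (c2P w).
- by move=> w j x1 x2 z; case: (input_joint_le w j x1 x2 z).
- move=> z w s1 _; apply: ler_wpDl; first by rewrite mulr_ge0 // subr_ge0 ltW.
  rewrite ler_pM2l // lef_pV2 ?posrE ?mulr_gt0 //; last by lra.
  by rewrite -[leLHS]mulr1 ler_pM2l.
- move=> z w s1 s2 ->; rewrite eqxx mulr1 lerDl divr_ge0 // ltW //.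
rewrite -[leRHS](proj2 seqWP); apply: ler_sum => w _.
rewrite -[leRHS]mulr1; apply: ler_wpM2l; first by case: seqWP.
rewrite exchange_big /= -[leRHS](proj2 (seq2P w)); apply: ler_sum => s2 _.
rewrite -mulr_sumr -[leRHS]mulr1; apply: ler_wpM2l; first exact: (proj1 (seq2P w) s2).
rewrite exchange_big /=.
under eq_bigr => z _ do rewrite /out1 -mulr_sumr mixture_sum1 mulr1.
apply: (families_le1 (@families_tuple R Z n)
  (F := fun j z => \sum_a input1 w j a * V a (tnth (f2 s2) j) z)) => j.
  move=> z; apply: sumr_ge0 => a _; apply: mulr_ge0; first by case: (input1P w j).
  by case: (VP a (tnth (f2 s2) j)).
rewrite exchange_big /= -[leRHS](proj2 (input1P w j)); apply: ler_sum => a _.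
by rewrite -mulr_sumr (proj2 (VP _ _)) mulr1.
Qed.

Lemma converse2 eta : 0 < eta -> eta < 1 ->
  - (m%:R * \sum_s source_pmf s * ln (c2 s.2 s.1.2)) <=
  \sum_w seqW w * (\sum_j info (input1 w j) (input2 w j) V (out2 (input2 w j) V)) + slack eta.
Proof.
move=> eta0 eta1; have [m1 m2] := card_ge1.
have M0 : 0 < M2c by lra.
apply: (@converse_core (fun w _ s2 => c2 w s2) (fun w s1 _ => c1 w s1)
  (fun w j => out2 (input2 w j) V)
  (fun z w _ s2 => (1 - eta) * \1[s2 == (g z w).2] + eta / M2c)) => //.
- by rewrite -[leLHS]mulr1; apply: ler_pM.
- by move=> w s1 s2; rewrite mulrC.
- by move=> w _ s2; case: (c2P w).
- by move=> w s1 _; case: (c1P w).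
- by move=> w j x1 x2 z; case: (input_joint_le w j x1 x2 z).
- move=> z w _ s2; apply: ler_wpDl; first by rewrite mulr_ge0 // subr_ge0 ltW.
  rewrite ler_pM2l // lef_pV2 ?posrE ?mulr_gt0 //; last by lra.
  by rewrite -[leLHS]mul1r ler_pM2r.
- by move=> z w s1 s2 ->; rewrite eqxx mulr1 lerDl divr_ge0 // ltW.
rewrite -[leRHS](proj2 seqWP); apply: ler_sum => w _.
rewrite -[leRHS]mulr1; apply: ler_wpM2l; first by case: seqWP.
rewrite -[leRHS](proj2 (seq1P w)); apply: ler_sum => s1 _.
rewrite -mulr_sumr -[leRHS]mulr1; apply: ler_wpM2l; first exact: (proj1 (seq1P w) s1).
rewrite exchange_big /=.
under eq_bigr => z _ do rewrite /out2 -mulr_sumr mixture_sum1 mulr1.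
apply: (families_le1 (@families_tuple R Z n)
  (F := fun j z => \sum_b input2 w j b * V (tnth (f1 s1) j) b z)) => j.
  move=> z; apply: sumr_ge0 => a _; apply: mulr_ge0; first by case: (input2P w j).
  by case: (VP (tnth (f1 s1) j) a).
rewrite exchange_big /= -[leRHS](proj2 (input2P w j)); apply: ler_sum => a _.
by rewrite -mulr_sumr (proj2 (VP _ _)) mulr1.
Qed.

(** Here the whole source pair is guessed by the decoder: [cA] is the full conditional law and [cB]
    is [1]. *)
Lemma converse12 eta : 0 < eta -> eta < 1 ->
  - (m%:R * \sum_s source_pmf s * ln (c1 s.2 s.1.1 * c2 s.2 s.1.2)) <=
  \sum_w seqW w * (\sum_j info (input1 w j) (input2 w j) V
     (out12 (input1 w j) (input2 w j) V)) + slack eta.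
Proof.
move=> eta0 eta1; have [m1 m2] := card_ge1.
have M0 : 0 < M1c * M2c by rewrite mulr_gt0 //; lra.
apply: (@converse_core (fun w s1 s2 => c1 w s1 * c2 w s2) (fun _ _ _ => 1)
  (fun w j => out12 (input1 w j) (input2 w j) V)
  (fun z w s1 s2 => (1 - eta) * \1[(s1, s2) == g z w] + eta / (M1c * M2c))) => //.
- by rewrite -[leLHS]mulr1; apply: ler_pM.
- by move=> w s1 s2; rewrite mulr1.
- by move=> w s1 s2; apply: mulr_ge0; [case: (c1P w)|case: (c2P w)].
- by move=> w j x1 x2 z; case: (input_joint_le w j x1 x2 z).
- by move=> z w s1 s2; apply: ler_wpDl => //; rewrite mulr_ge0 // subr_ge0 ltW.
- by move=> z w s1 s2 ->; rewrite eqxx mulr1 lerDl divr_ge0 // ltW.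
rewrite -[leRHS](proj2 seqWP); apply: ler_sum => w _.
rewrite -[leRHS]mulr1; apply: ler_wpM2l; first by case: seqWP.
rewrite pair_bigA /=.
under eq_bigr do rewrite big1_eq mul1r.
rewrite exchange_big /=.
have mix z : \sum_(s : M1 * M2) ((1 - eta) * \1[(s.1, s.2) == g z w] + eta / (M1c * M2c)) = 1.
  rewrite -[RHS](mixture_sum1 (g z w) eta) card_prod natrM.
  by apply: eq_bigr => -[].
under eq_bigr => z _ do rewrite /out12 -mulr_sumr mix mulr1.
apply: (families_le1 (@families_tuple R Z n)
  (F := fun j z => \sum_a \sum_b input1 w j a * input2 w j b * V a b z)) => j.
  move=> z; apply: sumr_ge0 => a _; apply: sumr_ge0 => b _.
  by apply: mulr_ge0; [apply: mulr_ge0; [case: (input1P w j)|case: (input2P w j)]|case: (VP a b)].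
rewrite exchange_big /= -[leRHS](proj2 (input1P w j)); apply: ler_sum => a _.
rewrite exchange_big /= -[leRHS]mulr1 -[X in _ <= _ * X](proj2 (input2P w j)) mulr_sumr.
by apply: ler_sum => b _; rewrite -mulr_sumr (proj2 (VP _ _)) mulr1.
Qed.

(** The number of source pairs is [(#|S1| * #|S2|) ^ m], so its logarithm is linear in [m]; the
    terms free of [m] are nonnegative and [m >= 1]. Hence the slack per letter is bounded
    independently of the block lengths. *)
Lemma slack_le eta e : (0 < m)%N -> 0 < eta -> eta < 1 -> error <= e ->
  slack eta <= m%:R * (- ln (1 - eta) + e * ln ((#|S1| * #|S2|)%:R / eta)).
Proof.
move=> m0 eta0 eta1 he; have [h1 h2] := source_card_gt0.
set K := (#|S1| * #|S2|)%:R.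
have K1 : 1 <= K :> R by rewrite /K ler1n muln_gt0 h1.
have M_E : M1c * M2c = K ^+ m.
  by rewrite -natrM !card_tuple -expnMn natrX.
have mR : 1 <= m%:R :> R by rewrite ler1n.
have lK : 0 <= ln K by rewrite ln_ge0.
have K0 : 0 < K by lra.
have le : 0 <= - ln eta by rewrite oppr_ge0 ln_le0 // ltW.
have e0 : 0 <= error.
  apply: sumr_ge0 => s _; apply: mulr_ge0; first by case: (seqSP source_pmfP m).
  by apply: sumr_ge0 => z _; apply: mulr_ge0 => //; case: (seqVP VP (f1 s.1.1) (f2 s.1.2)).
have l1 : 0 <= - ln (1 - eta) by rewrite oppr_ge0 ln_le0 //; lra.
rewrite M_E !ln_div ?posrE ?exprn_gt0 // lnXn // -[ln K *+ m]mulr_natl [leRHS]mulrDr.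
apply: lerD; first by rewrite ler_peMl.
apply: (@le_trans _ _ (e * (m%:R * ln K - ln eta))).
  by apply: ler_wpM2r => //; rewrite addr_ge0 // mulr_ge0.
rewrite mulrCA; apply: ler_wpM2l; first exact: le_trans he.
by rewrite mulrDr lerD2l ler_peMl.
Qed.

End Code.

Theorem converse_bounds (d : R) : 0 < d -> exists2 e : R, 0 < e &
  forall (Z : finType) (V : X1 -> X2 -> Z -> R) (m n : nat)
    (f1 : m.-tuple S1 -> n.-tuple X1) (f2 : m.-tuple S2 -> n.-tuple X2)
    (g : n.-tuple Z -> m.-tuple W -> m.-tuple S1 * m.-tuple S2),
  (forall x1 x2, pmf (V x1 x2)) -> (0 < m)%N -> receiver_error source_pmf V f1 f2 g <= e ->
  let I D := \sum_w seqW w * (\sum_j info (input1 f1 w j) (input2 f2 w j) V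
     (D (input1 f1 w j) (input2 f2 w j))) in
  [/\ m%:R * (- (\sum_s source_pmf s * ln (c1 s.2 s.1.1)) - d) <= I (fun u _ => out1 u V),
      m%:R * (- (\sum_s source_pmf s * ln (c2 s.2 s.1.2)) - d) <= I (fun _ v => out2 v V) &
      m%:R * (- (\sum_s source_pmf s * ln (c1 s.2 s.1.1 * c2 s.2 s.1.2)) - d) <=
        I (fun u v => out12 u v V)].
Proof.
(* [eta] makes [- ln (1 - eta)] equal to [d / 2], and [e] below makes the error term equal to the
   other half. Neither depends on the channel, the code or the block lengths. *)
move=> d0; pose eta := 1 - expR (- (d / 2)).
have x1 : expR (- (d / 2)) < 1 by rewrite expR_lt1; lra.
have x0 := expR_gt0 (- (d / 2)).
have eta0 : 0 < eta by rewrite /eta; lra.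
have eta1 : eta < 1 by rewrite /eta; lra.
have l_eta : - ln (1 - eta) = d / 2 by rewrite /eta subKr expRK opprK.
set K : R := (#|S1| * #|S2|)%:R.
have [h1 h2] := source_card_gt0.
have K1 : 1 <= K by rewrite /K ler1n muln_gt0 h1.
have L0 : 0 < ln (K / eta) by rewrite ln_gt0 // ltr_pdivlMr // mul1r; lra.
exists (d / 2 / ln (K / eta)); first by rewrite !divr_gt0.
move=> Z V m n f1 f2 g VP m0 he.
have sl := slack_le VP m0 eta0 eta1 he.
rewrite l_eta -/K divfK ?gt_eqF // in sl.
rewrite -splitr in sl.
have c1' := converse1 VP f1 f2 g eta0 eta1.
have c2' := converse2 VP f1 f2 g eta0 eta1.
have c12' := converse12 VP f1 f2 g eta0 eta1.
rewrite l_eta in c1' c2' c12'.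
by move=> I; split; rewrite mulrBr mulrN lerBlDr;
  [apply: (le_trans c1')|apply: (le_trans c2')|apply: (le_trans c12')]; rewrite lerD2l.
Qed.

End Converse.

(** * Cardinality of the time-sharing alphabet *)

Section Pentagon.
Variables (R : realType) (A B Z : finType) (u : A -> R) (v : B -> R) (V : A -> B -> Z -> R).
Hypotheses (uP : pmf u) (vP : pmf v) (VP : forall a b, pmf (V a b)).
Local Notation I := (info u v V).
Local Notation D1 := (out1 u V).
Local Notation D2 := (out2 v V).
Local Notation D12 := (out12 u v V).
Let u0 a : 0 <= u a. Proof. exact: (proj1 uP). Qed.
Let v0 b : 0 <= v b. Proof. exact: (proj1 vP). Qed.
Let V0 a b z : 0 <= V a b z. Proof. exact: (proj1 (VP a b)). Qed.

Let D1_ge0 a b z : 0 <= D1 a b z.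
Proof. by apply: sumr_ge0 => x _; rewrite mulr_ge0. Qed.
Let D2_ge0 a b z : 0 <= D2 a b z.
Proof. by apply: sumr_ge0 => x _; rewrite mulr_ge0. Qed.
Let D12_ge0 a b z : 0 <= D12 a b z.
Proof. by apply: sumr_ge0 => x _; apply: sumr_ge0 => y _; rewrite !mulr_ge0. Qed.

Lemma out_gt0 a b z : 0 < u a * v b * V a b z ->
  [/\ 0 < V a b z, 0 < D1 a b z, 0 < D2 a b z & 0 < D12 a b z].
Proof.
move=> h.
have Vp : 0 < V a b z.
  by rewrite lt0r V0 andbT; apply: contraTneq h => ->; rewrite mulr0 ltxx.
have up : 0 < u a.
  by rewrite lt0r u0 andbT; apply: contraTneq h => ->; rewrite !mul0r ltxx.
have vp : 0 < v b.
  by rewrite lt0r v0 andbT; apply: contraTneq h => ->; rewrite mulr0 mul0r ltxx.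
split=> //.
- by apply: lt_le_trans (out1_le _ _ _ u0 V0); rewrite mulr_gt0.
- by apply: lt_le_trans (out2_le _ _ _ v0 V0); rewrite mulr_gt0.
- exact: lt_le_trans (out12_le _ _ _ u0 v0 V0).
Qed.

Lemma eq_mean (F G : A -> B -> Z -> R) :
  (forall a b z, 0 < u a * v b * V a b z -> F a b z = G a b z) ->
  \sum_a \sum_b \sum_z u a * v b * V a b z * F a b z =
  \sum_a \sum_b \sum_z u a * v b * V a b z * G a b z.
Proof.
move=> h; apply: eq_bigr => a _; apply: eq_bigr => b _; apply: eq_bigr => z _.
have [->|ne0] := eqVneq (u a * v b * V a b z) 0; first by rewrite !mul0r.
by rewrite h // lt0r ne0 !mulr_ge0.
Qed.

(** [gibbs] for [u v V] against [u v E]. Every inequality of the pentagon is brought to this form: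
    [infoB] writes a difference of informations as [info] for a suitable [E], and only the mass of
    [u v E] has to be checked. *)
Lemma info_ge0 (E : A -> B -> Z -> R) : (forall a b z, 0 <= E a b z) ->
  (forall a b z, 0 < u a * v b * V a b z -> 0 < E a b z) ->
  \sum_a \sum_b \sum_z u a * v b * E a b z <= 1 -> 0 <= I E.
Proof.
move=> E0 Ep E1.
pose P (t : A * B * Z) := u t.1.1 * v t.1.2 * V t.1.1 t.1.2 t.2.
pose T (t : A * B * Z) := u t.1.1 * v t.1.2 * E t.1.1 t.1.2 t.2.
have P0 t : 0 <= P t by rewrite !mulr_ge0.
have T0 t : 0 <= T t by rewrite !mulr_ge0.
have up a b z : 0 < u a * v b * V a b z -> 0 < u a * v b.
  by move=> h; rewrite lt0r mulr_ge0 // andbT; apply: contraTneq h => ->; rewrite mul0r ltxx.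
have PT t : 0 < P t -> 0 < T t.
  by move=> h; apply: mulr_gt0; [exact: up h|exact: Ep].
have P1 : \sum_t P t = 1.
  rewrite !sum_pair -[RHS](proj2 uP); apply: eq_bigr => a _.
  rewrite -[RHS]mulr1 -[X in _ = _ * X](proj2 vP) mulr_sumr; apply: eq_bigr => b _.
  by rewrite /P /= -mulr_sumr (proj2 (VP a b)) mulr1.
have := gibbs P0 T0 PT; rewrite P1 !sum_pair => /(_ E1) /le_trans; apply.
rewrite le_eqVlt; apply/orP; left; apply/eqP; rewrite /P /T /=.
apply: (eq_mean (F := fun a b z => ln (u a * v b * V a b z / (u a * v b * E a b z)))) => a b z h.
have h' := up _ _ _ h; have h2 := Ep _ _ _ h.
by congr ln; rewrite -mulf_div divff ?mul1r // gt_eqF.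
Qed.

Lemma sum_out12 a b : \sum_z D12 a b z = 1.
Proof.
rewrite exchange_big -[RHS](proj2 uP); apply: eq_bigr => x _.
rewrite exchange_big -[RHS]mulr1 -[X in _ = _ * X](proj2 vP) mulr_sumr; apply: eq_bigr => y _.
by rewrite -mulr_sumr (proj2 (VP x y)) mulr1.
Qed.

Lemma sum_uv_out12 : \sum_a \sum_b \sum_z u a * v b * D12 a b z = 1.
Proof.
rewrite -[RHS](proj2 uP); apply: eq_bigr => a _.
rewrite -[RHS]mulr1 -[X in _ = _ * X](proj2 vP) mulr_sumr; apply: eq_bigr => b _.
by rewrite -mulr_sumr sum_out12 mulr1.
Qed.

Let divK_le (x y : R) : 0 <= x -> 0 <= y -> x * (y / x) <= y.
Proof.
move=> x0 y0; have [->|ne] := eqVneq x 0; first by rewrite mul0r.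
by rewrite mulrC divfK.
Qed.

Lemma info1_ge0 : 0 <= I D1.
Proof.
apply: info_ge0 => //; first by move=> a b z /out_gt0[].
rewrite -[leRHS](proj2 uP); apply: ler_sum => a _.
rewrite -[leRHS]mulr1 -[X in _ <= _ * X](proj2 vP) mulr_sumr; apply: ler_sum => b _.
rewrite -mulr_sumr ler_piMr ?mulr_ge0 // exchange_big -[leRHS](proj2 uP).
by apply: ler_sum => x _; rewrite -mulr_sumr (proj2 (VP x b)) mulr1.
Qed.

Lemma info2_ge0 : 0 <= I D2.
Proof.
apply: info_ge0 => //; first by move=> a b z /out_gt0[].
rewrite -[leRHS](proj2 uP); apply: ler_sum => a _.
rewrite -[leRHS]mulr1 -[X in _ <= _ * X](proj2 vP) mulr_sumr; apply: ler_sum => b _.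
rewrite -mulr_sumr ler_piMr ?mulr_ge0 // exchange_big -[leRHS](proj2 vP).
by apply: ler_sum => x _; rewrite -mulr_sumr (proj2 (VP a x)) mulr1.
Qed.

Lemma infoB (E F G : A -> B -> Z -> R) :
  (forall a b z, 0 < u a * v b * V a b z ->
     ln (V a b z / E a b z) = ln (V a b z / F a b z) - ln (V a b z / G a b z)) ->
  I E = I F - I G.
Proof.
move=> h; rewrite /info (eq_mean h) -sumrB; apply: eq_bigr => a _.
rewrite -sumrB; apply: eq_bigr => b _; rewrite -sumrB; apply: eq_bigr => z _.
by rewrite mulrBr.
Qed.

(** The difference of the two sides is I(X2;Z), the mean of [ln (D1 / D12)]. *)
Lemma info1_le12 : I D1 <= I D12.
Proof.
rewrite -subr_ge0 -(infoB (E := fun a b z => V a b z * (D12 a b z / D1 a b z))); last first.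
  move=> a b z /out_gt0[h h1 h2 h12].
  have -> : V a b z / (V a b z * (D12 a b z / D1 a b z)) = D1 a b z / D12 a b z.
    by field; rewrite !gt_eqF.
  by rewrite !ln_div ?posrE //; ring.
apply: info_ge0.
- by move=> a b z; rewrite !mulr_ge0 ?invr_ge0.
- by move=> a b z /out_gt0[h h1 h2 h12]; rewrite mulr_gt0 ?divr_gt0.
rewrite -sum_uv_out12 exchange_big [leRHS]exchange_big /=; apply: ler_sum => b _.
rewrite exchange_big [leRHS]exchange_big /=; apply: ler_sum => z _.
rewrite [leRHS](_ : _ = v b * \sum_a u a * D12 a b z); last first.
  by rewrite mulr_sumr; apply: eq_bigr => a _; ring.
rewrite [leLHS](_ : _ = v b * \sum_a u a * V a b z * (D12 a b z / D1 a b z)); last first.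
  by rewrite mulr_sumr; apply: eq_bigr => a _; ring.
apply: ler_wpM2l => //.
rewrite /out12 /out1 -!mulr_suml (proj2 uP) mul1r; apply: divK_le.
  by apply: sumr_ge0 => x _; rewrite mulr_ge0.
by apply: sumr_ge0 => x _; apply: sumr_ge0 => y _; rewrite !mulr_ge0.
Qed.

Lemma info2_le12 : I D2 <= I D12.
Proof.
rewrite -subr_ge0 -(infoB (E := fun a b z => V a b z * (D12 a b z / D2 a b z))); last first.
  move=> a b z /out_gt0[h h1 h2 h12].
  have -> : V a b z / (V a b z * (D12 a b z / D2 a b z)) = D2 a b z / D12 a b z.
    by field; rewrite !gt_eqF.
  by rewrite !ln_div ?posrE //; ring.
apply: info_ge0.
- by move=> a b z; rewrite !mulr_ge0 ?invr_ge0.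
- by move=> a b z /out_gt0[h h1 h2 h12]; rewrite mulr_gt0 ?divr_gt0.
rewrite -sum_uv_out12; apply: ler_sum => a _.
rewrite exchange_big [leRHS]exchange_big /=; apply: ler_sum => z _.
rewrite [leRHS](_ : _ = u a * \sum_b v b * D12 a b z); last first.
  by rewrite mulr_sumr; apply: eq_bigr => b _; ring.
rewrite [leLHS](_ : _ = u a * \sum_b v b * V a b z * (D12 a b z / D2 a b z)); last first.
  by rewrite mulr_sumr; apply: eq_bigr => b _; ring.
apply: ler_wpM2l => //.
rewrite /out12 /out2 -!mulr_suml (proj2 vP) mul1r; apply: divK_le.
  by apply: sumr_ge0 => x _; rewrite mulr_ge0.
by apply: sumr_ge0 => x _; apply: sumr_ge0 => y _; rewrite !mulr_ge0.
Qed.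

(** The defect of the inequality is the mean of [ln (V * D12 / (D1 * D2))], which for independent
    inputs is I(X1;X2|Z). [G] is a stopover, with [I G] equal to I(X1;Z), because [infoB] subtracts
    one information at a time. *)
Lemma info12_le : I D12 <= I D1 + I D2.
Proof.
pose G a b z := V a b z * (D12 a b z / D2 a b z).
pose E a b z := D1 a b z * D2 a b z / D12 a b z.
have eG : I G = I D12 - I D2.
  apply: infoB => a b z /out_gt0[h h1 h2 h12].
  have -> : V a b z / G a b z = D2 a b z / D12 a b z by rewrite /G; field; rewrite !gt_eqF.
  by rewrite !ln_div ?posrE //; ring.
have eE : I E = I D1 - I G.
  apply: infoB => a b z /out_gt0[h h1 h2 h12].
  have -> : V a b z / G a b z = D2 a b z / D12 a b z by rewrite /G; field; rewrite !gt_eqF.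
  have -> : V a b z / E a b z = (V a b z * D12 a b z) / (D1 a b z * D2 a b z).
    by rewrite /E; field; rewrite !gt_eqF.
  by rewrite !ln_div ?posrE ?mulr_gt0 // !lnM ?posrE //; ring.
suff : 0 <= I E by rewrite eE eG; lra.
apply: info_ge0.
- by move=> a b z; rewrite !mulr_ge0 ?invr_ge0.
- by move=> a b z /out_gt0[h h1 h2 h12]; rewrite divr_gt0 ?mulr_gt0.
(* [D12] is constant in both inputs, [D1] in the first and [D2] in the second; [a0] and [b0] serve
   to name these constants, and the double sum then factorizes. *)
have [a0 _] := pmf_witness uP; have [b0 _] := pmf_witness vP.
rewrite -(sum_out12 a0 b0).
under eq_bigr do rewrite exchange_big.
rewrite exchange_big /=; apply: ler_sum => z _.
set d := D12 a0 b0 z.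
have eb : \sum_b v b * D1 a0 b z = d.
  rewrite /d /out12 exchange_big; apply: eq_bigr => b _; rewrite mulr_sumr.
  by apply: eq_bigr => a _; ring.
have ea : \sum_a u a * D2 a b0 z = d.
  rewrite /d /out12; apply: eq_bigr => a _; rewrite mulr_sumr.
  by apply: eq_bigr => b _; ring.
apply: (@le_trans _ _ (d * (d / d))); last by rewrite divK_le ?D12_ge0.
rewrite le_eqVlt; apply/orP; left; apply/eqP.
transitivity ((\sum_a u a * D2 a b0 z) * ((\sum_b v b * D1 a0 b z) / d)); last by rewrite ea eb.
rewrite mulr_suml; apply: eq_bigr => a _.
rewrite mulr_suml mulr_sumr; apply: eq_bigr => b _.
rewrite /E -[D12 a b z]/d -[D1 a b z]/(D1 a0 b z) -[D2 a b z]/(D2 a b0 z); ring.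
Qed.

End Pentagon.

(** * Conic Caratheodory and the splitting of averaged pentagons *)

Section Caratheodory.
Variable R : realType.

(** More than [k] vectors in dimension [k] are dependent, and changing the sign of the dependence if
    necessary makes its sum nonnegative. *)
Lemma conic_dependence (T : finType) k (x : T -> 'rV[R]_k) (D : {set T}) : (k < #|D|)%N ->
  exists z : T -> R, [/\ forall t, t \notin D -> z t = 0, \sum_t z t *: x t = 0,
    0 <= \sum_t z t & exists t, z t != 0].
Proof.
move=> kD; have [t0 t0D] : exists t, t \in D by apply/card_gt0P; apply: leq_ltn_trans kD.
pose M : 'M[R]_(#|D|, k) := \matrix_i x (enum_val i).
have : kermx M != 0.
  by rewrite -mxrank_eq0 mxrank_ker subn_eq0 -ltnNge (leq_ltn_trans (rank_leq_col M)).
case/rowV0Pn => y /sub_kermxP yM y0.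
pose z0 t := if t \in D then y 0 (enum_rank_in t0D t) else 0.
have z0v i : z0 (enum_val i) = y 0 i by rewrite /z0 enum_valP enum_valK_in.
have z0D t : t \notin D -> z0 t = 0 by rewrite /z0 => /negPf ->.
have z0x : \sum_t z0 t *: x t = 0.
  rewrite (bigID (mem D)) /= [X in _ + X]big1 ?addr0; last by move=> t /z0D ->; rewrite scale0r.
  rewrite big_enum_val /= -[RHS]yM mulmx_sum_row; apply: eq_bigr => i _.
  by rewrite z0v rowK.
have [t z0t] : exists t, z0 t != 0.
  have [i yi] : exists i, y 0 i != 0.
    apply/existsP; apply: contraNT y0 => /existsPn h; apply/eqP/rowP => i.
    by rewrite mxE; apply/eqP; move: (h i); rewrite negbK.
  by exists (enum_val i); rewrite z0v.
have [s0|s0] := leP 0 (\sum_t z0 t).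
  by exists z0; split => //; exists t.
exists (fun t => - z0 t); split.
- by move=> ? /z0D ->; rewrite oppr0.
- by under eq_bigr do rewrite scaleNr; rewrite sumrN z0x oppr0.
- by rewrite sumrN oppr_ge0 ltW.
- by exists t; rewrite oppr_eq0.
Qed.

(* Moving along a dependence [z] with [0 <= \sum z] keeps the combination, does not increase the
   total weight, and eventually kills a coefficient; this gives [k] points instead of [k + 1]. *)
Lemma conic_caratheodory (T : finType) k (x : T -> 'rV[R]_k) (w : T -> R) :
  (forall t, 0 <= w t) ->
  exists w' : T -> R, [/\ forall t, 0 <= w' t, \sum_t w' t <= \sum_t w t,
    \sum_t w' t *: x t = \sum_t w t *: x t & (#|[set t | w' t != 0%R]| <= k)%N].
Proof.
have [n] := ubnP #|[set t | w t != 0]|.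
elim: n w => // n IH w; rewrite ltnS => wn w0.
have [le|gt] := leqP #|[set t | w t != 0]| k; first by exists w.
have [z [zD zx zs [t1 zt1]]] := conic_dependence x gt.
(* A nonzero [z] with nonnegative sum has a positive entry, so subtracting multiples of [z] does
   lower some coefficient. *)
have [t2 zt2] : exists t, 0 < z t.
  apply: contrapT => /forallNP h.
  have zle t : z t <= 0 by rewrite leNgt; apply/negP.
  have : \sum_t - z t = 0.
    by apply: le_anti; rewrite sumr_ge0 ?andbT => [|t _]; rewrite ?sumrN ?oppr_le0 ?oppr_ge0.
  move=> /eqP; rewrite psumr_eq0 => [/allP /(_ t1 (mem_index_enum _))|t _].
    by rewrite oppr_eq0 (negPf zt1).
  by rewrite oppr_ge0.
(* The coefficient that reaches [0] first; stopping there keeps all the others nonnegative. *)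
pose t := [arg min_(i < t2 | 0 < z i) (w i / z i)]%O.
have [zt tmin] : 0 < z t /\ forall i, 0 < z i -> w t / z t <= w i / z i.
  by rewrite /t; case: arg_minP.
pose c := w t / z t.
have c0 : 0 <= c by rewrite divr_ge0 // ltW.
pose w1 i := w i - c * z i.
have w10 i : 0 <= w1 i.
  rewrite subr_ge0; have [zi|zi] := ltP 0 (z i).
    by rewrite -ler_pdivlMr // tmin.
  by apply: (@le_trans _ _ 0) => //; rewrite mulr_ge0_le0.
have w1t : w1 t = 0 by rewrite /w1 /c divfK ?subrr // gt_eqF.
have wt : t \in [set t | w t != 0].
  by apply: contraTT zt => /zD ->; rewrite ltxx.
have sub : [set i | w1 i != 0] \subset [set i | w i != 0] :\ t.
  apply/fintype.subsetP => i; rewrite !inE => h; apply/andP; split.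
    by apply: contraNneq h => ->; rewrite w1t.
  apply: contraNneq h => wi; rewrite /w1 wi zD ?mulr0 ?subrr //.
  by rewrite inE wi eqxx.
have lt : (#|[set i | w1 i != 0%R]| < n)%N.
  apply: leq_ltn_trans (subset_leq_card sub) _; apply: leq_trans wn.
  by rewrite [X in (_ < X)%N](cardsD1 t) wt.
have [w' [h0 h1 h2 h3]] := IH _ lt w10.
exists w'; split=> //.
  apply: le_trans h1 _; rewrite sumrB -mulr_sumr gerBl.
  by rewrite mulr_ge0.
rewrite h2 /w1; under eq_bigr do rewrite scalerBl -scalerA.
by rewrite sumrB -scaler_sumr zx scaler0 subr0.
Qed.

(** The conic combination keeps the four sums exactly, with total weight at most [1]. As the
    coordinates are nonnegative, restoring the missing weight can only increase the sums, hence the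
    inequality in the conclusion. *)
Lemma four_points (T : finType) (w : T -> R) (x : T -> 'I_4 -> R) : pmf w ->
  (forall t i, 0 <= x t i) ->
  exists (e : 'I_4 -> T) (pq : 'I_4 -> R), pmf pq /\
    forall k, \sum_t w t * x t k <= \sum_i pq i * x (e i) k.
Proof.
move=> wP x0; have [w0 w1] := wP; have [t0 _] := pmf_witness wP.
have [w' [h0 h1 h2 h3]] := conic_caratheodory (fun t => \row_k x t k) w0.
pose s := enum [set t | w' t != 0].
have ss : (size s <= 4)%N by rewrite -cardE.
pose e (i : 'I_4) := nth t0 s i.
pose p0 (i : 'I_4) := if (i < size s)%N then w' (e i) else 0.
have sumE (F : T -> R) : \sum_t w' t * F t = \sum_i p0 i * F (e i).
  rewrite (bigID (fun t => w' t != 0)) /= [X in _ + X]big1 ?addr0; last first.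
    by move=> t; rewrite negbK => /eqP ->; rewrite mul0r.
  transitivity (\sum_(t <- s) w' t * F t).
    by rewrite big_enum /=; apply: eq_bigl => t; rewrite inE.
  rewrite (big_nth t0) big_mkord (big_ord_widen 4 (fun i => w' (nth t0 s i) * F (nth t0 s i))) //.
  by rewrite big_mkcond; apply: eq_bigr => i _; rewrite /p0 /e; case: ifP => //; rewrite mul0r.
have p00 i : 0 <= p0 i by rewrite /p0; case: ifP.
(* The missing weight, all given to index [0]. Indices beyond the support stand for [t0] and start
   with weight [0]. *)
pose d := 1 - \sum_i p0 i.
have d0 : 0 <= d.
  rewrite subr_ge0 -w1; apply: le_trans h1.
  have := sumE (fun=> 1).
  under eq_bigr do rewrite mulr1.
  by under [RHS]eq_bigr do rewrite mulr1; move=> ->.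
exists e, (fun i => p0 i + (if i == ord0 then d else 0)); split.
  split=> [i|]; first by rewrite addr_ge0 //; case: ifP.
  rewrite big_split /= [X in _ + X](_ : _ = d); first by rewrite /d addrC subrK.
  by rewrite -big_mkcond big_pred1_eq.
move=> k; have -> : \sum_t w t * x t k = \sum_i p0 i * x (e i) k.
  rewrite -(sumE (x^~ k)); move/rowP/(_ k): h2; rewrite !summxE => /esym h2.
  under eq_bigr => t _ do have -> : w t * x t k = (w t *: \row_k x t k) 0 k by rewrite !mxE.
  by rewrite h2; apply: eq_bigr => t _; rewrite !mxE.
apply: ler_sum => i _; apply: ler_wpM2r => //.
by rewrite lerDl; case: ifP.
Qed.

(* [r1, r2] is a point of the segment joining the corners [(a, d - a)] and [(d - c, c)], with the
   same barycentric coordinate for all [t]. *)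
Lemma pentagon_split (T : finType) (w a c d : T -> R) (h1 h2 : R) : pmf w ->
  (forall t, 0 <= a t <= d t) -> (forall t, 0 <= c t <= d t) -> (forall t, d t <= a t + c t) ->
  h1 <= \sum_t w t * a t -> h2 <= \sum_t w t * c t -> h1 + h2 <= \sum_t w t * d t ->
  exists r1 r2 : T -> R, [/\ forall t, 0 <= r1 t <= a t, forall t, 0 <= r2 t <= c t,
    forall t, r1 t + r2 t = d t, h1 <= \sum_t w t * r1 t & h2 <= \sum_t w t * r2 t].
Proof.
move=> wP ha hc hd; set A := \sum_t w t * a t; set C := \sum_t w t * c t.
set D := \sum_t w t * d t => hA hC hD.
have le : D <= A + C.
  rewrite /A /C -big_split; apply: ler_sum => t _ /=; rewrite -mulrDr ler_wpM2l //.
  by case: wP.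
have leA : A <= D by apply: ler_sum => t _; rewrite ler_wpM2l //; [case: wP|case/andP: (ha t)].
have leC : C <= D by apply: ler_sum => t _; rewrite ler_wpM2l //; [case: wP|case/andP: (hc t)].
have [l [l0 l1 hl1 hl2]] : exists l, [/\ 0 <= l, l <= 1,
    h1 <= D - C + l * (A + C - D) & h2 <= C - l * (A + C - D)].
  have [g0|g0] := eqVneq (A + C - D) 0.
    by exists 0; rewrite g0 !mul0r; split=> //; lra.
  have gp : 0 < A + C - D by rewrite lt0r g0 /=; lra.
  (* Solves [D - C + l * (A + C - D) = max h1 (D - C)]: the first coordinate is taken as small as
     [h1] and the segment allow, which leaves the most for the second. If [A + C = D] the segment is
     a point, treated apart. *)
  exists ((Num.max h1 (D - C) - (D - C)) / (A + C - D)).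
  have m1 : h1 <= Num.max h1 (D - C) by rewrite le_max lexx.
  have m2 : D - C <= Num.max h1 (D - C) by rewrite le_max lexx orbT.
  have m3 : Num.max h1 (D - C) <= A by rewrite ge_max hA /=; lra.
  have m4 : Num.max h1 (D - C) <= D - h2 by rewrite ge_max; apply/andP; split; lra.
  split; rewrite ?divfK //; [|..|lra|lra].
    by rewrite divr_ge0 ?subr_ge0 // ltW.
  by rewrite ler_pdivrMr // mul1r; lra.
pose r1 t := (d t - c t) + l * (a t + c t - d t).
have sr1 : \sum_t w t * r1 t = D - C + l * (A + C - D).
  rewrite /A /C /D -big_split -!sumrB mulr_sumr -big_split; apply: eq_bigr => t _ /=.
  by rewrite /r1; ring.
exists r1, (fun t => d t - r1 t); split=> [t|t|t||].
- move: (ha t) (hc t) (hd t) => /andP[? ?] /andP[? ?] ?.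
  have : 0 <= l * (a t + c t - d t) by rewrite mulr_ge0 //; lra.
  have : l * (a t + c t - d t) <= a t + c t - d t by rewrite ler_piMl //; lra.
  by rewrite /r1 => ? ?; apply/andP; split; lra.
- move: (ha t) (hc t) (hd t) => /andP[? ?] /andP[? ?] ?.
  have : 0 <= l * (a t + c t - d t) by rewrite mulr_ge0 //; lra.
  have : l * (a t + c t - d t) <= a t + c t - d t by rewrite ler_piMl //; lra.
  by rewrite /r1 => ? ?; apply/andP; split; lra.
- by rewrite addrC subrK.
- by rewrite sr1.
under eq_bigr do rewrite mulrBr.
by rewrite sumrB sr1 -/D; lra.
Qed.

End Caratheodory.

Section Rates.
Variables (R : realType) (X1 X2 Z : finType) (V : X1 -> X2 -> Z -> R).
Variables (Q : finType) (pq : Q -> R) (p1 : Q -> X1 -> R) (p2 : Q -> X2 -> R).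

Definition rate1 := \sum_q pq q * info (p1 q) (p2 q) V (out1 (p1 q) V).
Definition rate2 := \sum_q pq q * info (p1 q) (p2 q) V (out2 (p2 q) V).
Definition rate12 := \sum_q pq q * info (p1 q) (p2 q) V (out12 (p1 q) (p2 q) V).

Definition rates_ge (h1 h2 h12 : R) := [/\ h1 <= rate1, h2 <= rate2 & h12 <= rate12].

End Rates.

(** * Reduction to four time-sharing values *)

Section TimeSharing.
Variables (R : realType) (X1 X2 : finType).

Lemma time_sharing_four (Z1 Z2 : finType) (V1 : X1 -> X2 -> Z1 -> R) (V2 : X1 -> X2 -> Z2 -> R)
    (Q : finType) (pq : Q -> R) (p1 : Q -> X1 -> R) (p2 : Q -> X2 -> R) (h1 h2 : R) :
  (forall a b, pmf (V1 a b)) -> (forall a b, pmf (V2 a b)) ->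
  pmf pq -> (forall q, pmf (p1 q)) -> (forall q, pmf (p2 q)) ->
  rates_ge V1 pq p1 p2 h1 h2 (h1 + h2) -> rates_ge V2 pq p1 p2 h1 h2 (h1 + h2) ->
  exists (rq : 'I_4 -> R) (r1 : 'I_4 -> X1 -> R) (r2 : 'I_4 -> X2 -> R),
    [/\ pmf rq, forall q, pmf (r1 q), forall q, pmf (r2 q),
      rates_ge V1 rq r1 r2 h1 h2 (h1 + h2) & rates_ge V2 rq r1 r2 h1 h2 (h1 + h2)].
Proof.
move=> V1P V2P pqP p1P p2P.
have split_rates (Z : finType) (V : X1 -> X2 -> Z -> R) : (forall a b, pmf (V a b)) ->
    rates_ge V pq p1 p2 h1 h2 (h1 + h2) -> exists r1 r2 : Q -> R,
    [/\ forall q, 0 <= r1 q <= info (p1 q) (p2 q) V (out1 (p1 q) V),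
        forall q, 0 <= r2 q <= info (p1 q) (p2 q) V (out2 (p2 q) V),
        forall q, r1 q + r2 q = info (p1 q) (p2 q) V (out12 (p1 q) (p2 q) V),
        h1 <= \sum_q pq q * r1 q & h2 <= \sum_q pq q * r2 q].
  move=> VP [g1 g2 g12]; apply: pentagon_split => // q.
  - by rewrite info1_ge0 ?info1_le12.
  - by rewrite info2_ge0 ?info2_le12.
  - exact: info12_le.
move=> /(split_rates _ _ V1P)[a1 [a2 [ha1 ha2 ha12 ga1 ga2]]].
move=> /(split_rates _ _ V2P)[b1 [b2 [hb1 hb2 hb12 gb1 gb2]]].
(* Two split coordinates for each receiver. The two receivers split differently, but the weights
   [rq] and the points [e] will be common. *)
pose x (q : Q) (i : 'I_4) := nth 0 [:: a1 q; a2 q; b1 q; b2 q] i.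
have x0 q i : 0 <= x q i.
  move: (ha1 q) (ha2 q) (hb1 q) (hb2 q) => /andP[? _] /andP[? _] /andP[? _] /andP[? _].
  by rewrite /x; case: i => -[|[|[|[|]]]].
have [e [rq [rqP hx]]] := four_points pqP x0.
have bound (F G : Q -> R) (i : 'I_4) h : (forall q, x q i = F q) -> h <= \sum_q pq q * F q ->
    (forall q, 0 <= F q <= G q) -> h <= \sum_i rq i * F (e i) /\ h <= \sum_i rq i * G (e i).
  move=> xF hF FG; have h' : h <= \sum_i rq i * F (e i).
    apply: le_trans hF _; under eq_bigr do rewrite -xF.
    by apply: le_trans (hx i) _; apply: ler_sum => j _; rewrite xF.
  split=> //; apply: le_trans h' _; apply: ler_sum => j _; apply: ler_wpM2l.
    by case: rqP.
  by case/andP: (FG (e j)).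
have [u1 v1] := bound a1 _ (@Ordinal 4 0 isT) h1 (fun=> erefl) ga1 ha1.
have [u2 v2] := bound a2 _ (@Ordinal 4 1 isT) h2 (fun=> erefl) ga2 ha2.
have [u3 v3] := bound b1 _ (@Ordinal 4 2 isT) h1 (fun=> erefl) gb1 hb1.
have [u4 v4] := bound b2 _ (@Ordinal 4 3 isT) h2 (fun=> erefl) gb2 hb2.
exists rq, (p1 \o e), (p2 \o e); split => //; first by move=> q; exact: p1P.
- by move=> q; exact: p2P.
(* The split coordinates add up to the sum information at every [q], so the third inequality is the
   sum of two that were kept. *)
- split=> //; rewrite /rate12; under eq_bigr do rewrite /= -ha12 mulrDr.
  by rewrite big_split lerD.
- split=> //; rewrite /rate12; under eq_bigr do rewrite /= -hb12 mulrDr.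
  by rewrite big_split lerD.
Qed.

End TimeSharing.

(** * Continuity of [x ln x] and removal of error terms by compactness *)

Section Approximation.
Variable R : realType.

(* Absolute values make [xlnx] continuous on the whole line, not only on the half-line [x >= 0]. *)
Definition xlnx (x : R) : R := `|x| * ln `|x|.

(** At [0] the function is squeezed by [2 * sqrt |x|], which follows from [ln y <= y - 1] at
    [y = 1 / sqrt |x|]. *)
Lemma xlnx_continuous : continuous xlnx.
Proof.
move=> x; have [->|x0] := eqVneq x 0; last first.
  apply: continuousM; first exact: norm_continuous.
  apply: (@continuous_comp _ _ _ (fun x : R => `|x|) (@ln R)); first exact: norm_continuous.
  by apply: continuous_ln; rewrite normr_gt0.
pose g (y : R) := 2 * Num.sqrt `|y|.
have cg : {for 0, continuous g}.
  apply: continuousM; first exact: cst_continuous.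
  apply: (@continuous_comp _ _ _ (fun x : R => `|x|) Num.sqrt); first exact: norm_continuous.
  exact: sqrt_continuous.
have g0 : g 0 = 0 by rewrite /g normr0 sqrtr0 mulr0.
have cg0 : (g y @[y --> (0 : R)] --> g 0)%classic := cg.
rewrite g0 in cg0.
change ((xlnx y @[y --> (0 : R)] --> xlnx 0)%classic).
have -> : xlnx 0 = 0 by rewrite /xlnx normr0 mul0r.
apply: (@squeeze_cvgr _ _ _ _ (fun y => - g y) g) => //; last first.
  have cn : ((fun y => - g y) y @[y --> (0 : R)] --> - (0 : R))%classic by apply: cvgN.
  by rewrite oppr0 in cn.
near=> y.
have y1 : `|y| <= 1.
  near: y; apply/nbhs_ballP; exists 1 => //= y; rewrite /ball /= sub0r normrN; exact: ltW.
rewrite /xlnx /g; have [->|y0] := eqVneq y 0.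
  by rewrite normr0 sqrtr0 mulr0 mul0r oppr0 lexx.
set s := `|y|; have s0 : 0 < s by rewrite normr_gt0.
have q0 : 0 < Num.sqrt s by rewrite sqrtr_gt0.
have ss : Num.sqrt s * Num.sqrt s = s by rewrite -expr2 sqr_sqrtr // ltW.
have up : s * ln s <= 0 by rewrite mulr_ge0_le0 ?ln_le0 // ltW.
have lo : - (2 * Num.sqrt s) <= s * ln s.
  have := ln_leB1 (_ : 0 < (Num.sqrt s)^-1); rewrite invr_gt0 => /(_ q0).
  rewrite lnV ?posrE // => h.
  have -> : ln s = ln (Num.sqrt s) + ln (Num.sqrt s) by rewrite -lnM ?posrE // ss.
  have : s * (- ln (Num.sqrt s)) <= s * ((Num.sqrt s)^-1 - 1) by rewrite ler_pM2l.
  have -> : s * ((Num.sqrt s)^-1 - 1) = Num.sqrt s - s.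
    rewrite mulrBr mulr1; congr (_ - _).
    by apply: (canLR (mulfK (lt0r_neq0 q0))); rewrite ss.
  lra.
apply/andP; split; lra.
Unshelve. all: by end_near. Qed.

Lemma continuous_sum (T : topologicalType) (I : finType) (F : I -> T -> R) :
  (forall i, continuous (F i)) -> continuous (fun x => \sum_i F i x).
Proof.
move=> h; elim: (index_enum I) => [|i r IH].
  by under eq_fun do rewrite big_nil; exact: cst_continuous.
under eq_fun do rewrite big_cons.
by move=> x; apply: continuousD; [exact: h|exact: IH].
Qed.

Lemma continuous_mul (T : topologicalType) (f g : T -> R) :
  continuous f -> continuous g -> continuous (fun x => f x * g x).
Proof. by move=> cf cg x; apply: continuousM; [exact: cf|exact: cg]. Qed.

(** [phi] is minus the total shortfall in the inequalities. It attains its maximum on [K], and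
    approximate solutions with arbitrarily small error force this maximum to be [0]. *)
Lemma compact_approx (T : topologicalType) (K : set T) (J : finType) (G : J -> T -> R)
    (h : J -> R) : compact K -> (forall j, continuous (G j)) ->
  (forall d, 0 < d -> exists x, K x /\ forall j, h j - d <= G j x) ->
  exists x, K x /\ forall j, h j <= G j x.
Proof.
move=> cK cG H.
pose phi x := \sum_j Num.min (G j x - h j) 0.
have cphi : continuous phi.
  apply: (@continuous_sum _ _ (fun j x => Num.min (G j x - h j) 0)) => j x.
  apply: (@continuous_min R T (fun x => G j x - h j) (fun=> 0) x).
    by apply: continuousB; [exact: cG|exact: cst_continuous].
  exact: cst_continuous.
have K0 : (K !=set0)%classic by have [x [Kx _]] := H _ ltr01; exists x.
have [x xK xmax] := compact_EVT_max K0 cK (continuous_subspaceT cphi).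
have Kx : K x by move: xK; rewrite inE.
have phi0 : 0 <= phi x.
  rewrite leNgt; apply/negP => lt.
  (* With the [+ 1] a shortfall of [- phi x / c] in each of the [#|J|] inequalities totals strictly
     less than [- phi x], so [y] would beat the maximum. *)
  pose c : R := #|J|%:R + 1.
  have c0 : 0 < c by rewrite /c ltr_wpDl.
  have np : 0 < - phi x by rewrite oppr_gt0.
  have [y [Ky hy]] := H (- phi x / c) (divr_gt0 np c0).
  have yx : phi y <= phi x by apply: xmax; rewrite inE.
  have : \sum_(j : J) (phi x / c) <= phi y.
    apply: ler_sum => j _; rewrite le_min; apply/andP; split.
      by move: (hy j); rewrite mulNr; lra.
    by rewrite ltW // pmulr_llt0 ?invr_gt0.
  rewrite sumr_const -mulr_natr => /le_trans /(_ yx).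
  rewrite mulrAC ler_pdivrMr // /c; lra.
exists x; split=> // j; rewrite -subr_ge0.
have le0 i : Num.min (G i x - h i) 0 <= 0 by rewrite ge_min lexx orbT.
have : phi x <= Num.min (G j x - h j) 0.
  rewrite /phi (bigD1 j) //= gerDl; apply: sumr_le0 => i _; exact: le0.
by move=> /(le_trans phi0); rewrite le_min => /andP[].
Qed.

End Approximation.

(** * Passage to the limit *)

Section Entropies.
Variables (R : realType) (A B Z : finType) (u : A -> R) (v : B -> R) (V : A -> B -> Z -> R).
Hypotheses (uP : pmf u) (vP : pmf v) (VP : forall a b, pmf (V a b)).

(** Minus the conditional entropy of the output given both inputs. For a fixed channel it is a
    polynomial in [u] and [v], hence continuous. *)
Definition noise : R := \sum_a \sum_b \sum_z u a * v b * V a b z * ln (V a b z).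

Let u0 a : 0 <= u a. Proof. exact: (proj1 uP). Qed.
Let v0 b : 0 <= v b. Proof. exact: (proj1 vP). Qed.
Let V0 a b z : 0 <= V a b z. Proof. exact: (proj1 (VP a b)). Qed.

Lemma xlnxE (x : R) : 0 <= x -> xlnx x = x * ln x.
Proof. by move=> x0; rewrite /xlnx ger0_norm. Qed.

Lemma info_split (D : A -> B -> Z -> R) :
  (forall a b z, 0 < u a * v b * V a b z -> 0 < D a b z) ->
  info u v V D = noise - \sum_a \sum_b \sum_z u a * v b * V a b z * ln (D a b z).
Proof.
move=> D0; rewrite /info (eq_mean uP vP VP (G := fun a b z => ln (V a b z) - ln (D a b z))).
  rewrite /noise -sumrB; apply: eq_bigr => a _; rewrite -sumrB; apply: eq_bigr => b _.
  by rewrite -sumrB; apply: eq_bigr => z _; rewrite mulrBr.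
move=> a b z h; have [h1 _ _ _] := out_gt0 uP vP VP h.
by rewrite ln_div ?posrE // D0.
Qed.

(** In [info] the logarithm has an output probability in its denominator, which may vanish in the
    limit. Here, as in the two lemmas below, this logarithm occurs only inside [xlnx], so the
    right-hand side is continuous in [u] and [v]. *)
Lemma info1_xlnx : info u v V (out1 u V) =
  noise - \sum_b \sum_z v b * xlnx (\sum_a u a * V a b z).
Proof.
rewrite info_split; last by move=> a b z h; case: (out_gt0 uP vP VP h).
congr (_ - _); rewrite exchange_big; apply: eq_bigr => b _.
rewrite exchange_big; apply: eq_bigr => z _.
rewrite xlnxE; last by apply: sumr_ge0 => a _; rewrite mulr_ge0.
rewrite mulrA mulr_sumr mulr_suml; apply: eq_bigr => a _; rewrite /out1; ring.
Qed.

Lemma info2_xlnx : info u v V (out2 v V) =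
  noise - \sum_a \sum_z u a * xlnx (\sum_b v b * V a b z).
Proof.
rewrite info_split; last by move=> a b z h; case: (out_gt0 uP vP VP h).
congr (_ - _); apply: eq_bigr => a _.
rewrite exchange_big; apply: eq_bigr => z _.
rewrite xlnxE; last by apply: sumr_ge0 => b _; rewrite mulr_ge0.
rewrite mulrA mulr_sumr mulr_suml; apply: eq_bigr => b _; rewrite /out2; ring.
Qed.

Lemma info12_xlnx : info u v V (out12 u v V) =
  noise - \sum_z xlnx (\sum_a \sum_b u a * v b * V a b z).
Proof.
rewrite info_split; last by move=> a b z h; case: (out_gt0 uP vP VP h).
congr (_ - _); under eq_bigr do rewrite exchange_big.
rewrite exchange_big; apply: eq_bigr => z _ /=.
rewrite xlnxE; last by apply: sumr_ge0 => a _; apply: sumr_ge0 => b _; rewrite !mulr_ge0.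
rewrite mulr_suml; apply: eq_bigr => a _; rewrite mulr_suml.
by apply: eq_bigr => b _.
Qed.

End Entropies.

Section Compactness.
Variables (R : realType) (X1 X2 : finType).

Local Notation param := ('I_4 + ('I_4 * X1 + 'I_4 * X2))%type.
Local Notation space := 'rV[R]_#|{: param}|.

(** A triple [(pq, p1, p2)] is flattened into one row vector, so that compactness of a cube in
    finite dimension applies. *)
Definition get (x : space) (i : param) : R := x ord0 (enum_rank i).
Definition get_q (x : space) q : R := get x (inl q).
Definition get_1 (x : space) q a : R := get x (inr (inl (q, a))).
Definition get_2 (x : space) q b : R := get x (inr (inr (q, b))).

Lemma get_continuous i : continuous (get^~ i).
Proof. exact: coord_continuous. Qed.

Definition params : set space :=
  [set x | [/\ pmf (get_q x), forall q, pmf (get_1 x q) & forall q, pmf (get_2 x q)]]%classic.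

Let continuous_sub (T : topologicalType) (f g : T -> R) :
  continuous f -> continuous g -> continuous (fun x => f x - g x).
Proof. by move=> cf cg x; apply: continuousB; [exact: cf|exact: cg]. Qed.

Let closed_sum1 (J : finType) (F : J -> space -> R) : (forall j, continuous (F j)) ->
  closed [set x | \sum_j F j x = 1]%classic.
Proof.
move=> cF; have := @preimage_closed _ _ (fun x => \sum_j F j x) [set y : R | y = 1]%classic.
by apply; [move=> x _; exact: continuous_sum|exact: closed_eq].
Qed.

Lemma params_compact : compact params.
Proof.
have -> : params = ([set v : space | forall i, `[0 : R, 1]%classic (v ord0 i)] `&`
   ([set x | \sum_q get_q x q = 1%R] `&`
   (\bigcap_(q in [set: 'I_4]) [set x | \sum_a get_1 x q a = 1%R] `&`
    \bigcap_(q in [set: 'I_4]) [set x | \sum_b get_2 x q b = 1%R])))%classic.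
  apply/seteqP; split=> [x [[q0 q1] h1 h2]|x [box [q1 [h1 h2]]]].
    have le1 (T : finType) (P : T -> R) t : pmf P -> 0 <= P t <= 1.
      by move=> [P0 <-]; rewrite P0 (bigD1 t) //= lerDl sumr_ge0.
    split; last by split=> //; split=> q _; [exact: (proj2 (h1 q))|exact: (proj2 (h2 q))].
    move=> i /=; rewrite in_itv /= -(enum_valK i); case: (enum_val i) => [q|[[q a]|[q b]]].
    - exact: (le1 _ (get_q x) q (conj q0 q1)).
    - exact: (le1 _ (get_1 x q) a (h1 q)).
    - exact: (le1 _ (get_2 x q) b (h2 q)).
  have g0 i : 0 <= get x i by have /= := box (enum_rank i); rewrite in_itv /= => /andP[].
  split; first by split=> [q|]; [exact: g0|exact: q1].
    by move=> q; split; [move=> a; exact: g0|exact: h1].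
  by move=> q; split; [move=> a; exact: g0|exact: h2].
apply: compact_closedI.
  by apply: (@rV_compact R _ (fun=> `[0 : R, 1]%classic)) => i; exact: segment_compact.
apply: closedI; first by apply: closed_sum1 => q; exact: get_continuous.
by apply: closedI; apply: closed_bigI => q _; apply: closed_sum1 => a; exact: get_continuous.
Qed.

Section Rate.
Variables (Z : finType) (V : X1 -> X2 -> Z -> R).
Hypothesis VP : forall a b, pmf (V a b).

(** Defined and continuous on the whole [space]; the identification with the rates is made on
    [params] only, where coordinates are probabilities. *)
Definition xlnx_rate1 (x : space) := \sum_q get_q x q *
  (noise (get_1 x q) (get_2 x q) V -
   \sum_b \sum_z get_2 x q b * xlnx (\sum_a get_1 x q a * V a b z)).
Definition xlnx_rate2 (x : space) := \sum_q get_q x q *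
  (noise (get_1 x q) (get_2 x q) V -
   \sum_a \sum_z get_1 x q a * xlnx (\sum_b get_2 x q b * V a b z)).
Definition xlnx_rate12 (x : space) := \sum_q get_q x q *
  (noise (get_1 x q) (get_2 x q) V -
   \sum_z xlnx (\sum_a \sum_b get_1 x q a * get_2 x q b * V a b z)).

Lemma xlnx_rates x : params x ->
  [/\ xlnx_rate1 x = rate1 V (get_q x) (get_1 x) (get_2 x),
      xlnx_rate2 x = rate2 V (get_q x) (get_1 x) (get_2 x) &
      xlnx_rate12 x = rate12 V (get_q x) (get_1 x) (get_2 x)].
Proof.
move=> [_ h1 h2]; split; apply: eq_bigr => q _; congr (_ * _).
- by rewrite info1_xlnx.
- by rewrite info2_xlnx.
- by rewrite info12_xlnx.
Qed.

Let continuous_xlnx (f : space -> R) : continuous f -> continuous (fun x => xlnx (f x)).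
Proof.
move=> cf x.
exact: (@continuous_comp _ _ _ f (@xlnx R) x (cf x) (@xlnx_continuous R (f x))).
Qed.

Let continuous_const (c : R) : continuous (fun _ : space => c).
Proof. by move=> x; exact: cst_continuous. Qed.

Lemma noise_continuous q : continuous (fun x => noise (get_1 x q) (get_2 x q) V).
Proof.
apply: continuous_sum => a; apply: continuous_sum => b; apply: continuous_sum => z.
do 3!apply: continuous_mul => //; exact: get_continuous.
Qed.

Lemma xlnx_rates_continuous :
  [/\ continuous xlnx_rate1, continuous xlnx_rate2 & continuous xlnx_rate12].
Proof.
split; apply: continuous_sum => q; apply: continuous_mul; try exact: get_continuous;
  apply: continuous_sub; try exact: noise_continuous.
- apply: continuous_sum => b; apply: continuous_sum => z.
  apply: continuous_mul; first exact: get_continuous.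
  apply: continuous_xlnx; apply: continuous_sum => a.
  by apply: continuous_mul => //; exact: get_continuous.
- apply: continuous_sum => a; apply: continuous_sum => z.
  apply: continuous_mul; first exact: get_continuous.
  apply: continuous_xlnx; apply: continuous_sum => b.
  by apply: continuous_mul => //; exact: get_continuous.
- apply: continuous_sum => z; apply: continuous_xlnx.
  apply: continuous_sum => a; apply: continuous_sum => b.
  by apply: continuous_mul => //; apply: continuous_mul; exact: get_continuous.
Qed.

End Rate.

Theorem rates_limit (Z1 Z2 : finType) (V1 : X1 -> X2 -> Z1 -> R) (V2 : X1 -> X2 -> Z2 -> R)
    (h1 h2 h12 : R) :
  (forall a b, pmf (V1 a b)) -> (forall a b, pmf (V2 a b)) ->
  let feasible d := exists (pq : 'I_4 -> R) (p1 : 'I_4 -> X1 -> R) (p2 : 'I_4 -> X2 -> R),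
    [/\ pmf pq, forall q, pmf (p1 q), forall q, pmf (p2 q),
      rates_ge V1 pq p1 p2 (h1 - d) (h2 - d) (h12 - d) &
      rates_ge V2 pq p1 p2 (h1 - d) (h2 - d) (h12 - d)] in
  (forall d, 0 < d -> feasible d) -> feasible 0.
Proof.
move=> V1P V2P feasible H.
(* The boolean is the receiver; [Some true], [Some false] and [None] stand for the first, second and
   sum rate. *)
pose G (j : bool * option bool) (x : space) := match j with
  | (true, Some true) => xlnx_rate1 V1 x | (true, Some false) => xlnx_rate2 V1 x
  | (true, None) => xlnx_rate12 V1 x
  | (false, Some true) => xlnx_rate1 V2 x | (false, Some false) => xlnx_rate2 V2 x
  | (false, None) => xlnx_rate12 V2 x end.
pose h (j : bool * option bool) :=
  match j.2 with Some true => h1 | Some false => h2 | None => h12 end.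
have cG j : continuous (G j).
  have [c1 c2 c3] := xlnx_rates_continuous V1; have [d1 d2 d3] := xlnx_rates_continuous V2.
  by case: j => -[] [[]|].
have [|x [Kx Gx]] := compact_approx (h := h) params_compact cG.
  move=> d /H[pq [p1 [p2 [hq hp1 hp2 g1 g2]]]].
  pose x : space := \row_i match enum_val i with
     | inl q => pq q | inr (inl qa) => p1 qa.1 qa.2 | inr (inr qb) => p2 qb.1 qb.2 end.
  have eq : get_q x = pq by apply: funext => q; rewrite /get_q /get mxE enum_rankK.
  have e1 : get_1 x = p1.
    by apply: funext => q; apply: funext => a; rewrite /get_1 /get mxE enum_rankK.
  have e2 : get_2 x = p2.
    by apply: funext => q; apply: funext => b; rewrite /get_2 /get mxE enum_rankK.
  have Kx : params x by rewrite /params /= eq e1 e2.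
  exists x; split=> //.
  have [a1 a2 a3] := xlnx_rates V1P Kx; have [b1 b2 b3] := xlnx_rates V2P Kx.
  move: g1 g2; rewrite /rates_ge -eq -e1 -e2 -a1 -a2 -a3 -b1 -b2 -b3 => -[? ? ?] [? ? ?].
  by case=> -[] [[]|].
have [hq hp1 hp2] := Kx.
have [a1 a2 a3] := xlnx_rates V1P Kx; have [b1 b2 b3] := xlnx_rates V2P Kx.
exists (get_q x), (get_1 x), (get_2 x); split=> //; rewrite !subr0.
- split; rewrite -?a1 -?a2 -?a3.
  + exact: (Gx (true, Some true)).
  + exact: (Gx (true, Some false)).
  + exact: (Gx (true, None)).
- split; rewrite -?b1 -?b2 -?b3.
  + exact: (Gx (false, Some true)).
  + exact: (Gx (false, Some false)).
  + exact: (Gx (false, None)).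
Qed.

End Compactness.

(** * Entropies and mutual informations of the model *)

Lemma rsumE (T : finType) (A : pred T) (F : T -> R) : rsum A F = \sum_(t | A t) F t.
Proof. by []. Qed.

Lemma is_pmfP (T : finType) (P : T -> R) : is_pmf P <-> pmf P.
Proof.
split=> -[h0 h1]; split=> //.
  by move=> t; apply/RleP; exact: h0.
by move=> t; apply/RleP; exact: h0.
Qed.

Section SourceBridge.
Variables (S1 S2 W : finType) (p : S1 * S2 * W -> R).
Hypothesis pP : pmf p.
Hypothesis pM : markov p (fun t => t.1.1) (fun t => t.1.2) (fun t => t.2).

Definition side_pmf (w : W) : R := \sum_(t | t.2 == w) p t.
(* Letters [w] of probability [0] get the unconditional law, so that [given1 w] is always a pmf. *)
Definition given1 (w : W) (s : S1) : R :=
  if side_pmf w == 0 then \sum_(t | t.1.1 == s) p t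
  else (\sum_(t | (t.1.1 == s) && (t.2 == w)) p t) / side_pmf w.
Definition given2 (w : W) (s : S2) : R :=
  if side_pmf w == 0 then \sum_(t | t.1.2 == s) p t
  else (\sum_(t | (t.1.2 == s) && (t.2 == w)) p t) / side_pmf w.

Let p0 t : 0 <= p t. Proof. exact: (proj1 pP). Qed.

Lemma side_pmfP : pmf side_pmf.
Proof. exact: (image_pmf (fun t => t.2) pP). Qed.

Lemma given_pmf (S : finType) (h : S1 * S2 * W -> S) w :
  pmf (fun s => if side_pmf w == 0 then \sum_(t | h t == s) p t
    else (\sum_(t | (h t == s) && (t.2 == w)) p t) / side_pmf w).
Proof.
case: eqP => [_|/eqP ne]; first exact: image_pmf.
split=> [s|]; first by rewrite divr_ge0 ?sumr_ge0.
rewrite -mulr_suml; apply: (canLR (mulfK ne)); rewrite mul1r.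
rewrite /side_pmf [RHS](partition_big h predT) //=; apply: eq_bigr => s _.
by apply: eq_bigl => t; rewrite andbC.
Qed.

Lemma given1P w : pmf (given1 w). Proof. exact: (given_pmf (fun t => t.1.1)). Qed.
Lemma given2P w : pmf (given2 w). Proof. exact: (given_pmf (fun t => t.1.2)). Qed.

Lemma side_gt0 t : 0 < p t -> 0 < side_pmf t.2.
Proof.
move=> h; apply: (lt_le_trans h); rewrite /side_pmf (bigD1 t) //= lerDl.
exact: sumr_ge0.
Qed.

(** The Markov identity divided by [side_pmf c]. Where [side_pmf c] is [0] both sides vanish,
    whatever value the conditional laws take there. *)
Lemma source_factor : p = source_pmf side_pmf given1 given2.
Proof.
apply: funext => -[[a b] c]; rewrite /source_pmf /given1 /given2 /=.
case: eqP => [e|/eqP ne].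
  rewrite e !mul0r; apply/eqP; rewrite eq_le p0 andbT -{1}e /side_pmf.
  by rewrite (bigD1 (a, b, c)) //= lerDl sumr_ge0.
have := pM a b c; rewrite /prob !rsumE !RmultE.
have -> : \sum_(t : S1 * S2 * W | [&& t.1.1 == a, t.1.2 == b & t.2 == c]) p t = p (a, b, c).
  apply: big_pred1 => -[[x y] z]; by rewrite /= !xpair_eqE andbA.
rewrite -/(side_pmf c) => h.
apply: (mulIf ne); rewrite h; field.
exact: ne.
Qed.

Lemma given1_gt0 t : 0 < p t -> 0 < given1 t.2 t.1.1.
Proof.
rewrite source_factor /source_pmf => h; rewrite lt0r (proj1 (given1P _)) andbT.
by apply: contraTneq h => ->; rewrite mulr0 mul0r ltxx.
Qed.

Lemma given2_gt0 t : 0 < p t -> 0 < given2 t.2 t.1.2.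
Proof.
rewrite source_factor /source_pmf => h; rewrite lt0r (proj1 (given2P _)) andbT.
by apply: contraTneq h => ->; rewrite mulr0 ltxx.
Qed.

Lemma cond_entropyE (S : finType) (h : S1 * S2 * W -> S) :
  cond_entropy p h (fun t => t.2) =
  - \sum_t p t * ln (if side_pmf t.2 == 0 then \sum_(u | h u == h t) p u
    else (\sum_(u | (h u == h t) && (u.2 == t.2)) p u) / side_pmf t.2).
Proof.
rewrite /cond_entropy rsumE RoppE; congr (- _); apply: eq_bigr => t _.
rewrite RlnE RmultE RdivE /prob !rsumE.
have [->|ne] := eqVneq (p t) 0; first by rewrite !mul0r.
have pt : 0 < p t by rewrite lt0r ne p0.
by rewrite gt_eqF ?side_gt0.
Qed.

Lemma entropy12 : - \sum_t p t * ln (given1 t.2 t.1.1 * given2 t.2 t.1.2) =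
  cond_entropy p (fun t => t.1.1) (fun t => t.2) +
  cond_entropy p (fun t => t.1.2) (fun t => t.2).
Proof.
rewrite !cond_entropyE -opprD -big_split; congr (- _); apply: eq_bigr => t _ /=.
rewrite -mulrDr; have [->|ne] := eqVneq (p t) 0; first by rewrite !mul0r.
have pt : 0 < p t by rewrite lt0r ne p0.
by rewrite lnM ?posrE ?given1_gt0 ?given2_gt0.
Qed.

End SourceBridge.

Section ChannelBridge.
Variables (Q X1 X2 Y1 Y2 Z : finType) (pi : Y1 * Y2 -> Z).
Variables (pq : Q -> R) (p1 : Q -> X1 -> R) (p2 : Q -> X2 -> R).
Variable ch : X1 -> X2 -> Y1 * Y2 -> R.
Hypotheses (pqP : pmf pq) (p1P : forall q, pmf (p1 q)) (p2P : forall q, pmf (p2 q)).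
Hypothesis chP : forall x1 x2, pmf (ch x1 x2).

(** The channel seen by one receiver: [pi] is [fst] or [snd], and the computations below serve both
    receivers. *)
Definition output (x1 : X1) (x2 : X2) (z : Z) : R := \sum_(y | pi y == z) ch x1 x2 y.

Lemma outputP x1 x2 : pmf (output x1 x2).
Proof. exact: (image_pmf pi (chP x1 x2)). Qed.

Let P := code_joint pq p1 p2 ch.

Let PE : P = code_pmf pq p1 p2 ch.
Proof. by []. Qed.

Lemma code_joint_prob (aQ : pred Q) (a1 : pred X1) (a2 : pred X2) (aY : pred (Y1 * Y2)) :
  \sum_(t : Q * X1 * X2 * (Y1 * Y2) | [&& aQ t.1.1.1, a1 t.1.1.2, a2 t.1.2 & aY t.2]) P t =
  \sum_(q | aQ q) pq q * \sum_(x1 | a1 x1) p1 q x1 * \sum_(x2 | a2 x2) p2 q x2 *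
    \sum_(y | aY y) ch x1 x2 y.
Proof.
rewrite big_mkcond sum_pair sum_pair sum_pair [RHS]big_mkcond; apply: eq_bigr => q _ /=.
case: (aQ q) => /=; last by rewrite big1 // => x1 _; rewrite big1 // => x2 _; rewrite big1.
rewrite mulr_sumr [RHS]big_mkcond; apply: eq_bigr => x1 _ /=.
case: (a1 x1) => /=; last by rewrite big1 // => x2 _; rewrite big1.
rewrite 2!mulr_sumr [RHS]big_mkcond; apply: eq_bigr => x2 _ /=.
case: (a2 x2) => /=; last by rewrite big1.
rewrite 3!mulr_sumr [RHS]big_mkcond; apply: eq_bigr => y _ /=.
by case: (aY y) => //=; rewrite !mulrA.
Qed.

Lemma code_joint_mean (F : Q -> X1 -> X2 -> Z -> R) :
  \sum_t P t * F t.1.1.1 t.1.1.2 t.1.2 (pi t.2) =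
  \sum_q pq q * \sum_x1 \sum_x2 \sum_z p1 q x1 * p2 q x2 * output x1 x2 z * F q x1 x2 z.
Proof.
rewrite PE (sum_code_pmf pq p1 p2 ch (fun t => F t.1.1.1 t.1.1.2 t.1.2 (pi t.2))) /=.
apply: eq_bigr => q _; congr (_ * _); apply: eq_bigr => x1 _; apply: eq_bigr => x2 _.
under eq_bigr do rewrite -mulrA.
rewrite -mulr_sumr (sum_image (ch x1 x2) pi (F q x1 x2)) mulr_sumr.
by apply: eq_bigr => z _; rewrite mulrA.
Qed.

(** The quotient of probabilities has to be computed only at points of positive probability. There,
    for each of the three informations, the four events are rectangles, given by [code_joint_prob],
    and the common factors cancel. *)
Lemma mutual_info_mean (A C : finType) (fa : Q * X1 * X2 * (Y1 * Y2) -> A) (fc : _ -> C)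
    (F : Q -> X1 -> X2 -> Z -> R) :
  (forall t, 0 < P t ->
    (\sum_(u | [&& fa u == fa t, pi u.2 == pi t.2 & fc u == fc t]) P u) *
    (\sum_(u | fc u == fc t) P u) /
    ((\sum_(u | (fa u == fa t) && (fc u == fc t)) P u) *
     (\sum_(u | (pi u.2 == pi t.2) && (fc u == fc t)) P u)) = F t.1.1.1 t.1.1.2 t.1.2 (pi t.2)) ->
  cond_mutual_info P fa (fun t => pi t.2) fc =
  \sum_q pq q * \sum_x1 \sum_x2 \sum_z p1 q x1 * p2 q x2 * output x1 x2 z * ln (F q x1 x2 z).
Proof.
move=> h; rewrite -(code_joint_mean (fun q x1 x2 z => ln (F q x1 x2 z))).
rewrite /cond_mutual_info rsumE; apply: eq_bigr => t _.
rewrite RlnE RmultE RdivE !RmultE /prob !rsumE.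
have [->|ne] := eqVneq (P t) 0; first by rewrite !mul0r.
have Pt : 0 < P t by rewrite lt0r ne; apply: (proj1 (code_pmfP pqP p1P p2P chP)).
by rewrite (h t Pt).
Qed.

Lemma prob_pick (q : Q) (x1 : X1) (x2 : X2) (z : Z) :
  \sum_(t : Q * X1 * X2 * (Y1 * Y2) |
    [&& t.1.1.1 == q, t.1.1.2 == x1, t.1.2 == x2 & pi t.2 == z]) P t =
  pq q * (p1 q x1 * (p2 q x2 * output x1 x2 z)).
Proof.
rewrite (code_joint_prob (pred1 q) (pred1 x1) (pred1 x2) (fun y => pi y == z)).
by rewrite !big_pred1_eq.
Qed.

Lemma code_joint_gt0 t : 0 < P t ->
  [/\ 0 < pq t.1.1.1, 0 < p1 t.1.1.1 t.1.1.2, 0 < p2 t.1.1.1 t.1.2 &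
      0 < output t.1.1.2 t.1.2 (pi t.2)].
Proof.
move=> h; have [h1 h2 h3] := code_pmf_gt0 p1P p2P chP h; split=> //.
  rewrite lt0r (proj1 pqP) andbT; apply: contraTneq h => h.
  by rewrite PE /code_pmf h !mul0r ltxx.
apply: (lt_le_trans h3); rewrite /output (bigD1 t.2) //= lerDl.
by apply: sumr_ge0 => y _; case: (chP t.1.1.2 t.1.2).
Qed.

Let sum_ch x1 x2 : \sum_y ch x1 x2 y = 1. Proof. exact: (proj2 (chP x1 x2)). Qed.

Lemma mutual_info1 :
  cond_mutual_info P (fun t => t.1.1.2) (fun t => pi t.2) (fun t => (t.1.2, t.1.1.1)) =
  rate1 output pq p1 p2.
Proof.
apply: (@mutual_info_mean _ _ _ _ (fun q x1 x2 z => output x1 x2 z / out1 (p1 q) output x1 x2 z)).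
move=> t /[dup] Pt /code_joint_gt0; case: t Pt => -[[q x1] x2] y Pt /= [hq h1 h2 hV].
have hD : 0 < out1 (p1 q) output x1 x2 (pi y).
  apply: (lt_le_trans _ (out1_le _ _ _ _ _)); first exact: mulr_gt0 h1 hV.
    by case: (p1P q).
  by move=> a b; case: (outputP a b).
have -> : \sum_(u | [&& u.1.1.2 == x1, pi u.2 == pi y & (u.1.2, u.1.1.1) == (x2, q)]) P u =
    pq q * (p1 q x1 * (p2 q x2 * output x1 x2 (pi y))).
  rewrite -prob_pick; apply: eq_bigl => u; rewrite xpair_eqE.
  by case: (_ == x1); case: (_ == q); case: (_ == x2); case: (_ == pi y).
have -> : \sum_(u | (u.1.2, u.1.1.1) == (x2, q)) P u = pq q * p2 q x2.
  rewrite (eq_bigl (fun u => [&& pred1 q u.1.1.1, predT u.1.1.2, pred1 x2 u.1.2 & predT u.2])).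
    rewrite code_joint_prob !big_pred1_eq; congr (_ * _).
    rewrite -[RHS]mul1r -(proj2 (p1P q)) mulr_suml.
    by apply: eq_bigr => a _; rewrite big_pred1_eq sum_ch mulr1.
  by move=> u; rewrite xpair_eqE /= andbT andbC.
have -> : \sum_(u | (u.1.1.2 == x1) && ((u.1.2, u.1.1.1) == (x2, q))) P u =
    pq q * (p1 q x1 * p2 q x2).
  rewrite (eq_bigl (fun u => [&& pred1 q u.1.1.1, pred1 x1 u.1.1.2, pred1 x2 u.1.2 & predT u.2])).
    by rewrite code_joint_prob !big_pred1_eq sum_ch mulr1.
  move=> u; rewrite xpair_eqE /= andbT.
  by case: (_ == x1); case: (_ == q); case: (_ == x2).
have -> : \sum_(u | (pi u.2 == pi y) && ((u.1.2, u.1.1.1) == (x2, q))) P u =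
    pq q * (p2 q x2 * out1 (p1 q) output x1 x2 (pi y)).
  rewrite (eq_bigl (fun u => [&& pred1 q u.1.1.1, predT u.1.1.2, pred1 x2 u.1.2 & pi u.2 == pi y])).
    rewrite (code_joint_prob _ _ _ (fun u => pi u == pi y)) !big_pred1_eq; congr (_ * _).
    rewrite /out1 mulr_sumr; apply: eq_bigr => a _; by rewrite big_pred1_eq -/(output _ _ _) mulrCA.
  move=> u; rewrite xpair_eqE /=.
  by case: (_ == pi y); case: (_ == q); case: (_ == x2).
by field; rewrite !gt_eqF.
Qed.

Lemma mutual_info2 :
  cond_mutual_info P (fun t => t.1.2) (fun t => pi t.2) (fun t => (t.1.1.2, t.1.1.1)) =
  rate2 output pq p1 p2.
Proof.
apply: (@mutual_info_mean _ _ _ _ (fun q x1 x2 z => output x1 x2 z / out2 (p2 q) output x1 x2 z)).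
move=> t /[dup] Pt /code_joint_gt0; case: t Pt => -[[q x1] x2] y Pt /= [hq h1 h2 hV].
have hD : 0 < out2 (p2 q) output x1 x2 (pi y).
  apply: (lt_le_trans _ (out2_le _ _ _ _ _)); first exact: mulr_gt0 h2 hV.
    by case: (p2P q).
  by move=> a b; case: (outputP a b).
have -> : \sum_(u | [&& u.1.2 == x2, pi u.2 == pi y & (u.1.1.2, u.1.1.1) == (x1, q)]) P u =
    pq q * (p1 q x1 * (p2 q x2 * output x1 x2 (pi y))).
  rewrite -prob_pick; apply: eq_bigl => u; rewrite xpair_eqE.
  by case: (_ == x1); case: (_ == q); case: (_ == x2); case: (_ == pi y).
have -> : \sum_(u | (u.1.1.2, u.1.1.1) == (x1, q)) P u = pq q * p1 q x1.
  rewrite (eq_bigl (fun u => [&& pred1 q u.1.1.1, pred1 x1 u.1.1.2, predT u.1.2 & predT u.2])).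
    rewrite code_joint_prob !big_pred1_eq; congr (_ * _); rewrite -[RHS]mulr1 -(proj2 (p2P q)).
    by congr (_ * _); apply: eq_bigr => b _; rewrite sum_ch mulr1.
  by move=> u; rewrite xpair_eqE /= andbT andbC.
have -> : \sum_(u | (u.1.2 == x2) && ((u.1.1.2, u.1.1.1) == (x1, q))) P u =
    pq q * (p1 q x1 * p2 q x2).
  rewrite (eq_bigl (fun u => [&& pred1 q u.1.1.1, pred1 x1 u.1.1.2, pred1 x2 u.1.2 & predT u.2])).
    by rewrite code_joint_prob !big_pred1_eq sum_ch mulr1.
  move=> u; rewrite xpair_eqE /= andbT.
  by case: (_ == x1); case: (_ == q); case: (_ == x2).
have -> : \sum_(u | (pi u.2 == pi y) && ((u.1.1.2, u.1.1.1) == (x1, q))) P u =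
    pq q * (p1 q x1 * out2 (p2 q) output x1 x2 (pi y)).
  rewrite (eq_bigl (fun u => [&& pred1 q u.1.1.1, pred1 x1 u.1.1.2, predT u.1.2 & pi u.2 == pi y])).
    by rewrite (code_joint_prob _ _ _ (fun u => pi u == pi y)) !big_pred1_eq.
  move=> u; rewrite xpair_eqE /=.
  by case: (_ == pi y); case: (_ == q); case: (_ == x1).
by field; rewrite !gt_eqF.
Qed.

Lemma mutual_info12 :
  cond_mutual_info P (fun t => (t.1.1.2, t.1.2)) (fun t => pi t.2) (fun t => t.1.1.1) =
  rate12 output pq p1 p2.
Proof.
apply: (@mutual_info_mean _ _ _ _
  (fun q x1 x2 z => output x1 x2 z / out12 (p1 q) (p2 q) output x1 x2 z)).
move=> t /[dup] Pt /code_joint_gt0; case: t Pt => -[[q x1] x2] y Pt /= [hq h1 h2 hV].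
have hD : 0 < out12 (p1 q) (p2 q) output x1 x2 (pi y).
  apply: (lt_le_trans _ (out12_le _ _ _ _ _ _)); first exact: mulr_gt0 (mulr_gt0 h1 h2) hV.
  - by case: (p1P q).
  - by case: (p2P q).
  - by move=> a b; case: (outputP a b).
have -> : \sum_(u | [&& (u.1.1.2, u.1.2) == (x1, x2), pi u.2 == pi y & u.1.1.1 == q]) P u =
    pq q * (p1 q x1 * (p2 q x2 * output x1 x2 (pi y))).
  rewrite -prob_pick; apply: eq_bigl => u; rewrite xpair_eqE.
  by case: (_ == x1); case: (_ == q); case: (_ == x2); case: (_ == pi y).
have -> : \sum_(u | u.1.1.1 == q) P u = pq q.
  rewrite (eq_bigl (fun u => [&& pred1 q u.1.1.1, predT u.1.1.2, predT u.1.2 & predT u.2])).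
    rewrite code_joint_prob big_pred1_eq -[RHS]mulr1 -(proj2 (p1P q)); congr (_ * _).
    apply: eq_bigr => a _; rewrite -[RHS]mulr1 -(proj2 (p2P q)); congr (_ * _).
    by apply: eq_bigr => b _; rewrite sum_ch mulr1.
  by move=> u; rewrite /= andbT.
have -> : \sum_(u | ((u.1.1.2, u.1.2) == (x1, x2)) && (u.1.1.1 == q)) P u =
    pq q * (p1 q x1 * p2 q x2).
  rewrite (eq_bigl (fun u => [&& pred1 q u.1.1.1, pred1 x1 u.1.1.2, pred1 x2 u.1.2 & predT u.2])).
    by rewrite code_joint_prob !big_pred1_eq sum_ch mulr1.
  move=> u; rewrite xpair_eqE /= andbT.
  by case: (_ == x1); case: (_ == q); case: (_ == x2).
have -> : \sum_(u | (pi u.2 == pi y) && (u.1.1.1 == q)) P u =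
    pq q * out12 (p1 q) (p2 q) output x1 x2 (pi y).
  rewrite (eq_bigl (fun u => [&& pred1 q u.1.1.1, predT u.1.1.2, predT u.1.2 & pi u.2 == pi y])).
    rewrite (code_joint_prob _ _ _ (fun u => pi u == pi y)) big_pred1_eq; congr (_ * _).
    by apply: eq_bigr => a _; rewrite mulr_sumr; apply: eq_bigr => b _; rewrite mulrA.
  by move=> u; rewrite /= andbC.
by field; rewrite !gt_eqF.
Qed.

End ChannelBridge.

(** * The joint error probability and the errors of the two receivers *)

Section ErrorBridge.
Variables (S1 S2 W X1 X2 Y1 Y2 : finType).
Variables (p : S1 * S2 * W -> R) (ch : X1 -> X2 -> Y1 * Y2 -> R).
Hypotheses (pP : pmf p) (chP : forall x1 x2, pmf (ch x1 x2)).
Local Notation V1 := (output fst ch).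
Local Notation V2 := (output snd ch).

Lemma output_fst x1 x2 z : V1 x1 x2 z = \sum_b ch x1 x2 (z, b).
Proof.
rewrite /output big_mkcond sum_pair /= (bigD1 z) //= [X in _ + X]big1 ?addr0.
  by apply: eq_bigr => b _; rewrite eqxx.
by move=> a /negPf ne; apply: big1 => b _; rewrite ne.
Qed.

Lemma output_snd x1 x2 z : V2 x1 x2 z = \sum_a ch x1 x2 (a, z).
Proof.
rewrite /output big_mkcond sum_pair /=; apply: eq_bigr => a _.
by rewrite -big_mkcond big_pred1_eq.
Qed.

Variables (m n : nat).

Section Outputs.
Variables (x1 : n.-tuple X1) (x2 : n.-tuple X2).
Let both (y : n.-tuple Y1 * n.-tuple Y2) : R :=
  \prod_j ch (tnth x1 j) (tnth x2 j) (tnth y.1 j, tnth y.2 j).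

Lemma outputs_fst (F : n.-tuple Y1 -> R) :
  \sum_y both y * F y.1 = \sum_z seqV V1 x1 x2 z * F z.
Proof.
rewrite sum_pair; apply: eq_bigr => z _ /=; rewrite -mulr_suml /both /=; congr (_ * _).
rewrite (families_tuple (fun j b => ch (tnth x1 j) (tnth x2 j) (tnth z j, b))).
by rewrite /seqV; apply: eq_bigr => j _; rewrite output_fst.
Qed.

Lemma outputs_snd (F : n.-tuple Y2 -> R) :
  \sum_y both y * F y.2 = \sum_z seqV V2 x1 x2 z * F z.
Proof.
rewrite sum_pair exchange_big; apply: eq_bigr => z _ /=; rewrite -mulr_suml /both /=; congr (_ * _).
rewrite (families_tuple (fun j a => ch (tnth x1 j) (tnth x2 j) (a, tnth z j))).
by rewrite /seqV; apply: eq_bigr => j _; rewrite output_snd.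
Qed.

Lemma both_ge0 y : 0 <= both y.
Proof. by apply: prodr_ge0 => j _; case: (chP (tnth x1 j) (tnth x2 j)). Qed.

End Outputs.

Variables (f1 : m.-tuple S1 -> n.-tuple X1) (f2 : m.-tuple S2 -> n.-tuple X2).
Variables (g1 : n.-tuple Y1 -> m.-tuple W -> m.-tuple S1 * m.-tuple S2)
          (g2 : n.-tuple Y2 -> m.-tuple W -> m.-tuple S1 * m.-tuple S2).

Let seqS0 (s : m.-tuple S1 * m.-tuple S2 * m.-tuple W) : 0 <= seqS p s.
Proof. by case: (seqSP pP m). Qed.

Let errE : err_prob p ch f1 f2 g1 g2 = \sum_s seqS p s *
  \sum_(y : n.-tuple Y1 * n.-tuple Y2)
    (\prod_j ch (tnth (f1 s.1.1) j) (tnth (f2 s.1.2) j) (tnth y.1 j, tnth y.2 j)) *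
    \1[(g1 y.1 s.2 != s.1) || (g2 y.2 s.2 != s.1)].
Proof.
apply: eq_bigr => s _; congr (_ * _); apply: eq_bigr => y _; congr (_ * _).
by case: ifP.
Qed.

Lemma err_prob_le :
  err_prob p ch f1 f2 g1 g2 <= receiver_error p V1 f1 f2 g1 + receiver_error p V2 f1 f2 g2.
Proof.
rewrite errE /receiver_error -big_split; apply: ler_sum => s _ /=.
rewrite -mulrDr; apply: ler_wpM2l => //.
rewrite -(outputs_fst _ _ (fun z => \1[g1 z s.2 != s.1])).
rewrite -(outputs_snd _ _ (fun z => \1[g2 z s.2 != s.1])) -big_split.
apply: ler_sum => y _ /=; rewrite -mulrDr; apply: ler_wpM2l; first exact: both_ge0.
by case: (g1 _ _ == _); case: (g2 _ _ == _); rewrite -natrD ler_nat.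
Qed.

Lemma receiver_error_le :
  receiver_error p V1 f1 f2 g1 <= err_prob p ch f1 f2 g1 g2 /\
  receiver_error p V2 f1 f2 g2 <= err_prob p ch f1 f2 g1 g2.
Proof.
rewrite errE; split; apply: ler_sum => s _ /=; apply: ler_wpM2l => //.
  rewrite -(outputs_fst _ _ (fun z => \1[g1 z s.2 != s.1])).
  apply: ler_sum => y _ /=; apply: ler_wpM2l; first exact: both_ge0.
  by case: (g1 _ _ == _); case: (g2 _ _ == _); rewrite ler_nat.
rewrite -(outputs_snd _ _ (fun z => \1[g2 z s.2 != s.1])).
apply: ler_sum => y _ /=; apply: ler_wpM2l; first exact: both_ge0.
by case: (g1 _ _ == _); case: (g2 _ _ == _); rewrite ler_nat.
Qed.

End ErrorBridge.

Lemma geometric_small (K e : R) : 0 <= K -> K < 1 -> 0 < e -> exists2 t, (0 < t)%N & K ^+ t < e.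
Proof.
move=> K0 K1 e0.
have /cvgr_lt/(_ e e0)[N _ h] : (GRing.exp K @ \oo --> (0 : R))%classic.
  by apply: cvg_expr; rewrite ger0_norm.
by exists N.+1 => //; apply: h => /=.
Qed.

(** * Achievability and converse for the compound channel *)

Section Main.
Variables (S1 S2 W X1 X2 Y1 Y2 : finType).
Variables (p : S1 * S2 * W -> R) (ch : X1 -> X2 -> Y1 * Y2 -> R).
Hypotheses (pP : pmf p) (chP : forall x1 x2, pmf (ch x1 x2)).
Hypothesis pM : markov p (fun t => t.1.1) (fun t => t.1.2) (fun t => t.2).
Local Notation V1 := (output fst ch).
Local Notation V2 := (output snd ch).
Local Notation H1 := (cond_entropy p (fun t => t.1.1) (fun t => t.2)).
Local Notation H2 := (cond_entropy p (fun t => t.1.2) (fun t => t.2)).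

Lemma region_condE rel b (Q : finType) (pq : Q -> R) (p1 : Q -> X1 -> R) (p2 : Q -> X2 -> R) :
  pmf pq -> (forall q, pmf (p1 q)) -> (forall q, pmf (p2 q)) ->
  region_cond rel p ch b pq p1 p2 <->
  (rel H1 (b * rate1 V1 pq p1 p2) /\ rel H2 (b * rate2 V1 pq p1 p2) /\
   rel (H1 + H2) (b * rate12 V1 pq p1 p2) /\
   rel H1 (b * rate1 V2 pq p1 p2) /\ rel H2 (b * rate2 V2 pq p1 p2) /\
   rel (H1 + H2) (b * rate12 V2 pq p1 p2)).
Proof.
move=> hq h1 h2; rewrite /region_cond.
rewrite (mutual_info1 fst) // (mutual_info2 fst) // (mutual_info12 fst) //.
by rewrite (mutual_info1 snd) // (mutual_info2 snd) // (mutual_info12 snd).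
Qed.

Lemma gap_of_rate (m0 n0 : nat) (b H I : R) : (0 < m0)%N -> b = n0%:R / m0%:R ->
  H < b * I -> 0 < m0%:R * - H + n0%:R * I.
Proof.
move=> m00 -> h; have m0R : 0 < m0%:R :> R by rewrite ltr0n.
have : m0%:R * H < m0%:R * (n0%:R / m0%:R * I) by rewrite ltr_pM2l.
have -> : m0%:R * (n0%:R / m0%:R * I) = n0%:R * I by field; rewrite gt_eqF.
lra.
Qed.

Lemma direct_part b (m0 n0 : nat) : (0 < m0)%N -> (0 < n0)%N -> b = n0%:R / m0%:R ->
  region_exists Rlt p ch b -> achievable p ch b.
Proof.
move=> m00 n00 bE [Q [pq [p1 [p2 [_ [/is_pmfP pqP [p1P' [p2P' reg]]]]]]]].
have p1P q : pmf (p1 q) by apply/is_pmfP.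
have p2P q : pmf (p2 q) by apply/is_pmfP.
move: reg => /(region_condE _ _ pqP p1P p2P).
move=> [/RltP r1 [/RltP r2 [/RltP r3 [/RltP r4 [/RltP r5 /RltP r6]]]]].
pose c1 := given1 p; pose c2 := given2 p.
have c1P := given1P pP; have c2P := given2P pP.
have c1_gt0 := given1_gt0 pP pM; have c2_gt0 := given2_gt0 pP pM.
have E1 : - H1 = \sum_s p s * ln (weight1 c1 s) by rewrite (cond_entropyE pP) opprK.
have E2 : - H2 = \sum_s p s * ln (weight2 c2 s) by rewrite (cond_entropyE pP) opprK.
have E12 : - (H1 + H2) = \sum_s p s * ln (weight12 c1 c2 s).
  by rewrite -(entropy12 pP pM) opprK.
have I1 (Z : finType) (V : X1 -> X2 -> Z -> R) :
    rate1 V pq p1 p2 = \sum_t code_pmf pq p1 p2 V t * ln (ratio1 p1 V t).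
  by rewrite sum_code_pmf.
have I2 (Z : finType) (V : X1 -> X2 -> Z -> R) :
    rate2 V pq p1 p2 = \sum_t code_pmf pq p1 p2 V t * ln (ratio2 p2 V t).
  by rewrite sum_code_pmf.
have I12 (Z : finType) (V : X1 -> X2 -> Z -> R) :
    rate12 V pq p1 p2 = \sum_t code_pmf pq p1 p2 V t * ln (ratio12 p1 p2 V t).
  by rewrite sum_code_pmf.
have {}r1 := gap_of_rate m00 bE r1; have {}r2 := gap_of_rate m00 bE r2.
have {}r3 := gap_of_rate m00 bE r3; have {}r4 := gap_of_rate m00 bE r4.
have {}r5 := gap_of_rate m00 bE r5; have {}r6 := gap_of_rate m00 bE r6.
rewrite E1 I1 in r1; rewrite E2 I2 in r2; rewrite E12 I12 in r3.
rewrite E1 I1 in r4; rewrite E2 I2 in r5; rewrite E12 I12 in r6.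
(* One exponent [d] below all six gaps, since both receivers are analysed on the same random
   codebook. *)
have margin (x1 x2 x3 x4 x5 x6 : R) : 0 < x1 -> 0 < x2 -> 0 < x3 -> 0 < x4 -> 0 < x5 -> 0 < x6 ->
    exists d, [/\ 0 < d, d < x1, d < x2, d < x3 & [/\ d < x4, d < x5 & d < x6]].
  move=> h1 h2 h3 h4 h5 h6.
  pose d := Num.min (Num.min (Num.min x1 x2) (Num.min x3 x4)) (Num.min x5 x6).
  have d0 : 0 < d by rewrite /d !lt_min h1 h2 h3 h4 h5 h6.
  have [l1 l2 l3 [l4 l5 l6]] : [/\ d <= x1, d <= x2, d <= x3 & [/\ d <= x4, d <= x5 & d <= x6]].
    by split; [..|split]; rewrite /d !ge_min lexx ?orbT.
  by exists (d / 2); split; [..|split]; lra.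
have [d [d0 d1 d2 d3 [d4 d5 d6]]] := margin _ _ _ _ _ _ r1 r2 r3 r4 r5 r6.
have V1P := outputP fst chP; have V2P := outputP snd chP.
have [K1 [K10 K11 g1]] := random_coding pP c1P c2P pqP p1P p2P c1_gt0 c2_gt0 V1P d0 d1 d2 d3.
have [K2 [K20 K21 g2]] := random_coding pP c1P c2P pqP p1P p2P c1_gt0 c2_gt0 V2P d0 d4 d5 d6.
move=> eps /RltP eps0.
pose K := Num.max K1 K2.
(* The mean errors of the two receivers are at most [6 * K1 ^+ t] and [6 * K2 ^+ t], hence the [12];
   [t > 0] keeps the block lengths positive. *)
have [t t0 ht] : exists2 t, (0 < t)%N & K ^+ t < eps / 12.
  by apply: geometric_small; rewrite ?le_max ?K10 // ?gt_max ?K11 // divr_gt0.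
have le1 : K1 ^+ t <= K ^+ t by rewrite lerXn2r ?nnegrE ?le_max ?K10 ?lexx.
have le2 : K2 ^+ t <= K ^+ t by rewrite lerXn2r ?nnegrE ?le_max ?K20 ?lexx ?orbT.
have [[[a1 a2] _] _] := pmf_witness pP.
pose s0 : (m0 * t).-tuple S1 * (m0 * t).-tuple S2 := (nseq_tuple _ a1, nseq_tuple _ a2).
(* The sum of both errors is averaged, so that a single codebook is good for the two receivers at
   once. *)
pose F (C : codebook S1 S2 Q X1 X2 (m0 * t) (n0 * t)) :=
  receiver_error p V1 C.2.1 C.2.2 (decoder c1 c2 p1 p2 V1 (expR (t%:R * d)) s0 C) +
  receiver_error p V2 C.2.1 C.2.2 (decoder c1 c2 p1 p2 V2 (expR (t%:R * d)) s0 C).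
have [C hC] := exists_le_mean F (codebook_pmfP S1 S2 pqP p1P p2P (m0 * t) (n0 * t)).
exists (m0 * t)%N, (n0 * t)%N; rewrite !muln_gt0 m00 n00 t0; split=> //; split=> //; split.
  rewrite !INRE RdivE bE !natrM -mulf_div divff ?mulr1 //.
  by rewrite pnatr_eq0 -lt0n.
exists C.2.1, C.2.2, (decoder c1 c2 p1 p2 V1 (expR (t%:R * d)) s0 C),
  (decoder c1 c2 p1 p2 V2 (expR (t%:R * d)) s0 C); apply/RltP.
apply: le_lt_trans (err_prob_le pP chP _ _ _ _) _.
apply: (le_lt_trans hC).
rewrite /F; under eq_bigr do rewrite mulrDr.
rewrite big_split /=.
move: (g1 t s0) (g2 t s0); lra.
Qed.

(** [J] is uniform on the [n] channel uses, so a sum over uses is [n] times a mean over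
    [(W^m, J)]. *)
Lemma rate_block (m n : nat) (w : m.-tuple W -> R) (G : m.-tuple W -> 'I_n -> R) : (0 < n)%N ->
  \sum_w0 w w0 * (\sum_j G w0 j) = n%:R * \sum_(q : m.-tuple W * 'I_n) (w q.1 / n%:R) * G q.1 q.2.
Proof.
move=> n0; rewrite sum_pair mulr_sumr; apply: eq_bigr => x _ /=.
rewrite !mulr_sumr; apply: eq_bigr => j _; field.
by rewrite pnatr_eq0 -lt0n.
Qed.

Lemma converse_part b : achievable p ch b -> region_exists Rle p ch b.
Proof.
move=> ach.
have b0 : 0 < b.
  have [m [n [m0 [n0 [<- _]]]]] := ach 1%R (ltac:(exact/RltP)).
  by rewrite RdivE !INRE divr_gt0 // ltr0n.
pose c1 := given1 p; pose c2 := given2 p; pose pW := side_pmf p.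
have c1P := given1P pP; have c2P := given2P pP; have pWP := side_pmfP pP.
have pE : p = source_pmf pW c1 c2 := source_factor pP pM.
have V1P := outputP fst chP; have V2P := outputP snd chP.
have E1 : H1 = - \sum_s source_pmf pW c1 c2 s * ln (c1 s.2 s.1.1) by rewrite (cond_entropyE pP) -pE.
have E2 : H2 = - \sum_s source_pmf pW c1 c2 s * ln (c2 s.2 s.1.2) by rewrite (cond_entropyE pP) -pE.
have E12 : H1 + H2 = - \sum_s source_pmf pW c1 c2 s * ln (c1 s.2 s.1.1 * c2 s.2 s.1.2).
  by rewrite -(entropy12 pP pM) -pE.
have : exists (pq : 'I_4 -> R) (p1 : 'I_4 -> X1 -> R) (p2 : 'I_4 -> X2 -> R),
    [/\ pmf pq, forall q, pmf (p1 q), forall q, pmf (p2 q),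
      rates_ge V1 pq p1 p2 (H1 / b - 0) (H2 / b - 0) ((H1 + H2) / b - 0) &
      rates_ge V2 pq p1 p2 (H1 / b - 0) (H2 / b - 0) ((H1 + H2) / b - 0)].
  apply: rates_limit => // d d0.
  (* After division by [b] this becomes [d / 2] in each inequality, so that two single rates
     together lose [d], the loss that [rates_limit] admits in the sum rate. *)
  pose dl := d * b / 2.
  have dl0 : 0 < dl by rewrite divr_gt0 ?mulr_gt0.
  have [e e0 conv] := converse_bounds X1 X2 pWP c1P c2P dl0.
  have [m [n [m0 [n0 [bE [f1 [f2 [g1 [g2 /RltP he]]]]]]]]] := ach e (ltac:(exact/RltP)).
  rewrite RdivE !INRE in bE.
  have [l1 l2] := receiver_error_le pP chP f1 f2 g1 g2.
  have {}l1 := ltW (le_lt_trans l1 he); have {}l2 := ltW (le_lt_trans l2 he).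
  rewrite [in receiver_error _ _ _ _ _]pE in l1; rewrite [in receiver_error _ _ _ _ _]pE in l2.
  pose Q := (m.-tuple W * 'I_n)%type.
  pose pq (q : Q) := seqW pW q.1 / n%:R.
  pose p1 (q : Q) := input1 c1 f1 q.1 q.2; pose p2 (q : Q) := input2 c2 f2 q.1 q.2.
  have mR : 0 < m%:R :> R by rewrite ltr0n.
  have nR : 0 < n%:R :> R by rewrite ltr0n.
  have pqP : pmf pq.
    have [s0 s1] := seqWP pWP m.
    split=> [q|]; first by rewrite divr_ge0 // ltW.
    rewrite sum_pair -[RHS]s1; apply: eq_bigr => w _.
    by rewrite /pq /= sumr_const card_ord -[LHS]mulr_natr divfK // gt_eqF.
  have p1P q : pmf (p1 q) by exact: input1P.
  have p2P q : pmf (p2 q) by exact: input2P.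
  have sc (h I : R) : m%:R * (h - dl) <= n%:R * I -> h / b - d / 2 <= I.
    move=> le; have -> : h / b - d / 2 = (h - dl) / b by rewrite /dl; field; rewrite gt_eqF.
    rewrite ler_pdivrMr // -bE mulrA ler_pdivlMr // mulrC [I * _]mulrC //.
  pose h1 := Num.max (H1 / b - d / 2) 0; pose h2 := Num.max (H2 / b - d / 2) 0.
  have block (Z : finType) (V : X1 -> X2 -> Z -> R) (D : (X1 -> R) -> (X2 -> R) -> _) :
      \sum_w seqW pW w * (\sum_j info (input1 c1 f1 w j) (input2 c2 f2 w j) V
        (D (input1 c1 f1 w j) (input2 c2 f2 w j))) =
      n%:R * \sum_q pq q * info (p1 q) (p2 q) V (D (p1 q) (p2 q)).
    exact: (@rate_block m n (fun w => seqW pW w) (fun w j => info _ _ V (D _ _)) n0).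
  have key (Z : finType) (V : X1 -> X2 -> Z -> R) g : (forall a b, pmf (V a b)) ->
      receiver_error (source_pmf pW c1 c2) V f1 f2 g <= e -> rates_ge V pq p1 p2 h1 h2 (h1 + h2).
    move=> VP /(conv _ _ _ _ _ _ _ VP m0) /=; rewrite -E1 -E2 -E12 => -[].
    rewrite (block _ V (fun u _ => out1 u V)) => /sc k1.
    rewrite (block _ V (fun _ v => out2 v V)) => /sc k2.
    rewrite (block _ V (fun u v => out12 u v V)) => /sc; rewrite -/(rate12 V pq p1 p2) => k3.
    have pq0 q : 0 <= pq q by case: pqP.
    have r1 : 0 <= rate1 V pq p1 p2.
      by apply: sumr_ge0 => q _; rewrite mulr_ge0 // info1_ge0.
    have r2 : 0 <= rate2 V pq p1 p2.
      by apply: sumr_ge0 => q _; rewrite mulr_ge0 // info2_ge0.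
    have r13 : rate1 V pq p1 p2 <= rate12 V pq p1 p2.
      by apply: ler_sum => q _; rewrite ler_wpM2l // info1_le12.
    have r23 : rate2 V pq p1 p2 <= rate12 V pq p1 p2.
      by apply: ler_sum => q _; rewrite ler_wpM2l // info2_le12.
    have k1' : h1 <= rate1 V pq p1 p2 by rewrite ge_max k1.
    have k2' : h2 <= rate2 V pq p1 p2 by rewrite ge_max k2.
    split; [exact: k1'|exact: k2'|].
    rewrite [(_ + _) / b]mulrDl in k3; move: k1' k2'; rewrite /h1 /h2.
    (* When both targets are positive the sum inequality [k3] suffices. If one is truncated at [0],
       the other is bounded by a single rate, itself at most the sum rate. *)
    by case: (leP (H1 / b - d / 2) 0) => ?; case: (leP (H2 / b - d / 2) 0) => ? ? ?; lra.
  have key1 := key _ _ _ V1P l1; have key2 := key _ _ _ V2P l2.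
  have [rq [r1 [r2 [rqP r1P r2P t1 t2]]]] := time_sharing_four V1P V2P pqP p1P p2P key1 key2.
  exists rq, r1, r2; split=> //.
    move: t1 => [t1 t2' t3]; split.
    - apply: le_trans t1; rewrite /h1 le_max; apply/orP; left; lra.
    - apply: le_trans t2'; rewrite /h2 le_max; apply/orP; left; lra.
    - apply: le_trans t3; rewrite mulrDl.
      have : H1 / b - d / 2 <= h1 by rewrite le_max lexx.
      have : H2 / b - d / 2 <= h2 by rewrite le_max lexx.
      lra.
  move: t2 => [t1' t2' t3]; split.
  - apply: le_trans t1'; rewrite /h1 le_max; apply/orP; left; lra.
  - apply: le_trans t2'; rewrite /h2 le_max; apply/orP; left; lra.
  - apply: le_trans t3; rewrite mulrDl.
    have : H1 / b - d / 2 <= h1 by rewrite le_max lexx.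
    have : H2 / b - d / 2 <= h2 by rewrite le_max lexx.
    lra.
move=> [pq [p1 [p2 [pqP p1P p2P]]]]; rewrite !subr0 => -[a1 a2 a3] [b1 b2 b3].
exists 'I_4, pq, p1, p2; rewrite card_ord; split=> //; split; first by apply/is_pmfP.
split; first by move=> q; apply/is_pmfP.
split; first by move=> q; apply/is_pmfP.
apply/(region_condE _ _ pqP p1P p2P).
have conv h r : h / b <= r -> Rle h (b * r).
  by move=> le; apply/RleP; rewrite RmultE mulrC -ler_pdivrMr.
by repeat split; apply: conv.
Qed.

End Main.

Local Open Scope R_scope.

Theorem theorem8 (S1 S2 W X1 X2 Y1 Y2 : finType)
  (p : S1 * S2 * W -> R) (ch : X1 -> X2 -> Y1 * Y2 -> R)
  (Hp : is_pmf p) (Hch : forall x1 x2, is_pmf (ch x1 x2))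
  (Hmarkov : markov p (fun t => t.1.1) (fun t => t.1.2) (fun t => t.2)) :
  (forall b : R,
     (exists m0 n0 : nat, (0 < m0)%N /\ (0 < n0)%N /\ b = INR n0 / INR m0) ->
     region_exists Rlt p ch b -> achievable p ch b) /\
  (forall b : R, achievable p ch b -> region_exists Rle p ch b).
Proof.
have pP := (is_pmfP p).1 Hp.
have chP x1 x2 := (is_pmfP (ch x1 x2)).1 (Hch x1 x2).
split=> [b [m0 [n0 [hm [hn hb]]]]|b]; last exact: converse_part.
by apply: (direct_part pP chP Hmarkov hm hn); rewrite hb RdivE !INRE.
Qed.
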